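(* Given a rooted tree $T=(V,A)$ with $n$ vertices, a function $t:V\to\mathbb{R}$, and a Lipschitz constant $\gamma\ge 0$, the $\gamma$-Lipschitz isotonic regression of $t$ on $T$ can be found in $O(n\log n)$ time.
   Context: The arcs of the rooted tree are directed from each child to its parent, i.e. $(u,v)\in A$ iff $u$ is a child of $v$. The $\gamma$-Lipschitz isotonic regression of $t$ on $T$ is the function $s:V\to\mathbb{R}$ minimizing $\sum_{v\in V}(s(v)-t(v))^2$ subject to $s(u)\le s(v)\le s(u)+\gamma$ for all $(u,v)\in A$. *)

(* Defs.v *)
From HB Require Import structures.
From mathcomp Require Import all_boot all_order all_algebra.
From mathcomp Require Import all_classical all_reals all_analysis.

Set Implicit Arguments.
Unset Strict Implicit.
Unset Printing Implicit Defensive.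

Import Order.TTheory GRing.Theory Num.Theory.
Import numFieldNormedType.Exports.

Local Open Scope ring_scope.

(* [A u v] is the arc from the child [u] to its parent [v]. *)
Definition rooted_tree (V : finType) (A : rel V) (r : V) : Prop :=
  [/\ forall v, ~~ A r v,
      forall u, u != r -> exists! v, A u v
    & forall u, connect A u r].

Section Regression.
Variables (R : realType) (V : finType) (A : rel V).

Definition lipschitz_isotonic (gamma : R) (s : V -> R) : Prop :=
  forall u v, A u v -> s u <= s v <= s u + gamma.

Definition sq_error (t s : V -> R) : R := \sum_v (s v - t v) ^+ 2.

Definition is_LIR (t : V -> R) (gamma : R) (s : V -> R) : Prop :=
  lipschitz_isotonic gamma s /\
  forall s', lipschitz_isotonic gamma s' -> sq_error t s <= sq_error t s'.

End Regression.

(* The model of computation is a structured real RAM. A state has integer and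
   real registers, and integer and real arrays indexed by integers; a program
   can only mention finitely many registers and arrays, so the arrays play the
   role of the memory of the machine. The operations on reals are exact field
   operations and comparison, without rounding to integers. Integers only have
   successor, predecessor and comparison, so that they remain bounded by a
   linear function of the input size and of the number of steps, and unit cost
   cannot be abused by packing data into large integers. *)

Inductive iexp : Type :=
  | ICst of nat
  | IVar of nat
  | ISucc of iexp
  | IPred of iexp
  | IGet of nat & iexp.

Inductive rop : Type := RAdd | RSub | RMul | RDiv.

Inductive rexp : Type :=
  | RCst of nat
  | RVar of nat
  | RGet of nat & iexp
  | ROp of rop & rexp & rexp.

Inductive bexp : Type :=
  | BIeq of iexp & iexp
  | BIle of iexp & iexp
  | BRle of rexp & rexp
  | BNot of bexp
  | BAnd of bexp & bexp.

Inductive cmd : Type :=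
  | Skip
  | ISet of nat & iexp
  | RSet of nat & rexp
  | IPut of nat & iexp & iexp
  | RPut of nat & iexp & rexp
  | Seq of cmd & cmd
  | If of bexp & cmd & cmd
  | While of bexp & cmd
  | Call of nat.

(* The list of the procedure bodies. Procedures may be recursive; they have
   neither parameters nor local variables. Execution starts with procedure 0. *)
Definition program := seq cmd.

Definition upd (T : Type) (f : nat -> T) (i : nat) (x : T) : nat -> T :=
  fun j => if j == i then x else f j.

Section Semantics.
Variable R : realType.

Record state := State {
  ivar : nat -> nat;
  rvar : nat -> R;
  iarr : nat -> nat -> nat;
  rarr : nat -> nat -> R }.

Implicit Type st : state.

Fixpoint ieval st (e : iexp) : nat :=
  match e with
  | ICst n => n
  | IVar x => ivar st x
  | ISucc e => (ieval st e).+1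
  | IPred e => (ieval st e).-1
  | IGet a e => iarr st a (ieval st e)
  end.

Definition rop_eval (o : rop) (x y : R) : R :=
  match o with
  | RAdd => x + y
  | RSub => x - y
  | RMul => x * y
  | RDiv => x / y
  end.

Fixpoint reval st (e : rexp) : R :=
  match e with
  | RCst n => n%:R
  | RVar x => rvar st x
  | RGet a e => rarr st a (ieval st e)
  | ROp o e1 e2 => rop_eval o (reval st e1) (reval st e2)
  end.

Fixpoint beval st (b : bexp) : bool :=
  match b with
  | BIeq e1 e2 => ieval st e1 == ieval st e2
  | BIle e1 e2 => (ieval st e1 <= ieval st e2)%N
  | BRle e1 e2 => reval st e1 <= reval st e2
  | BNot b => ~~ beval st b
  | BAnd b1 b2 => beval st b1 && beval st b2
  end.

Definition set_ivar st x (n : nat) :=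
  State (upd (ivar st) x n) (rvar st) (iarr st) (rarr st).

Definition set_rvar st x (y : R) :=
  State (ivar st) (upd (rvar st) x y) (iarr st) (rarr st).

Definition set_iarr st a i (n : nat) :=
  State (ivar st) (rvar st) (upd (iarr st) a (upd (iarr st a) i n)) (rarr st).

Definition set_rarr st a i (y : R) :=
  State (ivar st) (rvar st) (iarr st) (upd (rarr st) a (upd (rarr st a) i y)).

(* [exec p c st k st']: running [c] from [st] terminates in [st'] after [k]
   steps. Every assignment, test and call is one step: the expressions are part
   of the program, hence of size bounded independently of the input. *)
Inductive exec (p : program) : cmd -> state -> nat -> state -> Prop :=
  | ExecSkip st : exec p Skip st 1 st
  | ExecISet st x e : exec p (ISet x e) st 1 (set_ivar st x (ieval st e))
  | ExecRSet st x e : exec p (RSet x e) st 1 (set_rvar st x (reval st e))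
  | ExecIPut st a i e :
      exec p (IPut a i e) st 1 (set_iarr st a (ieval st i) (ieval st e))
  | ExecRPut st a i e :
      exec p (RPut a i e) st 1 (set_rarr st a (ieval st i) (reval st e))
  | ExecSeq st1 st2 st3 k1 k2 c1 c2 :
      exec p c1 st1 k1 st2 -> exec p c2 st2 k2 st3 ->
      exec p (Seq c1 c2) st1 (k1 + k2)%N st3
  | ExecIf st st' k b c1 c2 :
      exec p (if beval st b then c1 else c2) st k st' ->
      exec p (If b c1 c2) st k.+1 st'
  | ExecWhileFalse st b c :
      ~~ beval st b -> exec p (While b c) st 1 st
  | ExecWhileTrue st1 st2 st3 k1 k2 b c :
      beval st1 b -> exec p c st1 k1 st2 -> exec p (While b c) st2 k2 st3 ->
      exec p (While b c) st1 (k1 + k2).+1 st3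
  | ExecCall st st' k f :
      exec p (nth Skip p f) st k st' -> exec p (Call f) st k.+1 st'.

Definition runs (p : program) st k st' : Prop := exec p (Call 0) st k st'.

(* The vertices are numbered by [num], and the tree is given by its parent
   array, in which the root is its own parent. Registers and memory cells that
   do not hold the input may initially have any content. *)
Definition holds_input (V : finType) (A : rel V) (r : V) (num : V -> 'I_#|V|)
    (t : V -> R) (gamma : R) st : Prop :=
  [/\ ivar st 0 = #|V|,
      rvar st 0 = gamma,
      forall u v, A u v -> iarr st 0 (num u) = num v,
      iarr st 0 (num r) = num r
    & forall v, rarr st 0 (num v) = t v].

Definition output (V : finType) (num : V -> 'I_#|V|) st (v : V) : R :=
  rarr st 1 (num v).

End Semantics.

(* Main.v *)
(* Let f_u(x) be half the derivative, at x, of the least cost of the subtree of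
   a vertex u when s(u) = x. Then f_u(x) = x - t(u) + sum_c f_c(clamp_c x), over
   the children c of u, where clamp_c x = min(x, max(m_c, x - gamma)) and m_c is
   the zero of f_c; each f_u is continuous, piecewise linear and increases with
   slope at least 1. The regression is s(r) = m_r at the root and
   s(c) = clamp_c(s(parent of c)) elsewhere: the numbers f_c(s(c)) are the
   Karush-Kuhn-Tucker multipliers of the arcs.

   The breakpoints of f_u are the leaves of a 2-3 tree, each given by its gap to
   the preceding one, and every subtree carries its total gap, total change of
   slope, and moment, so that m_u is found by a descent. Passing from f_u to
   f_u o clamp_u inserts the breakpoints m_u and m_u + gamma, and moves all the
   later ones by gamma, which changes a single gap. A sum of two such functions
   is formed by inserting all the breakpoints of the smaller tree into the larger
   one in a single traversal: m sorted insertions into n leaves take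
   O(m (1 + log(n/m))) steps, which the potential sum_u n_u log n_u pays for, n_u
   being the number of breakpoints of the current f_u. Vertices are processed
   once all their children have been, and s is read off in the opposite order. *)
Require Import Defs.
From mathcomp Require Import all_boot all_order all_algebra.
From mathcomp Require Import all_classical all_reals all_analysis.
From mathcomp Require Import zify ring lra.

Import Order.TTheory GRing.Theory Num.Theory.
Import numFieldNormedType.Exports.

Local Open Scope classical_set_scope.
Local Open Scope ring_scope.

Set Implicit Arguments.
Unset Strict Implicit.
Unset Printing Implicit Defensive.

(** * Execution and cost of programs *)

Section Machine.
Variable R : realType.
Implicit Types (st : state R) (p : program) (c : cmd).
Local Open Scope nat_scope.

(** Optimality rests on three facts about the f_u (the recurrence, steepness, the zeros m_u), which
    yield a variational inequality directly; the program only has to exhibit numbers that satisfy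
    them. Procedures have no local variables and heap cells are never overwritten: stack links and
    updated nodes are fresh cells, subtrees may be shared, and a fact about a tree survives any
    computation that merely lets the heap grow. Correctness of insertion is stated on the flat list
    of leaves, as a scan that composes along concatenation and so forgets the shape of the tree. The
    bound log(n/m) does not show in the recursion. A threshold height J, absent from the program, is
    used in the analysis only and chosen at the end: near log(n/m) for a merge, the logarithm of the
    whole list for the two breakpoints of one vertex. Each processed vertex creates exactly two
    breakpoints and none is lost, so all lists together stay below 2n breakpoints and the final
    potential is O(n log n). *)

Definition ev p c st (Q : nat -> state R -> Prop) :=
  exists k st', exec p c st k st' /\ Q k st'.

(** The execution itself is handed over too: frame and heap properties are read off a run after its
    specification has been applied. *)
Lemma ev_conseq p c st (Q Q' : nat -> state R -> Prop) :
  ev p c st Q -> (forall k st', exec p c st k st' -> Q k st' -> Q' k st') ->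
  ev p c st Q'.
Proof. by move=> [k [st' [e q]]] h; exists k, st'; split=> //; apply: h. Qed.

Lemma ev_skip p st (Q : nat -> state R -> Prop) : Q 1 st -> ev p Skip st Q.
Proof. by exists 1, st; split=> //; constructor. Qed.

Lemma ev_iset p x e st (Q : nat -> state R -> Prop) :
  Q 1 (set_ivar st x (ieval st e)) -> ev p (ISet x e) st Q.
Proof. by move=> q; eexists _, _; split; [constructor | exact: q]. Qed.

Lemma ev_rset p x e st (Q : nat -> state R -> Prop) :
  Q 1 (set_rvar st x (reval st e)) -> ev p (RSet x e) st Q.
Proof. by move=> q; eexists _, _; split; [constructor | exact: q]. Qed.

Lemma ev_iput p a i e st (Q : nat -> state R -> Prop) :
  Q 1 (set_iarr st a (ieval st i) (ieval st e)) -> ev p (IPut a i e) st Q.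
Proof. by move=> q; eexists _, _; split; [constructor | exact: q]. Qed.

Lemma ev_rput p a i e st (Q : nat -> state R -> Prop) :
  Q 1 (set_rarr st a (ieval st i) (reval st e)) -> ev p (RPut a i e) st Q.
Proof. by move=> q; eexists _, _; split; [constructor | exact: q]. Qed.

Lemma ev_seq p c1 c2 st (Q : nat -> state R -> Prop) :
  ev p c1 st (fun k1 st1 => ev p c2 st1 (fun k2 => Q (k1 + k2))) ->
  ev p (Seq c1 c2) st Q.
Proof.
move=> [k1 [st1 [e1 [k2 [st2 [e2 q]]]]]].
by exists (k1 + k2), st2; split=> //; exact: ExecSeq e1 e2.
Qed.

Lemma ev_if p b c1 c2 st (Q : nat -> state R -> Prop) :
  ev p (if beval st b then c1 else c2) st (fun k => Q k.+1) ->
  ev p (If b c1 c2) st Q.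
Proof. by move=> [k [st' [e q]]]; exists k.+1, st'; split=> //; constructor. Qed.

Lemma ev_call p f st (Q : nat -> state R -> Prop) :
  ev p (nth Skip p f) st (fun k => Q k.+1) -> ev p (Call f) st Q.
Proof. by move=> [k [st' [e q]]]; exists k.+1, st'; split=> //; constructor. Qed.

Lemma ev_while_end p b c st (Q : nat -> state R -> Prop) :
  ~~ beval st b -> Q 1 st -> ev p (While b c) st Q.
Proof. by move=> nb q; exists 1, st; split=> //; constructor. Qed.

Lemma ev_while_step p b c st (Q : nat -> state R -> Prop) :
  beval st b ->
  ev p c st (fun j st' => ev p (While b c) st' (fun k => Q (j + k).+1)) ->
  ev p (While b c) st Q.
Proof.
move=> bt [j [st1 [e1 [k [st2 [e2 q]]]]]].
by exists (j + k).+1, st2; split=> //; exact: ExecWhileTrue bt e1 e2.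
Qed.

(** [I] is indexed by the steps spent so far, so one invariant carries both correctness and cost.
    Each successful test adds 1 to the index; the failing one is the extra 1 in [j = i.+1]. *)
Lemma ev_while p b c (I : nat -> state R -> Prop) (mu : state R -> nat) :
  (forall k st, I k st -> beval st b ->
     ev p c st (fun j st' => I (k + j).+1 st' /\ mu st' < mu st)) ->
  forall k st, I k st ->
    ev p (While b c) st
      (fun j st' => ~~ beval st' b /\ exists2 i, j = i.+1 & I (k + i) st').
Proof.
move=> step k st; have [n] := ubnP (mu st); elim: n k st => // n IH k st.
rewrite ltnS => le_n Ist.
have [bt|bf] := boolP (beval st b); last first.
  exists 1, st; split; first by constructor.
  by split=> //; exists 0; rewrite ?addn0.
have [j [st1 [e1 [I1 mu1]]]] := step k st Ist bt.
have [|j2 [st2 [e2 [nb [i ji I2]]]]] := IH _ st1 _ I1.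
  by exact: leq_trans mu1 le_n.
exists (j + j2).+1, st2; split; first exact: ExecWhileTrue bt e1 e2.
split=> //; exists (j + j2) => //.
by have -> : k + (j + j2) = (k + j).+1 + i by lia.
Qed.

(** * Syntactic frame conditions *)

Section Frame.
Variables (wi wr wa wb F : pred nat).

Fixpoint writes_only c :=
  match c with
  | Skip => true
  | ISet x _ => wi x
  | RSet x _ => wr x
  | IPut a _ _ => wa a
  | RPut a _ _ => wb a
  | Seq c1 c2 | If _ c1 c2 => writes_only c1 && writes_only c2
  | While _ c => writes_only c
  | Call f => F f
  end.

Definition agree_off st st' :=
  [/\ forall x, ~~ wi x -> ivar st' x = ivar st x,
      forall x, ~~ wr x -> rvar st' x = rvar st x,
      forall x, ~~ wa x -> iarr st' x = iarr st x
    & forall x, ~~ wb x -> rarr st' x = rarr st x].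

Lemma upd_off (T : Type) (P : pred nat) (f : nat -> T) x y v :
  P x -> ~~ P y -> upd f x v y = f y.
Proof. by move=> Px; rewrite /upd; case: eqP => [->|//]; rewrite Px. Qed.

(** Induction on the execution rather than on the command, since procedures are recursive; the
    hypothesis on [p] subjects the bodies of the callable procedures to the same write sets. *)
Lemma exec_agree p c st k st' :
  (forall f, F f -> writes_only (nth Skip p f)) ->
  exec p c st k st' -> writes_only c -> agree_off st st'.
Proof.
move=> okp; have tr s1 s2 s3 : agree_off s1 s2 -> agree_off s2 s3 -> agree_off s1 s3.
  move=> [i1 r1 a1 b1] [i2 r2 a2 b2].
  by split=> x nx; rewrite ?i2 ?i1 ?r2 ?r1 ?a2 ?a1 ?b2 ?b1.
elim=> {c st k st'} /=.
- by [].
- by move=> st x e wx; split=> // y ny /=; apply: upd_off ny.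
- by move=> st x e wx; split=> // y ny /=; apply: upd_off ny.
- by move=> st a i e wx; split=> // y ny /=; apply: upd_off ny.
- by move=> st a i e wx; split=> // y ny /=; apply: upd_off ny.
- by move=> s1 s2 s3 k1 k2 c1 c2 _ h1 _ h2 /andP[/h1 g1 /h2]; apply: tr g1.
- by move=> s1 s2 k b c1 c2 _ h /andP[w1 w2]; apply: h; case: ifP.
- by [].
- by move=> s1 s2 s3 k1 k2 b c _ _ h1 _ h2 w; apply: tr (h1 w) (h2 w).
- by move=> s1 s2 k f _ h Ff; apply: h; apply: okp.
Qed.

End Frame.

(* Cells are only allocated, never modified: the heap consists of the integer
   arrays 1 (child), 2 (next), 3 (sentinel flag) and of the real arrays 2
   (length), 3 (weight), 4 (moment); register 1 is the first free address. *)
Definition heap_le st st' :=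
  ivar st 1 <= ivar st' 1 /\
  forall x, x < ivar st 1 ->
    [/\ iarr st' 1 x = iarr st 1 x, iarr st' 2 x = iarr st 2 x
      & iarr st' 3 x = iarr st 3 x] /\
    [/\ rarr st' 2 x = rarr st 2 x, rarr st' 3 x = rarr st 3 x
      & rarr st' 4 x = rarr st 4 x].

Definition is_free e := if e is IVar 1 then true else false.
Definition is_succ_free e := if e is ISucc e then is_free e else false.

(** Calls to procedure 0 are excluded because [main] resets the free address, which otherwise only
    moves up. *)
Fixpoint alloc_only c :=
  match c with
  | Skip | RSet _ _ => true
  | Call f => 0 < f
  | ISet x e => (x == 1) ==> is_succ_free e
  | IPut a i _ => (a \in [:: 1; 2; 3]) ==> is_free i
  | RPut a i _ => (a \in [:: 2; 3; 4]) ==> is_free i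
  | Seq c1 c2 | If _ c1 c2 => alloc_only c1 && alloc_only c2
  | While _ c => alloc_only c
  end.

Lemma heap_le_trans s1 s2 s3 : heap_le s1 s2 -> heap_le s2 s3 -> heap_le s1 s3.
Proof.
move=> [l1 h1] [l2 h2]; split; first exact: leq_trans l2.
move=> x lx; have [[-> -> ->] [-> -> ->]] := h2 x (leq_trans lx l1).
exact: h1.
Qed.

Lemma is_freeP e st : is_free e -> ieval st e = ivar st 1.
Proof. by case: e => // - [|[]]. Qed.

(** Writes to the heap land at the free address, above every address that [heap_le] speaks of.
    Earlier representations are thus preserved without any separation argument. *)
Lemma exec_heap_le p c st k st' : all alloc_only (behead p) ->
  exec p c st k st' -> alloc_only c -> heap_le st st'.
Proof.
move=> okp; elim=> {c st k st'} /=.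
- by [].
- move=> st x e; have [->|ne _] := eqVneq x 1 => /=; last first.
    by split=> //=; rewrite /upd eq_sym (negPf ne).
  case: e => // e /is_freeP fe; split=> //=; rewrite /upd eqxx /= fe.
  exact: leqnSn.
- by [].
- move=> st a i e al; split=> //= x lx; split=> //.
  have ne b : b \in [:: 1; 2; 3] ->
      upd (iarr st) a (upd (iarr st a) (ieval st i) (ieval st e)) b x = iarr st b x.
    rewrite /upd; case: (b =P a) => [->|//] ain; move: al; rewrite ain => /is_freeP ->.
    by rewrite (ltn_eqF lx).
  by rewrite !ne.
- move=> st a i e al; split=> //= x lx; split=> //.
  have ne b : b \in [:: 2; 3; 4] ->
      upd (rarr st) a (upd (rarr st a) (ieval st i) (reval st e)) b x = rarr st b x.
    rewrite /upd; case: (b =P a) => [->|//] ain; move: al; rewrite ain => /is_freeP ->.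
    by rewrite (ltn_eqF lx).
  by rewrite !ne.
- by move=> s1 s2 s3 k1 k2 c1 c2 _ h1 _ h2 /andP[/h1 g1 /h2]; apply: heap_le_trans g1.
- by move=> s1 s2 k b c1 c2 _ h /andP[w1 w2]; apply: h; case: ifP.
- by [].
- by move=> s1 s2 s3 k1 k2 b c _ _ h1 _ h2 w; apply: heap_le_trans (h1 w) (h2 w).
- move=> s1 s2 k [//|f] _ h _; apply: h; rewrite -nth_behead.
  have [lf|gf] := ltnP f (size (behead p)); first exact: all_nthP lf.
  by rewrite nth_default.
Qed.

End Machine.

(** * Lists of breakpoints *)

Section Breakpoints.
Variable R : realType.

(* A leaf is a triple (gap to the previous breakpoint, change of slope, flag);
   the flag marks the sentinel that ends every list of breakpoints. *)
Definition leaf : Type := (R * R * bool)%type.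
(* An item (x, d, w) is a breakpoint to be inserted at x, with change of slope
   d, after a stretch of all what follows x by w. *)
Definition item : Type := (R * R * R)%type.

Implicit Types (l o : seq leaf) (its : seq item) (lf : leaf).

Fixpoint llen l : R := if l is lf :: l' then lf.1.1 + llen l' else 0.
Fixpoint lwt l : R := if l is lf :: l' then lf.1.2 + lwt l' else 0.
(** Sum of slope change times position, positions being counted from the start of the list. To the
    right of all its breakpoints, a list starting at 0 contributes slope [lwt l] and intercept
    [- lmom l]. *)
Fixpoint lmom l : R :=
  if l is lf :: l' then lf.1.2 * lf.1.1 + (lmom l' + lf.1.1 * lwt l') else 0.
Definition linf l : bool := has snd l.

Lemma llen_cat l1 l2 : llen (l1 ++ l2) = llen l1 + llen l2.
Proof. by elim: l1 => [|lf l1 IH] /=; rewrite ?add0r // IH addrA. Qed.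

Lemma lwt_cat l1 l2 : lwt (l1 ++ l2) = lwt l1 + lwt l2.
Proof. by elim: l1 => [|lf l1 IH] /=; rewrite ?add0r // IH addrA. Qed.

Lemma lmom_cat l1 l2 :
  lmom (l1 ++ l2) = lmom l1 + (lmom l2 + llen l1 * lwt l2).
Proof.
by elim: l1 => [|lf l1 IH] /=; [rewrite mul0r addr0 add0r | rewrite IH lwt_cat; ring].
Qed.

Definition nonneg_gaps l := all (fun lf => lf.2 || (0 <= lf.1.1)) l.
(** The first gap is the position of the first breakpoint and may be negative. The gap of a sentinel
    is unconstrained, as the sentinel stands at infinity. *)
Definition ascending l := nonneg_gaps (behead l).

Lemma nonneg_ascending l : nonneg_gaps l -> ascending l.
Proof. by case: l => //= lf l /andP[]. Qed.

Lemma ascending_cat l1 l2 :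
  ascending (l1 ++ l2) -> ascending l1 /\ ascending l2.
Proof.
case: l1 => [|lf l1] //=; rewrite /ascending /= /nonneg_gaps all_cat => /andP[-> n2].
by split=> //; apply: nonneg_ascending.
Qed.

Lemma llen_ge0 l : nonneg_gaps l -> ~~ linf l -> 0 <= llen l.
Proof.
elim: l => //= lf l IH /andP[h /IH{}IH]; rewrite negb_or => /andP[nf /IH].
by move: h; rewrite (negPf nf) /=; exact: addr_ge0.
Qed.

(** The final leaf is a breakpoint at infinity without change of slope: every item finds a leaf in
    front of which it can be inserted. *)
Fixpoint sentinel l :=
  if l is lf :: l' then
    if l' is [::] then lf.2 && (lf.1.2 == 0) else ~~ lf.2 && sentinel l'
  else false.

Lemma sentinel_linf l : sentinel l -> linf l.
Proof.
elim: l => // lf [|lf' l] IH; first by rewrite /linf /= => /andP[->].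
by move=> /andP[_ /IH]; rewrite /linf /= => ->; rewrite orbT.
Qed.

Lemma sentinel_cat l1 l2 : l2 != [::] -> sentinel (l1 ++ l2) ->
  ~~ linf l1 /\ sentinel l2.
Proof.
move=> n2; elim: l1 => //= lf l1 IH.
case E : (l1 ++ l2) => [|lf' l]; first by case: l1 l2 n2 E {IH} => [|? ?] [].
by rewrite -E => /andP[nlf /IH[n1 s2]]; split=> //; rewrite negb_or nlf.
Qed.

(* [insertion l its pos o its']: a scan of l, which starts at position pos,
   inserts the items its and yields o; its' are the items beyond the end of l. *)
Inductive insertion : seq leaf -> seq item -> R -> seq leaf -> seq item -> Prop :=
  | InsNil its pos : insertion [::] its pos [::] its
  | InsKeep g d b l its pos o its' :
      (if its is it :: _ then ~~ b && (pos + g <= it.1.1) else true) ->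
      insertion l its (pos + g) o its' ->
      insertion ((g, d, b) :: l) its pos ((g, d, b) :: o) its'
  | InsItem g d b l (x dx w : R) its pos o its' :
      b || (x < pos + g) ->
      insertion ((pos + g - x, d, b) :: l) its x o its' ->
      insertion ((g, d, b) :: l) ((x, dx, w) :: its) pos
        ((x - pos + w, dx, false) :: o) its'.

(** A scan remembers only its position and the pending items, so it can be cut anywhere: a subtree
    and its right siblings can be treated one after the other. *)
Lemma insertion_cat l1 its pos o1 its1 l2 o2 its2 :
  insertion l1 its pos o1 its1 -> insertion l2 its1 (pos + llen l1) o2 its2 ->
  insertion (l1 ++ l2) its pos (o1 ++ o2) its2.
Proof.
move=> ins1; elim: ins1 l2 o2 its2 => {l1 its pos o1 its1} /=.
- by move=> its pos l2 o2 its2; rewrite addr0.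
- by move=> g d b l its pos o its' h _ IH l2 o2 its2 i2; apply: InsKeep => //; apply: IH; rewrite -addrA.
- move=> g d b l x dx w its pos o its' h _ IH l2 o2 its2 i2; apply: InsItem => //.
  by apply: IH; rewrite (_ : x + _ = pos + (g + llen l)) //; ring.
Qed.

Lemma insertion_skip l its pos : ascending l ->
  (if its is it :: _ then ~~ linf l && (pos + llen l <= it.1.1) else true) ->
  insertion l its pos l its.
Proof.
elim: l pos => [|[[g d] b] l IH] pos /=; first by constructor.
rewrite {1}/ascending /= => nn; case: its IH => [|it its] IH h.
  by constructor=> //; apply: IH => //; apply: nonneg_ascending.
move: h; rewrite /linf /= negb_or -andbA => /and3P[nb nl le].
have ge0 := llen_ge0 nn nl.
constructor; first by rewrite nb /=; lra.
by apply: IH; [apply: nonneg_ascending | rewrite nl /=; lra].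
Qed.

(** Allows [expand_pl] to identify the outcome with a list written down by hand. *)
Lemma insertion_det l its pos o1 its1 o2 its2 :
  insertion l its pos o1 its1 -> insertion l its pos o2 its2 ->
  o1 = o2 /\ its1 = its2.
Proof.
move=> i1; elim: i1 o2 its2 => {l its pos o1 its1}.
- by move=> its pos o2 its2 i2; inversion i2.
- move=> g d b l its pos o its' h _ IH o2 its2 i2; inversion i2; subst.
    by match goal with H : insertion l _ _ _ its2 |- _ => case: (IH _ _ H) => -> -> end.
  by match goal with H : is_true (b || _) |- _ =>
    move: h H => /= /andP[/negPf -> /=]; rewrite ltNge => -> end.
- move=> g d b l x dx w its pos o its' h _ IH o2 its2 i2; inversion i2; subst.
    by match goal with H : is_true (~~ b && _) |- _ =>
      move: H h => /= /andP[/negPf -> /=]; rewrite ltNge => -> end.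
  by match goal with H : insertion _ _ x _ its2 |- _ => case: (IH _ _ H) => -> -> end.
Qed.

Lemma insertion_size l its pos o its' : insertion l its pos o its' ->
  (size o + size its' = size l + size its)%N.
Proof. by elim=> //=; lia. Qed.

Lemma insertion_leq l its pos o its' : insertion l its pos o its' ->
  (size its' <= size its)%N.
Proof. by elim=> //= *; lia. Qed.

(** Progress: a stretch that cannot be skipped absorbs an item, and this item can be charged for the
    visit. *)
Lemma insertion_consumes l its pos o its' : insertion l its pos o its' ->
  l != [::] ->
  (if its is it :: _ then linf l || (it.1.1 < pos + llen l) else false) ->
  (size its' < size its)%N.
Proof.
elim=> {l its pos o its'} //.
- move=> g d b l its pos o its' h ins IH _; case: its h ins IH => // it its.
  move=> /andP[nb le] ins IH c; case: l ins IH c => [|lf l] ins IH c.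
    by move: c; rewrite /linf /= (negPf nb) /= addr0 ltNge le.
  by apply: IH => //; move: c; rewrite /linf /= (negPf nb) addrA.
- by move=> g d b l x dx w its pos o its' _ ins _ _ _; have := insertion_leq ins.
Qed.

Lemma insertion_sentinel l its pos o its' : insertion l its pos o its' ->
  sentinel l -> sentinel o /\ its' = [::].
Proof.
elim=> {l its pos o its'} //.
- move=> g d b [|lf l] its pos o its' h ins IH.
    rewrite /= => /andP[bt d0]; inversion ins; subst.
    by move: h; case: its' {ins IH} => [|it its'] //=; rewrite bt ?d0.
  by move=> /andP[nb /IH[so ->]]; split=> //; case: o so {ins IH} => //= lf' o ->; rewrite nb.
- move=> g d b l x dx w its pos o its' h _ IH s.
  have [|so ->] := IH; first by case: l s {IH}.
  by split=> //; case: o so {IH}.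
Qed.

Lemma insertion_nonneg l its pos o its' : insertion l its pos o its' ->
  nonneg_gaps l -> path <=%R pos [seq it.1.1 | it <- its] ->
  all (fun it : item => 0 <= it.2) its -> nonneg_gaps o.
Proof.
elim=> {l its pos o its'} //.
- move=> g d b l its pos o its' h _ IH /= /andP[hg /IH{}IH] pth w.
  rewrite hg; apply: IH => //; case: its h pth {w} => //= it its /andP[_ ->].
  by case/andP.
- move=> g d b l x dx w its pos o its' h _ IH /= /andP[hg nl] /andP[px pth] /andP[w0 ws].
  apply/andP; split; first by rewrite /= addr_ge0 // subr_ge0.
  by apply: IH => //=; rewrite nl andbT; case: b h {hg} => //=; lra.
Qed.

Lemma insertion_ascending l its pos o its' : insertion l its pos o its' ->
  ascending l -> sorted <=%R [seq it.1.1 | it <- its] ->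
  all (fun it : item => 0 <= it.2) its -> ascending o.
Proof.
case=> {l its pos o its'} //.
- move=> g d b l its pos o its' h ins asc pth w; apply: (insertion_nonneg ins) => //.
  by case: its h pth {w ins} => //= it its /andP[_ ->].
- move=> g d b l x dx w its pos o its' h ins asc /= pth /andP[_ ws].
  apply: (insertion_nonneg ins) => //=; apply/andP; split=> //.
  by case: (b) h => //=; lra.
Qed.

(** * Lists of breakpoints as piecewise linear functions *)

Definition pos_part (x : R) : R := Num.max x 0.

Fixpoint pl l (pos x : R) : R :=
  if l is lf :: l' then
    lf.1.2 * pos_part (x - (pos + lf.1.1)) + pl l' (pos + lf.1.1) x
  else 0.

Fixpoint pl_items its (x : R) : R :=
  if its is it :: its' then
    it.1.2 * pos_part (x - it.1.1) + pl_items its' x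
  else 0.

Lemma pl_cat l1 l2 pos x :
  pl (l1 ++ l2) pos x = pl l1 pos x + pl l2 (pos + llen l1) x.
Proof.
elim: l1 pos => [|lf l1 IH] pos /=; first by rewrite addr0 add0r.
by rewrite IH !addrA.
Qed.

Lemma pl_shift l pos a x : pl l (pos + a) x = pl l pos (x - a).
Proof.
elim: l pos => //= lf l IH pos.
rewrite (_ : pos + a + lf.1.1 = pos + lf.1.1 + a); last by ring.
by rewrite IH (_ : x - (pos + lf.1.1 + a) = x - a - (pos + lf.1.1)) //; ring.
Qed.

Lemma pos_part_ge0 (x : R) : 0 <= x -> pos_part x = x.
Proof. by move=> h; apply/max_idPl. Qed.

Lemma pos_part_le0 (x : R) : x <= 0 -> pos_part x = 0.
Proof. by move=> h; apply/max_idPr. Qed.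

(** The empty list is a separate case because [pos] is then only an origin of coordinates, not a
    breakpoint, and [x] may lie on either side of it. *)
Lemma pl_right l pos x : ascending l -> ~~ linf l ->
  (l = [::] \/ pos + llen l <= x) ->
  pl l pos x = lwt l * x - (lmom l + pos * lwt l).
Proof.
elim: l pos => [|[[g d] b] l IH] pos /=; first by move=> *; ring.
rewrite {1}/ascending /linf /= negb_or => nn /andP[_ nl] [//|le].
have ge0 := llen_ge0 nn nl.
rewrite IH //; [|exact: nonneg_ascending|by right; lra].
by rewrite pos_part_ge0; [ring | lra].
Qed.

Lemma pl_left g d b l pos x : sentinel ((g, d, b) :: l) ->
  ascending ((g, d, b) :: l) -> b || (x <= pos + g) ->
  pl ((g, d, b) :: l) pos x = 0.
Proof.
elim: l g d b pos => [|[[g' d'] b'] l IH] g d b pos.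
  rewrite /= addr0 => /andP[-> /eqP ->]; by rewrite mul0r.
move=> /andP[/negPf /= -> s]; rewrite /ascending /= => /andP[hg nn] le.
rewrite pos_part_le0 ?subr_le0 // mulr0 add0r; apply: (IH _ _ b') => //.
by case: (b') hg => //=; lra.
Qed.

Fixpoint items_of (pos : R) l : seq item :=
  if l is lf :: l' then
    let e := pos + lf.1.1 in
    if lf.2 then items_of e l' else (e, lf.1.2, 0) :: items_of e l'
  else [::].

Lemma items_of_cat pos l1 l2 :
  items_of pos (l1 ++ l2) = items_of pos l1 ++ items_of (pos + llen l1) l2.
Proof.
elim: l1 pos => [|lf l1 IH] pos /=; first by rewrite addr0.
by rewrite IH addrA; case: ifP.
Qed.

Lemma items_of_pl l pos x : sentinel l -> pl_items (items_of pos l) x = pl l pos x.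
Proof.
elim: l pos => // [[[g d] b] [|lf l]] IH pos.
  by move=> /andP[/= -> /eqP ->] /=; rewrite mul0r addr0.
by move=> /andP[/= /negPf nb /(IH (pos + g)) /= e]; rewrite nb /= e.
Qed.

Lemma items_of_size l pos : sentinel l -> size l = (size (items_of pos l)).+1.
Proof.
elim: l pos => // [[[g d] b] [|lf l]] IH pos; first by move=> /andP[/= -> _].
by move=> /andP[/= /negPf nb /(IH (pos + g)) /= e]; rewrite nb /= -e.
Qed.

Lemma items_of_stretch l pos : all (fun it : item => it.2 == 0) (items_of pos l).
Proof. by elim: l pos => //= lf l IH pos; case: ifP => //= _; rewrite eqxx IH. Qed.

Lemma items_of_path l pos : nonneg_gaps l -> sentinel l ->
  path <=%R pos [seq it.1.1 | it <- items_of pos l].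
Proof.
elim: l pos => // [[[g d] b] [|lf l]] IH pos; first by move=> _ /andP[/= -> _].
move=> /andP[hg nn] /andP[nb s]; have := IH (pos + g) nn s.
by move: hg; move: nb => /= /negPf ->; rewrite /= lerDl => -> ->.
Qed.

Lemma items_of_sorted l pos : ascending l -> sentinel l ->
  sorted <=%R [seq it.1.1 | it <- items_of pos l].
Proof.
case: l => // [[[g d] b] [|lf l]] asc; first by move=> /andP[/= -> _].
by move=> /andP[/= /negPf nb s]; have /= := items_of_path (pos + g) asc s; rewrite nb.
Qed.

Lemma insertion_pl l its pos o its' x : insertion l its pos o its' ->
  all (fun it : item => it.2 == 0) its ->
  pl o pos x + pl_items its' x = pl l pos x + pl_items its x.
Proof.
elim=> {l its pos o its'} //.
- by move=> g d b l its pos o its' h _ IH /= /IH e; rewrite -!addrA e.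
- move=> g d b l y dx w its pos o its' h _ IH /= /andP[/eqP -> /IH] /=.
  rewrite (_ : y + (pos + g - y) = pos + g); last by ring.
  rewrite (_ : pos + (y - pos + 0) = y); last by ring.
  by move=> e; rewrite -addrA e; ring.
Qed.

Definition steep (F : R -> R) := forall x y, x <= y -> y - x <= F y - F x.

Lemma root_piece a b l1 g d f l2 (F : R -> R) :
  let l := l1 ++ (g, d, f) :: l2 in
  let S := a + lwt l1 in let I := b - lmom l1 in let p := llen l1 in
  (forall x, F x = a * x + b + pl l 0 x) -> steep F ->
  sentinel l -> ascending l ->
  (l1 = [::] \/ S * p + I <= 0) -> f || (0 < S * (p + g) + I) ->
  [/\ 0 < S, F (- I / S) = 0, l1 = [::] \/ p <= - I / S
    & f || (- I / S < p + g)].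
Proof.
move=> l S I p FE st sl asc h1 h2.
have [nl1 sl2] := @sentinel_cat l1 ((g, d, f) :: l2) isT sl.
have [asc1 asc2] := ascending_cat asc.
have FS x : (l1 = [::] \/ p <= x) -> f || (x <= p + g) -> F x = S * x + I.
  move=> lx xr; rewrite FE pl_cat pl_right //; last by rewrite add0r.
  by rewrite add0r pl_left // /S /I; ring.
have [y [z [yz [yl [yr [zl zr]]]]]] : exists y z : R, y < z /\
    (l1 = [::] \/ p <= y) /\ (f || (y <= p + g)) /\
    (l1 = [::] \/ p <= z) /\ (f || (z <= p + g)).
  case: (l1 =P [::]) => [e|ne].
    exists (p + g - 1), (p + g); rewrite lexx orbT; split; first by lra.
    by split; [left | split; [apply/orP; right; lra | split; [left |]]].
  have {}h1 : S * p + I <= 0 by case: h1.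
  have [ft|nf] := boolP f.
    by exists p, (p + 1); split; [lra | split; [right | split; [| split; [right; lra|]]]].
  move: h2; rewrite (negPf nf) /= => h2.
  have g0 : 0 <= g.
    move: asc ne; rewrite /l /ascending; case: (l1) => //= lf l' + _.
    by rewrite /nonneg_gaps all_cat /= (negPf nf) => /and3P[].
  have : g != 0 by apply/eqP => e; move: h2 h1; rewrite e addr0; lra.
  exists p, (p + g); split; first by lra.
  by split; [right | split; [lra | split; [right; lra | ]]].
have S0 : 0 < S.
  by have := st y z (ltW yz); rewrite !FS //; move: yz; clear; nra.
have Sm : S * (- I / S) = - I by rewrite mulrC divfK // gt_eqF.
have ml : l1 = [::] \/ p <= - I / S.
  case: h1 => [|h1]; [by left | right].
  by rewrite -(ler_pM2l S0) Sm; lra.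
have mr : f || (- I / S < p + g).
  by case: (f) h2 => //= h2; rewrite -(ltr_pM2l S0) Sm; lra.
split=> //; rewrite FS ?Sm ?addNr //.
by case: (f) mr => //= /ltW.
Qed.

(* The minimizer over [x - gam, x] of a convex function whose derivative
   vanishes at m. *)
Definition clamp (gam m x : R) : R := Num.min x (Num.max m (x - gam)).

(** Cancelling the slope [S] at [m] and restoring it at [m + gam] creates a plateau at height
    [F m = 0]. Both items enter at [m]: the stretch [gam] of the second is at once the length of the
    plateau and the shift of all the later breakpoints. *)
Lemma expand_pl a b l1 g d f l2 (F : R -> R) gam m o its' :
  let l := l1 ++ (g, d, f) :: l2 in
  let S := a + lwt l1 in
  (forall x, F x = a * x + b + pl l 0 x) ->
  0 <= gam -> sentinel l -> ascending l ->
  F m = 0 -> l1 = [::] \/ llen l1 <= m -> f || (m < llen l1 + g) ->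
  insertion l [:: (m, - S, 0); (m, S, gam)] 0 o its' ->
  forall x, a * x + b + pl o 0 x = F (clamp gam m x).
Proof.
move=> l S FE gam0 sl asc Fm h1 h2 ins x.
have [nl1 sl2] := @sentinel_cat l1 ((g, d, f) :: l2) isT sl.
have [asc1 asc2] := ascending_cat asc.
pose its := [:: (m, - S, 0); (m, S, gam)] : seq item.
have ins1 : insertion l1 its 0 l1 its.
  case: h1 => [->|h1]; first by constructor.
  by apply: insertion_skip; rewrite //= nl1 add0r.
(* The outcome by hand: both items land in front of the leaf that ends the piece containing [m]. *)
pose o2 := (m - llen l1 + 0, - S, false) :: (m - m + gam, S, false) ::
  (m + (llen l1 + g - m) - m, d, f) :: l2.
have ins2 : insertion ((g, d, f) :: l2) its (0 + llen l1) o2 [::].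
  rewrite add0r; apply: InsItem => //; apply: InsItem.
    by case: (f) h2 => //=; lra.
  constructor=> //; apply: insertion_skip => //.
  by move: asc2; rewrite /ascending /=; exact: nonneg_ascending.
have [-> _] := insertion_det ins (insertion_cat ins1 ins2).
pose I := b - lmom l1.
have FS y : (l1 = [::] \/ llen l1 <= y) -> f || (y <= llen l1 + g) -> F y = S * y + I.
  move=> ly yr; rewrite FE pl_cat pl_right //; last by rewrite add0r.
  by rewrite add0r pl_left // /S /I; ring.
have Sm : S * m + I = 0.
  by rewrite -FS //; case: (f) h2 => //= /ltW.
have sl2' : sentinel ((m + (llen l1 + g - m) - m, d, f) :: l2) by case: (l2) sl2.
have asc2' : ascending ((m + (llen l1 + g - m) - m, d, f) :: l2) by [].
have shift : pl ((m + (llen l1 + g - m) - m, d, f) :: l2) (m + gam) x =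
    pl ((g, d, f) :: l2) (llen l1) (x - gam).
  rewrite /= (_ : m + gam + (m + (llen l1 + g - m) - m) = llen l1 + g + gam); last by ring.
  by rewrite pl_shift (_ : x - (llen l1 + g + gam) = x - gam - (llen l1 + g)) //; ring.
have -> : pl (l1 ++ o2) 0 x = pl l1 0 x - S * pos_part (x - m) +
   S * pos_part (x - (m + gam)) + pl ((g, d, f) :: l2) (llen l1) (x - gam).
  rewrite pl_cat add0r /o2 -shift.
  set q := m + gam + (m + (llen l1 + g - m) - m).
  rewrite [LHS]/= -[pl _ (m + gam) x]/(d * pos_part (x - q) + pl l2 q x).
  rewrite (_ : llen l1 + (m - llen l1 + 0) = m); last by ring.
  rewrite (_ : m + (m - m + gam) = m + gam); last by ring.
  by ring.
have right_pl y : y <= m -> pl ((g, d, f) :: l2) (llen l1) y = 0.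
  by move=> ym; apply: pl_left => //; case: (f) h2 => //=; lra.
have left_pl y : m <= y -> a * y + b + pl l1 0 y = S * y + I.
  move=> my; rewrite pl_right // /S /I; first by ring.
  by case: h1 => [|h]; [left | right; rewrite add0r; lra].
rewrite /clamp; have [xm|mx] := leP x m.
  rewrite (min_idPl _) ?le_max ?xm // !(@pos_part_le0 (x - _)); [|lra|lra].
  by rewrite right_pl ?FE ?pl_cat ?right_pl //; [rewrite add0r right_pl //; ring | lra].
have [xmg|mxg] := leP (x - gam) m.
  rewrite (min_idPr _) ?ltW // Fm right_pl // pos_part_ge0 ?pos_part_le0; [|lra|lra].
  by have := left_pl x (ltW mx); nra.
rewrite (min_idPr _); last by lra.
rewrite !pos_part_ge0; [|lra|lra].
rewrite FE pl_cat add0r.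
have := left_pl x (ltW mx); have := left_pl (x - gam) (ltW mxg).
set u := pl l1 _ _; set v := pl l1 _ _; nra.
Qed.

End Breakpoints.

(** * Optimality of the clamped zeros *)

Section Optimality.
Variables (R : realType) (V : finType) (A : rel V) (r : V) (pr : V -> V).
Variables (t : V -> R) (gam : R).
Hypothesis AE : forall u v, A u v = (u != r) && (pr u == v).
Hypothesis gam0 : 0 <= gam.

Lemma clamp_le (m x : R) : clamp gam m x <= x.
Proof. by rewrite /clamp ge_min lexx. Qed.

Lemma clamp_ge (m x : R) : x <= clamp gam m x + gam.
Proof.
rewrite -lerBlDr /clamp le_min le_max lexx orbT andbT.
by rewrite lerBlDr lerDl.
Qed.

Lemma clamp_left (m x : R) : x <= m -> clamp gam m x = x.
Proof. by move=> xm; rewrite /clamp (min_idPl _) // le_max xm. Qed.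

Lemma clamp_mid (m x : R) : m <= x -> x - gam <= m -> clamp gam m x = m.
Proof. by move=> mx xm; rewrite /clamp (max_idPl xm) (min_idPr mx). Qed.

Lemma clamp_right (m x : R) : m <= x - gam -> clamp gam m x = x - gam.
Proof. by move=> mx; rewrite /clamp (max_idPr mx) (min_idPr _) // gerBl. Qed.

Lemma le_clamp (m : R) : {homo clamp gam m : x y / x <= y}.
Proof.
move=> x y xy; rewrite /clamp le_min ge_min xy /=.
have h : x - gam <= y - gam by lra.
by rewrite ge_min ge_max !le_max lexx h !orbT.
Qed.

Lemma steep_sum (f : V -> R -> R) (m : V -> R) (P : pred V) (a : R) :
  (forall c, P c -> steep (f c)) ->
  steep (fun x => x - a + \sum_(c | P c) f c (clamp gam (m c) x)).
Proof.
move=> stf x y xy.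
have : \sum_(c | P c) f c (clamp gam (m c) x) <= \sum_(c | P c) f c (clamp gam (m c) y).
  apply: ler_sum => c /stf; move/(_ _ _ (le_clamp (m c) xy)).
  by have := le_clamp (m c) xy; lra.
by lra.
Qed.

(* The multiplier of the arc from c to its parent is f c (s c): the differences
   (s u - t u) are f u (s u) minus the multipliers of the children of u, and
   complementary slackness makes every summand nonnegative. *)
Lemma lir_optimal (f : V -> R -> R) (m s : V -> R) :
  (forall u x, f u x =
     x - t u + \sum_(c | (c != r) && (pr c == u)) f c (clamp gam (m c) x)) ->
  (forall u, steep (f u)) -> (forall u, f u (m u) = 0) ->
  s r = m r -> (forall c, c != r -> s c = clamp gam (m c) (s (pr c))) ->
  is_LIR A t gam s.
Proof.
move=> fE st fm sr sc; split.
  move=> u v; rewrite AE => /andP[ur /eqP <-].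
  by rewrite sc // clamp_le clamp_ge.
move=> s' feas'.
(* First-order condition: half the derivative of the error at [s] is nonnegative in the direction of
   every feasible [s']. *)
have key : 0 <= \sum_u (s u - t u) * (s' u - s u).
  have -> : \sum_u (s u - t u) * (s' u - s u) = \sum_(c | c != r)
      f c (s c) * ((s' c - s c) - (s' (pr c) - s (pr c))).
    have E u : s u - t u = f u (s u) - \sum_(c | (c != r) && (pr c == u)) f c (s c).
      rewrite fE (eq_bigr (fun c => f c (s c))); first by rewrite addrK.
      by move=> c /andP[cr /eqP <-]; rewrite -sc.
    under eq_bigr do rewrite E mulrBl.
    rewrite sumrB (bigD1 r) //= sr fm mul0r add0r.
    under [X in _ - X = _]eq_bigr do rewrite mulr_suml.
    rewrite (exchange_big_dep (fun c => c != r)) /=; last by move=> u c _ /andP[].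
    rewrite -sumrB; apply: eq_bigr => c cr.
    rewrite (eq_bigl (pred1 (pr c))); last by move=> u; rewrite /= cr eq_sym.
    by rewrite big_pred1_eq -mulrBr.
  apply: sumr_ge0 => c cr.
  have fpos y : m c <= y -> 0 <= f c y.
    by move=> le; have := st c _ _ le; rewrite fm; lra.
  have fneg y : y <= m c -> f c y <= 0.
    by move=> le; have := st c _ _ le; rewrite fm; lra.
  have [f1 f2] : s' c <= s' (pr c) /\ s' (pr c) <= s' c + gam.
    by apply/andP/feas'; rewrite AE cr eqxx.
  (* The multiplier is nonpositive where [s c = s (pr c)], zero where [s c = m c], and nonnegative
     where [s c = s (pr c) - gam]; feasibility of [s'] gives the other factor a matching sign. *)
  rewrite sc //; have [le1|lt1] := leP (s (pr c)) (m c).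
    by rewrite (clamp_left le1); apply: mulr_le0; [exact: fneg | lra].
  have [le2|lt2] := leP (s (pr c) - gam) (m c).
    by rewrite (clamp_mid (ltW lt1) le2) fm mul0r.
  rewrite (clamp_right (ltW lt2)); apply: mulr_ge0; last by lra.
  by apply: fpos; lra.
(* The difference of the errors is twice the form in [key] plus a sum of squares. *)
rewrite -subr_ge0 /sq_error -sumrB.
rewrite (eq_bigr (fun u => 2 * ((s u - t u) * (s' u - s u)) + (s' u - s u) ^+ 2)).
  rewrite big_split /= -mulr_sumr addr_ge0 ?mulr_ge0 //.
  by apply: sumr_ge0 => u _; exact: sqr_ge0.
by move=> u _; ring.
Qed.

End Optimality.

(** * Truncated logarithms against [ln] *)

Lemma trunc_log_ln (R : realType) (n : nat) : (0 < n)%N ->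
  (trunc_log 2 n)%:R * ln 2 <= ln n%:R :> R.
Proof.
move=> n0; rewrite mulr_natl -lnXn ?ltr0n //.
rewrite ler_ln ?posrE ?exprn_gt0 ?ltr0n //.
by rewrite -natrX ler_nat trunc_logP.
Qed.

(** For [n] at least 2 both successors at most double, whence the factor 4; the successor in
    [(4 * K).+1] keeps the constant positive when [K = 0]. *)
Lemma nlogn_bigO (R : realType) (K : nat) :
  (fun n : nat => (K * (n.+1 * (trunc_log 2 n).+1))%:R : R^o) =O_\oo
  (fun n : nat => n%:R * ln n%:R : R^o).
Proof.
have ln2 : 0 < ln 2 :> R by rewrite ln_gt0 // ltr1n.
apply/eqO_exP; exists ((4 * K).+1%:R / ln 2); first by rewrite divr_gt0 ?ltr0n.
near=> n.
have n2 : (1 < n)%N by near: n; exact: nbhs_infty_gt.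
have lg1 : (0 < trunc_log 2 n)%N by rewrite trunc_log_gt0.
have lnn := @trunc_log_ln R n (ltnW n2).
have lnn0 : 0 <= ln n%:R :> R by rewrite ln_ge0 // ler1n ltnW.
rewrite ger0_norm ?ler0n // ger0_norm ?mulr_ge0 // mulrAC ler_pdivlMr //.
have le1 : (K * (n.+1 * (trunc_log 2 n).+1) <= (4 * K).+1 * (n * trunc_log 2 n))%N.
  have : ((n.+1 * (trunc_log 2 n).+1) <= 2 * n * (2 * trunc_log 2 n))%N.
    by rewrite leq_mul //; lia.
  by move: (trunc_log 2 n) => L h; nia.
move: le1; rewrite -(ler_nat R) -(ler_pM2r ln2) => /le_trans; apply.
by rewrite !natrM -!mulrA !ler_wpM2l.
Unshelve. all: by end_near.
Qed.

(** * 2-3 trees on the heap *)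

Section Trees.
Variable R : realType.
Local Open Scope nat_scope.

(* A forest, in first-child/next-sibling form: [Cell lf c r] is a tree with
   children c followed by the forest r; lf is only relevant for a leaf. *)
Inductive forest := Nil | Cell of leaf R & forest & forest.

Implicit Types (t c r : forest).

Fixpoint leaves t : seq (leaf R) :=
  if t is Cell lf c r then
    (if c is Nil then [:: lf] else leaves c) ++ leaves r
  else [::].

Definition head_leaves lf c := if c is Nil then [:: lf] else leaves c.

Fixpoint fsize t : nat := if t is Cell _ _ r then (fsize r).+1 else 0.

(** The number of trees at the top is left free, since insertion replaces a tree by several ones of
    the same height. *)
Fixpoint balanced h t : bool :=
  if t is Cell _ c r then
    (if h is h'.+1 then [&& 1 < fsize c, fsize c <= 3 & balanced h' c]
     else if c is Nil then true else false) && balanced h r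
  else true.

(* The number of nodes of height greater than J. *)
Fixpoint high_nodes J h t : nat :=
  if t is Cell _ c r then
    (if J < h then (high_nodes J h.-1 c).+1 else 0) + high_nodes J h r
  else 0.

Lemma leavesE lf c r : leaves (Cell lf c r) = head_leaves lf c ++ leaves r.
Proof. by []. Qed.

Lemma head_leavesE lf c : 0 < fsize c -> head_leaves lf c = leaves c.
Proof. by case: c. Qed.

Lemma balanced_size h t : balanced h t -> fsize t * 2 ^ h <= size (leaves t).
Proof.
elim: t h => // lf c IHc r IHr h /= /andP[bc /IHr{IHr} lr].
rewrite size_cat mulSn leq_add // {lr}.
case: h bc => [|h]; first by case: c {IHc}.
move=> /and3P[c1 _ /IHc{IHc}]; case: c c1 => // lf' c' r' c1.
apply: leq_trans; rewrite expnS leq_mul2r; exact/orP/or_intror.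
Qed.

Lemma high_nodes_eq0 J h t : h <= J -> high_nodes J h t = 0.
Proof. by move=> hJ; elim: t => //= lf c _ r ->; rewrite ltnNge hJ. Qed.

(** The summand [fsize t] makes the induction work: a node and its own unit in [fsize] are paid for
    by the units of its children, of which there are at least two. *)
Lemma high_nodes_size J h t : J < h -> balanced h t ->
  (high_nodes J h t + fsize t) * 2 ^ J.+1 <= 2 * size (leaves t).
Proof.
elim: t h => // lf c IHc r IHr [//|h] Jh.
rewrite [balanced _ _]/= => /andP[/and3P[c1 _ bc] /(IHr _ Jh){IHr}].
have -> : high_nodes J h.+1 (Cell lf c r) =
    (high_nodes J h c).+1 + high_nodes J h.+1 r by rewrite {1}/high_nodes -/high_nodes Jh.
rewrite leavesE (head_leavesE _ (ltnW c1)) size_cat [fsize (Cell _ _ _)]/=; set X := 2 ^ J.+1.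
set nr := high_nodes J h.+1 r; set nc := high_nodes _ _ c => lr.
suff lc : (nc + 2) * X <= 2 * size (leaves c).
  rewrite (_ : (nc.+1 + nr + (fsize r).+1) * X = (nc + 2) * X + (nr + fsize r) * X); last by ring.
  by rewrite mulnDr leq_add.
have [Jh'|hJ] := ltnP J h.
  by apply: leq_trans (IHc _ Jh' bc); rewrite leq_mul2r leq_add2l c1 orbT.
have eJ : J = h by apply/eqP; rewrite eqn_leq hJ andbT -ltnS.
rewrite /nc high_nodes_eq0 // add0n leq_mul2l /= /X expnS eJ.
by apply: leq_trans (balanced_size bc); rewrite leq_mul2r c1 orbT.
Qed.

Lemma high_nodes_bound J h t : balanced h t -> fsize t = 1 ->
  high_nodes J h t <= size (leaves t) %/ 2 ^ J.
Proof.
move=> bt t1; have [Jh|hJ] := ltnP J h; last by rewrite high_nodes_eq0.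
have := high_nodes_size Jh bt; rewrite t1 addn1 expnS mulnCA leq_mul2l /=.
by rewrite leq_divRL ?expn_gt0 //; apply: leq_trans; rewrite leq_mul2r leqnSn orbT.
Qed.

Variables (st st' : state R).
Implicit Types (s : state R) (p : nat).

(** Each cell caches the totals of its own subtree, siblings excluded. Two trees may share cells,
    which is harmless as cells are immutable. *)
Fixpoint rep s p t : Prop :=
  if t is Cell lf c r then
    [/\ 0 < p < ivar s 1, rep s (iarr s 1 p) c, rep s (iarr s 2 p) r
      & [/\ iarr s 3 p = nat_of_bool (linf (head_leaves lf c)),
            rarr s 2 p = llen (head_leaves lf c),
            rarr s 3 p = lwt (head_leaves lf c)
          & rarr s 4 p = lmom (head_leaves lf c)]]
  else p = 0.

Lemma rep_cell s p lf c r : rep s p (Cell lf c r) ->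
  [/\ 0 < p < ivar s 1, rep s (iarr s 1 p) c, rep s (iarr s 2 p) r
      & [/\ iarr s 3 p = nat_of_bool (linf (head_leaves lf c)),
            rarr s 2 p = llen (head_leaves lf c),
            rarr s 3 p = lwt (head_leaves lf c)
          & rarr s 4 p = lmom (head_leaves lf c)]].
Proof. by []. Qed.

Fixpoint items_rep s p (its : seq (item R)) : Prop :=
  if its is (x, d, w) :: its' then
    [/\ 0 < p < ivar s 1, rarr s 2 p = x, rarr s 3 p = d, rarr s 4 p = w
      & items_rep s (iarr s 2 p) its']
  else p = 0.

Lemma items_rep_cons s p x d w its : items_rep s p ((x, d, w) :: its) ->
  [/\ 0 < p < ivar s 1, rarr s 2 p = x, rarr s 3 p = d, rarr s 4 p = w
    & items_rep s (iarr s 2 p) its].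
Proof. by []. Qed.

Lemma rep_le p t : heap_le st st' -> rep st p t -> rep st' p t.
Proof.
move=> [lf hp]; elim: t p => //= l c IHc r IHr p [/andP[p0 pF] /IHc rc /IHr rr info].
have [[e1 e2 e3] [e4 e5 e6]] := hp p pF.
by rewrite p0 (leq_trans pF lf) e1 e2 e3 e4 e5 e6.
Qed.

Lemma items_rep_le p its : heap_le st st' -> items_rep st p its -> items_rep st' p its.
Proof.
move=> [lf hp]; elim: its p => //= [[[x d] w] its] IH p [/andP[p0 pF] <- <- <- /IH rr].
have [[e1 e2 e3] [e4 e5 e6]] := hp p pF.
by rewrite p0 (leq_trans pF lf) e2 e4 e5 e6.
Qed.

Lemma rep_eq0 p t : rep st p t -> (p == 0) = (fsize t == 0).
Proof. by case: t => [|lf c r] /= => [->|[/andP[]]] //; case: p. Qed.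

Lemma items_rep_eq0 p its : items_rep st p its -> (p == 0) = nilp its.
Proof. by case: its => [|[[x d] w] its] /= => [->|[/andP[]]] //; case: p. Qed.

Lemma balanced_cell h lf c r : balanced h (Cell lf c r) =
  (if h is h'.+1 then [&& 1 < fsize c, fsize c <= 3 & balanced h' c]
   else if c is Nil then true else false) && balanced h r.
Proof. by case: h. Qed.

Definition tree_rep s p h l : Prop :=
  exists t, [/\ fsize t = 1, balanced h t, rep s p t & leaves t = l].

End Trees.
Arguments Nil {R}.
Arguments leaves : simpl never.
Arguments rep : simpl never.
Arguments balanced : simpl never.
Arguments items_rep : simpl never.

(** * The program *)

Section Programs.
Local Open Scope nat_scope.

Local Notation "c1 ;; c2" := (Seq c1 c2) (at level 60, right associativity).
(* The address 0 is the null pointer. Cells of the heap represent tree nodes,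
   items (where next leads to the following item, and mom is the stretch), and
   the links of the stack that saves values across recursive calls. *)
Local Notation child e := (IGet 1 e).
Local Notation next e := (IGet 2 e).
Local Notation flag e := (IGet 3 e).
Local Notation len e := (RGet 2 e).
Local Notation wt e := (RGet 3 e).
Local Notation mom e := (RGet 4 e).
Local Notation free := (IVar 1).
Local Notation stack := (IVar 2).
Local Notation arg := (IVar 3).
Local Notation res := (IVar 4).
Local Notation height := (IVar 5).
Local Notation items := (IVar 6).
Local Notation grp := (IVar 7).
Local Notation tmp := (IVar 8).
Local Notation pos := (RVar 1).
Local Notation rlen := (RVar 2).
Local Notation rwt := (RVar 3).
Local Notation rmom := (RVar 4).
Local Notation slope := (RVar 5).
Local Notation icpt := (RVar 6).

Definition fresh := IPred free.

Definition alloc : cmd :=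
  IPut 1 free (IVar 11) ;; IPut 2 free (IVar 12) ;; IPut 3 free (IVar 9) ;;
  RPut 2 free rlen ;; RPut 3 free rwt ;; RPut 4 free rmom ;;
  ISet 1 (ISucc free).

(** [alloc] also writes [rlen] and [rwt] into the link; [bulk] and [flatten] keep real values across
    a recursive call in this way. *)
Definition push (e : iexp) : cmd :=
  ISet 11 e ;; ISet 12 stack ;; alloc ;; ISet 2 fresh.

Definition pop (x : nat) : cmd := ISet x (child stack) ;; ISet 2 (next stack).

Definition copy (e nx : iexp) : cmd :=
  ISet 11 (child e) ;; ISet 12 nx ;; ISet 9 (flag e) ;;
  RSet 2 (len e) ;; RSet 3 (wt e) ;; RSet 4 (mom e) ;; alloc.

Definition measure : cmd :=
  ISet 8 grp ;; ISet 9 (ICst 0) ;;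
  RSet 2 (RCst 0) ;; RSet 3 (RCst 0) ;; RSet 4 (RCst 0) ;;
  While (BNot (BIeq tmp (ICst 0)))
    (RSet 4 (ROp RAdd rmom (ROp RAdd (mom tmp) (ROp RMul rlen (wt tmp)))) ;;
     RSet 2 (ROp RAdd rlen (len tmp)) ;; RSet 3 (ROp RAdd rwt (wt tmp)) ;;
     If (BIeq (flag tmp) (ICst 0)) Skip (ISet 9 (ICst 1)) ;;
     ISet 8 (next tmp)).

Definition make_node : cmd :=
  measure ;; ISet 11 grp ;; ISet 12 res ;; alloc ;; ISet 4 fresh.

(* Packs the siblings grp into nodes with two or three children each, in front
   of the forest res. *)
Definition group : cmd :=
  If (BIeq (next (next grp)) (ICst 0)) make_node
  (If (BIeq (next (next (next grp))) (ICst 0)) make_node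
  (push grp ;; ISet 7 (next (next grp)) ;; Call 2 ;; pop 7 ;;
   copy (next grp) (ICst 0) ;; copy grp fresh ;; ISet 7 fresh ;; make_node)).

(* No item is to be inserted before the end of the subtree arg. *)
Definition bulk_skips : bexp :=
  BNot (BAnd (BNot (BIeq items (ICst 0)))
    (BNot (BAnd (BIeq (flag arg) (ICst 0))
                (BRle (ROp RAdd pos (len arg)) (len items))))).

(* Inserts items into the forest arg of trees of the given height. A tree may be
   replaced by several ones. At height 0 the item becomes a leaf, whose gap is
   taken from the leaf that follows, and the latter is visited again. *)
Definition bulk : cmd :=
  If (BIeq arg (ICst 0)) (ISet 4 (ICst 0))
  (If bulk_skips
    (push arg ;; RSet 1 (ROp RAdd pos (len arg)) ;; ISet 3 (next arg) ;;
     Call 1 ;; pop 3 ;; copy arg res ;; ISet 4 fresh)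
  (If (BIeq height (ICst 0))
    (RSet 2 (ROp RAdd (ROp RSub (len items) pos) (mom items)) ;;
     RSet 3 (wt items) ;; push (ICst 0) ;;
     RSet 2 (ROp RSub (ROp RAdd pos (len arg)) (len items)) ;;
     RSet 3 (wt arg) ;; RSet 4 (ROp RMul rwt rlen) ;;
     ISet 11 (ICst 0) ;; ISet 12 (next arg) ;; ISet 9 (flag arg) ;; alloc ;;
     ISet 3 fresh ;; RSet 1 (len items) ;; ISet 6 (next items) ;; Call 1 ;;
     RSet 2 (len stack) ;; RSet 3 (wt stack) ;; RSet 4 (ROp RMul rwt rlen) ;;
     ISet 9 (ICst 0) ;; ISet 12 res ;; pop 11 ;; alloc ;; ISet 4 fresh)
    (push arg ;; ISet 3 (child arg) ;; ISet 5 (IPred height) ;; Call 1 ;;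
     ISet 5 (ISucc height) ;; pop 3 ;; push res ;; ISet 3 (next arg) ;;
     Call 1 ;; pop 7 ;; Call 2))).

(* Prepends the breakpoints of the forest arg, as items, to the list res, from
   right to left, and increments register 10 for each of them. *)
Definition flatten : cmd :=
  If (BIeq arg (ICst 0)) Skip
  (RSet 2 pos ;; push arg ;; RSet 1 (ROp RAdd pos (len arg)) ;;
   ISet 3 (next arg) ;; Call 3 ;; RSet 1 (len stack) ;; pop 3 ;;
   If (BIeq height (ICst 0))
     (If (BIeq (flag arg) (ICst 0))
       (RSet 2 (ROp RAdd pos (len arg)) ;; RSet 3 (wt arg) ;;
        RSet 4 (RCst 0) ;; ISet 11 (ICst 0) ;; ISet 12 res ;; alloc ;;
        ISet 4 fresh ;; ISet 10 (ISucc (IVar 10)))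
       Skip)
     (ISet 3 (child arg) ;; ISet 5 (IPred height) ;; Call 3 ;;
      ISet 5 (ISucc height))).

Definition next_slope : rexp := ROp RAdd slope (wt arg).
Definition next_icpt : rexp :=
  ROp RSub icpt (ROp RAdd (mom arg) (ROp RMul pos (wt arg))).
Definition next_pos : rexp := ROp RAdd pos (len arg).

(* Skips the subtrees at the end of which the function is still nonpositive. *)
Definition find_root : cmd :=
  If (BAnd (BIeq (flag arg) (ICst 0))
       (BRle (ROp RAdd (ROp RMul next_slope next_pos) next_icpt) (RCst 0)))
    (RSet 6 next_icpt ;; RSet 5 next_slope ;; RSet 1 next_pos ;;
     ISet 3 (next arg) ;; Call 4)
  (If (BIeq height (ICst 0)) Skip
    (ISet 3 (child arg) ;; ISet 5 (IPred height) ;; Call 4)).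

(** Insertion may leave several trees. Each round of grouping at least halves their number and
    raises the height by one. *)
Definition insert_items : cmd :=
  RSet 1 (RCst 0) ;; Call 1 ;;
  While (BNot (BIeq (next res) (ICst 0)))
    (ISet 7 res ;; ISet 4 (ICst 0) ;; Call 2 ;; ISet 5 (ISucc height)).

(* The function of a vertex e is given, before its first breakpoint, by its slope
   [RGet 20 e] and its intercept [RGet 21 e]; [RGet 22 e] is its zero. *)
Local Notation par e := (IGet 0 e).
Local Notation deg e := (IGet 20 e).
Local Notation queue e := (IGet 21 e).
Local Notation root e := (IGet 22 e).
Local Notation ht e := (IGet 23 e).
Local Notation sz e := (IGet 24 e).
Local Notation rd := (IVar 20).
Local Notation wr := (IVar 21).
Local Notation v := (IVar 22).
Local Notation p := (IVar 23).
Local Notation small := (IVar 24).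
Local Notation large := (IVar 25).
Local Notation i := (IVar 26).

Definition solve : cmd :=
  ISet 3 (root v) ;; ISet 5 (ht v) ;; RSet 1 (RCst 0) ;;
  RSet 5 (RGet 20 v) ;; RSet 6 (RGet 21 v) ;; Call 4 ;;
  RPut 22 v (ROp RDiv (ROp RSub (RCst 0) icpt) slope).

(** Takes the slope of the piece containing the zero from [slope], where [solve] has left it. *)
Definition expand : cmd :=
  ISet 11 (ICst 0) ;; ISet 12 (ICst 0) ;; ISet 9 (ICst 0) ;;
  RSet 2 (RGet 22 v) ;; RSet 3 slope ;; RSet 4 (RVar 0) ;; alloc ;;
  RSet 3 (ROp RSub (RCst 0) slope) ;; RSet 4 (RCst 0) ;;
  ISet 12 fresh ;; alloc ;; ISet 6 fresh ;;
  ISet 3 (root v) ;; ISet 5 (ht v) ;; insert_items ;;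
  IPut 22 v res ;; IPut 23 v height ;; IPut 24 v (ISucc (ISucc (sz v))).

(** Integers cannot be added in the model: the size of the union is found by counting upwards from
    [sz large] while the smaller tree is flattened. *)
Definition merge_trees : cmd :=
  ISet 10 (sz large) ;; ISet 3 (root small) ;; ISet 5 (ht small) ;;
  ISet 4 (ICst 0) ;; RSet 1 (RCst 0) ;; Call 3 ;; ISet 6 res ;;
  ISet 3 (root large) ;; ISet 5 (ht large) ;; insert_items.

Definition union : cmd :=
  If (BIle (sz v) (sz p)) (ISet 24 v ;; ISet 25 p) (ISet 24 p ;; ISet 25 v) ;;
  merge_trees ;;
  IPut 22 p res ;; IPut 23 p height ;; IPut 24 p (IVar 10) ;;
  RPut 20 p (ROp RAdd (RGet 20 p) (RGet 20 v)) ;;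
  RPut 21 p (ROp RAdd (RGet 21 p) (RGet 21 v)).

Definition enqueue (e : iexp) : cmd := IPut 21 wr e ;; ISet 21 (ISucc wr).

Definition process : cmd :=
  ISet 22 (queue rd) ;; ISet 20 (ISucc rd) ;; ISet 23 (par v) ;;
  solve ;; expand ;; union ;;
  IPut 20 p (IPred (deg p)) ;; If (BIeq (deg p) (ICst 0)) (enqueue p) Skip.

Definition init_vertex : cmd :=
  IPut 20 i (ICst 0) ;;
  ISet 11 (ICst 0) ;; ISet 12 (ICst 0) ;; ISet 9 (ICst 1) ;;
  RSet 2 (RCst 0) ;; RSet 3 (RCst 0) ;; RSet 4 (RCst 0) ;; alloc ;;
  IPut 22 i fresh ;; IPut 23 i (ICst 0) ;; IPut 24 i (ICst 0) ;;
  RPut 20 i (RCst 1) ;; RPut 21 i (ROp RSub (RCst 0) (RGet 0 i)).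

Definition count_child : cmd :=
  IPut 20 (par i) (ISucc (deg (par i))) ;;
  If (BIeq (par i) i) (ISet 22 i) Skip.

Definition enqueue_leaf : cmd := If (BIeq (deg i) (ICst 0)) (enqueue i) Skip.

Definition for_all_vertices (c : cmd) : cmd :=
  ISet 26 (ICst 0) ;; While (BNot (BIle (IVar 0) i)) (c ;; ISet 26 (ISucc i)).

Definition output_vertex : cmd :=
  ISet 20 (IPred rd) ;; ISet 22 (queue rd) ;; ISet 23 (par v) ;;
  If (BRle (RGet 1 p) (RGet 22 v)) (RPut 1 v (RGet 1 p))
  (If (BRle (ROp RSub (RGet 1 p) (RVar 0)) (RGet 22 v)) (RPut 1 v (RGet 22 v))
    (RPut 1 v (ROp RSub (RGet 1 p) (RVar 0)))).

(** Allocation starts at 1 because address 0 is the null pointer. Dequeueing erases nothing, so the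
    last loop can walk back through the queue. *)
Definition main : cmd :=
  ISet 1 (ICst 1) ;;
  for_all_vertices init_vertex ;;
  for_all_vertices count_child ;;
  ISet 20 (ICst 0) ;; ISet 21 (ICst 0) ;;
  ISet 27 v ;;
  for_all_vertices enqueue_leaf ;;
  While (BNot (BIle wr rd)) process ;;
  ISet 22 (IVar 27) ;; solve ;; RPut 1 v (RGet 22 v) ;;
  While (BNot (BIle rd (ICst 0))) output_vertex.

Definition lir_program : program :=
  [:: main; bulk; group; flatten; find_root].

Lemma lir_program_alloc : all alloc_only (behead lir_program).
Proof. by []. Qed.

End Programs.

(** * Correctness and cost of the procedures *)

Section Procedures.
Variable R : realType.
Implicit Types (st : state R) (t c r : forest R) (Q : nat -> state R -> Prop).
Local Open Scope nat_scope.

Local Notation run := (ev lir_program).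

Lemma exec_heap (cm : cmd) st k st' :
  exec lir_program cm st k st' -> alloc_only cm -> heap_le st st'.
Proof. exact/exec_heap_le/lir_program_alloc. Qed.

(** * Allocation, stack and copies *)

Lemma run_alloc st Q :
  (forall st', heap_le st st' ->
     (forall x, ivar st' x = if x == 1 then (ivar st 1).+1 else ivar st x) ->
     rvar st' = rvar st ->
     [/\ iarr st' 1 (ivar st 1) = ivar st 11,
         iarr st' 2 (ivar st 1) = ivar st 12
       & iarr st' 3 (ivar st 1) = ivar st 9] ->
     [/\ rarr st' 2 (ivar st 1) = rvar st 2,
         rarr st' 3 (ivar st 1) = rvar st 3
       & rarr st' 4 (ivar st 1) = rvar st 4] -> Q 7 st') ->
  run alloc st Q.
Proof.
move=> h; rewrite /alloc; do 6![apply: ev_seq; first [apply: ev_iput | apply: ev_rput]].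
apply: ev_iset; apply: h; [|by []|by []| |].
- split=> [|x]; first by rewrite /= /upd /=.
  by move=> lx; rewrite /= /upd /= (ltn_eqF lx).
- by rewrite /= /upd /= eqxx.
- by rewrite /= /upd /= eqxx.
Qed.

Record pushed st (n : nat) st' : Prop := Pushed {
  pushed_heap : heap_le st st';
  pushed_ivar : forall x, x \notin [:: 1; 2; 11; 12] -> ivar st' x = ivar st x;
  pushed_rvar : rvar st' = rvar st;
  pushed_stack : 0 < ivar st' 2 < ivar st' 1;
  pushed_child : iarr st' 1 (ivar st' 2) = n;
  pushed_next : iarr st' 2 (ivar st' 2) = ivar st 2;
  pushed_len : rarr st' 2 (ivar st' 2) = rvar st 2;
  pushed_wt : rarr st' 3 (ivar st' 2) = rvar st 3 }.

Lemma run_push e st Q : 0 < ivar st 1 ->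
  (forall st', pushed st (ieval st e) st' -> Q 10 st') -> run (push e) st Q.
Proof.
move=> F h; rewrite /push; apply: ev_seq; apply: ev_iset; apply: ev_seq; apply: ev_iset.
apply: ev_seq; apply: run_alloc => st1 hp hi hr [hc hn hf] [hl hw hm].
move: hc hn hf hl hw hm; rewrite /= /upd /= => hc hn hf hl hw hm.
apply: ev_iset; apply: h; split=> //.
- move=> x; rewrite !inE => /norP[x1 /norP[x2 /norP[x11 x12]]].
  by rewrite /= /upd (negPf x2) hi (negPf x1) /= /upd (negPf x11) (negPf x12).
all: by rewrite /= /upd /= hi /= /upd /= ?ltnSn ?F ?hc ?hn ?hl ?hw ?hr.
Qed.

Record copied st (s n : nat) st' : Prop := Copied {
  copied_heap : heap_le st st';
  copied_ivar : forall x, x \notin [:: 1; 9; 11; 12] -> ivar st' x = ivar st x;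
  copied_rvar : rvar st' 1 = rvar st 1;
  copied_free : ivar st' 1 = (ivar st 1).+1;
  copied_next : iarr st' 2 (ivar st 1) = n;
  copied_cell : [/\ iarr st' 1 (ivar st 1) = iarr st 1 s,
                    iarr st' 3 (ivar st 1) = iarr st 3 s
                  & [/\ rarr st' 2 (ivar st 1) = rarr st 2 s,
                    rarr st' 3 (ivar st 1) = rarr st 3 s
                  & rarr st' 4 (ivar st 1) = rarr st 4 s]] }.

(** [copy] keeps evaluating its arguments while it overwrites registers 9, 11 and 12. *)
Definition stable st (e : iexp) := forall st',
  (forall x, x \notin [:: 9; 11; 12] -> ivar st' x = ivar st x) ->
  iarr st' = iarr st -> ieval st' e = ieval st e.

Lemma run_copy e nx st Q : stable st e -> stable st nx ->
  (forall st', copied st (ieval st e) (ieval st nx) st' -> Q 13 st') ->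
  run (copy e nx) st Q.
Proof.
move=> se sn h; rewrite /copy.
have upd3 (f : nat -> nat) n m k x : x \notin [:: 9; 11; 12] ->
    upd (upd (upd f 11 n) 12 m) 9 k x = f x.
  by rewrite !inE /upd => /norP[/negPf -> /norP[/negPf -> /negPf ->]].
do 3![apply: ev_seq; apply: ev_iset]; do 3![apply: ev_seq; apply: ev_rset].
have off1 n x : x \notin [:: 9; 11; 12] -> upd (ivar st) 11 n x = ivar st x.
  by rewrite !inE /upd => /norP[_ /norP[/negPf -> _]].
have off2 n m x : x \notin [:: 9; 11; 12] -> upd (upd (ivar st) 11 n) 12 m x = ivar st x.
  by rewrite !inE /upd => /norP[_ /norP[/negPf -> /negPf ->]].
apply: run_alloc => st1 hp hi hr [hc hn hf] [hl hw hm].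
move: hc hn hf hl hw hm; rewrite /= !se ?sn //=; try by [exact: off1|exact: off2|exact: upd3].
rewrite /upd /= => hc hn hf hl hw hm.
apply: h; split=> //.
- move=> x; rewrite !inE => /norP[x1 /norP[x9 /norP[x11 x12]]].
  by rewrite hi (negPf x1) /= /upd (negPf x9) (negPf x12) (negPf x11).
- by rewrite hr /= /upd.
Qed.

Lemma copied_rep st s n st' lf c r t : copied st s n st' -> 0 < ivar st 1 ->
  rep st s (Cell lf c r) -> rep st' n t -> rep st' (ivar st 1) (Cell lf c t).
Proof.
move=> [hp _ _ F hn [hc hf [hl hw hm]]] F0 [/andP[s0 sF] rc _ [e1 e2 e3 e4]] rt.
rewrite /rep -/rep.
rewrite hc hf hl hw hm hn F ltnSn F0; split=> //.
exact: rep_le rc.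
Qed.

(** * Grouping of siblings *)

Lemma run_measure st Q c : rep st (ivar st 7) c ->
  (forall k st', (forall x, x \notin [:: 8; 9] -> ivar st' x = ivar st x) ->
     rvar st' 1 = rvar st 1 -> iarr st' = iarr st -> rarr st' = rarr st ->
     ivar st' 9 = linf (leaves c) -> rvar st' 2 = llen (leaves c) ->
     rvar st' 3 = lwt (leaves c) -> rvar st' 4 = lmom (leaves c) ->
     k <= 8 * fsize c + 6 -> Q k st') ->
  run measure st Q.
Proof.
move=> rc h; rewrite /measure; do 2![apply: ev_seq; apply: ev_iset].
do 3![apply: ev_seq; apply: ev_rset].
set st0 := set_rvar _ _ _; set W := While _ _.
(* Generalised to a loop entered with the totals of a list [l] already accumulated. *)
suff W_run c' l s Q' : rep s (ivar s 8) c' -> ivar s 9 = linf l ->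
    rvar s 2 = llen l -> rvar s 3 = lwt l -> rvar s 4 = lmom l ->
  (forall k st', (forall x, x \notin [:: 8; 9] -> ivar st' x = ivar s x) ->
     rvar st' 1 = rvar s 1 -> iarr st' = iarr s -> rarr st' = rarr s ->
     ivar st' 9 = linf (l ++ leaves c') -> rvar st' 2 = llen (l ++ leaves c') ->
     rvar st' 3 = lwt (l ++ leaves c') -> rvar st' 4 = lmom (l ++ leaves c') ->
     k <= 8 * fsize c' + 1 -> Q' k st') -> run W s Q'.
  apply: (W_run c [::]) => //.
  - by apply: rep_le rc.
  - move=> k st' hi hr ha hb h9 h2 h3 h4 hk; apply: h => //.
      move=> x xn; rewrite hi //; move: xn; rewrite !inE /= /upd.
      by move=> /norP[/negPf -> /negPf ->].
    by lia.
elim: c' l s Q' {rc h} => [|lf c1 _ r IH] l s Q'.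
  rewrite /rep /= => e8 h9 h2 h3 h4 h; apply: ev_while_end; first by rewrite /= e8.
  by apply: h => //; rewrite cats0.
move=> [/andP[p0 pF] rc rr [e1 e2 e3 e4]] h9 h2 h3 h4 h.
apply: ev_while_step; first by rewrite /= -lt0n.
do 3![apply: ev_seq; apply: ev_rset]; apply: ev_seq; apply: ev_if.
rewrite /= e1.
set s3 := set_rvar _ _ _.
have linf_cat : linf (l ++ head_leaves lf c1) = linf l || linf (head_leaves lf c1).
  by rewrite /linf has_cat.
have tail s4 : (forall x, x != 9 -> ivar s4 x = ivar s x) ->
    ivar s4 9 = linf (l ++ head_leaves lf c1) -> rvar s4 = rvar s3 ->
    iarr s4 = iarr s -> rarr s4 = rarr s ->
    run (ISet 8 (IGet 2 (IVar 8))) s4 (fun k st' => run W st' (fun j st' =>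
      Q' (1 + (1 + (1 + (2 + k))) + j).+1 st')).
  move=> i4 h94 r4 a4 b4; apply: ev_iset; apply: (IH (l ++ head_leaves lf c1)).
  - apply: (@rep_le _ s); first by split; rewrite /= ?a4 ?b4 // /upd /= i4.
    by rewrite /= /upd /= a4 i4.
  - by rewrite /= /upd.
  - by rewrite /= r4 /s3 /= /upd /= h2 e2 llen_cat.
  - by rewrite /= r4 /s3 /= /upd /= h3 e3 lwt_cat.
  - by rewrite /= r4 /s3 /= /upd /= h2 h4 e3 e4 lmom_cat.
  move=> k st' hi hr ha hb k9 k2 k3 k4 hk; apply: h => //.
  - move=> x xn; rewrite hi // /= /upd; move: xn; rewrite !inE.
    by move=> /norP[/negPf -> x9]; rewrite i4.
  - by rewrite hr /= r4 /s3 /= /upd.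
  - by rewrite ha /= a4.
  - by rewrite hb /= b4.
  - by rewrite k9 -catA.
  - by rewrite k2 -catA.
  - by rewrite k3 -catA.
  - by rewrite k4 -catA.
  - by move=> /=; lia.
case hb : (linf (head_leaves lf c1)) => /=; [apply: ev_iset | apply: ev_skip]; apply: tail => //=.
- by move=> x; rewrite /upd => /negPf ->.
- by rewrite /upd /= linf_cat hb orbT.
- by rewrite linf_cat hb orbF.
Qed.

Lemma run_make_node st Q c o : rep st (ivar st 7) c -> 0 < fsize c ->
  rep st (ivar st 4) o -> 0 < ivar st 1 ->
  (forall k st', heap_le st st' ->
     (forall x, x \notin [:: 1; 4; 8; 9; 11; 12] -> ivar st' x = ivar st x) ->
     rvar st' 1 = rvar st 1 ->
     rep st' (ivar st' 4) (Cell (0, 0, false)%R c o) ->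
     k <= 8 * fsize c + 16 -> Q k st') ->
  run make_node st Q.
Proof.
move=> rc c0 ro F h; rewrite /make_node; apply: ev_seq.
apply: (run_measure rc) => k s1 hi hr ha hb h9 h2 h3 h4 hk.
have hp1 : heap_le st s1 by split; rewrite ?hi // ha hb.
do 2![apply: ev_seq; apply: ev_iset]; apply: ev_seq.
apply: run_alloc => s2 hp2 hi2 hr2 [hc hn hf] [hl hw hm].
have hp : heap_le st s2 by apply: heap_le_trans hp1 _; case: hp2.
move: hi2 hr2 hc hn hf hl hw hm; rewrite /= /upd /=.
rewrite (hi 1 isT) (hi 4 isT) (hi 7 isT) h9 h2 h3 h4 => hi2 hr2 hc hn hf hl hw hm.
apply: ev_iset; apply: h => //; last by lia.
- move=> x; rewrite !inE => /norP[x1 /norP[x4 /norP[x8 /norP[x9 /norP[x11 x12]]]]].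
  rewrite /= /upd (negPf x4) hi2 (negPf x1) (negPf x12) (negPf x11) hi //.
  by rewrite !inE negb_or x8.
- by rewrite /= hr2.
rewrite /rep -/rep /= /upd /= hi2 /= hc hn hf hl hw hm.
split; first by rewrite F ltnSn.
- by apply: rep_le rc; case: hp => *; split.
- by apply: rep_le ro; case: hp => *; split.
by rewrite head_leavesE.
Qed.

Definition group_regs : pred nat := fun x => x \in [:: 1; 2; 4; 7; 8; 9; 11; 12].
Definition len_regs : pred nat := fun x => x \in [:: 2; 3; 4].
Definition heap_arrays : pred nat := fun x => x \in [:: 1; 2; 3].

Lemma group_frame st k st' : exec lir_program group st k st' ->
  agree_off group_regs len_regs heap_arrays len_regs st st'.
Proof.
move=> ex; apply: (exec_agree (F := pred1 2) _ ex) => //.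
by move=> f /eqP ->.
Qed.

(** Two siblings are split off per call until two or three remain, so there are [(fsize c)./2]
    nodes. This halving lets the credits of one level pay for the next. *)
Lemma run_group c o h st :
  rep st (ivar st 7) c -> rep st (ivar st 4) o -> 0 < ivar st 1 ->
  1 < fsize c -> balanced h c -> balanced h.+1 o ->
  run group st (fun k st' => exists o', [/\ rep st' (ivar st' 4) o',
    balanced h.+1 o', leaves o' = leaves c ++ leaves o,
    fsize o' = (fsize c)./2 + fsize o
    & ivar st' 2 = ivar st 2 /\ k <= 40 * fsize c]).
Proof.
have [n] := ubnP (fsize c); elim: n c o st => // n IH c o st cn rc ro F c1 bc bo.
(* [k0] counts the tests made before [make_node] is reached. *)
have node (k0 : nat) : fsize c <= 3 -> k0 <= 2 ->
    run make_node st (fun k st' => exists o', [/\ rep st' (ivar st' 4) o',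
    balanced h.+1 o', leaves o' = leaves c ++ leaves o,
    fsize o' = (fsize c)./2 + fsize o
    & ivar st' 2 = ivar st 2 /\ k0 + k <= 40 * fsize c]).
  move=> c3 k02; apply: (run_make_node rc (ltnW c1) ro F) => k s1 hp hi hr r1 hk.
  exists (Cell (0, 0, false)%R c o); split=> //.
  - by rewrite balanced_cell c1 c3 bc.
  - by rewrite leavesE head_leavesE // ltnW.
  - by rewrite /=; move: c1 c3; case: (fsize c) => [|[|[|[|]]]].
  by split; [rewrite hi | lia].
case: c rc c1 cn bc node => // lf1 a1 [|lf2 a2 c] // rc c1 cn bc node.
have [/andP[p0 pF] ra1 r2 info1] := rep_cell rc.
have [/andP[q0 qF] ra2 r3 info2] := rep_cell r2.
rewrite /group; apply: ev_if; rewrite [beval _ _]/= (rep_eq0 r3).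
case: (posnP (fsize c)) => [c0|c0].
  by apply: (node 1) => //=; rewrite c0.
rewrite ?gtn_eqF //; apply: ev_if; rewrite [beval _ _]/=.
case: c rc r2 r3 c1 c0 cn bc node => // lf3 a3 c rc r2 r3 c1 _ cn bc node.
have [/andP[s0 sF] ra3 r4 info3] := rep_cell r3.
rewrite (rep_eq0 r4); case: (posnP (fsize c)) => [c0|c0].
  by apply: (node 2) => //=; rewrite c0.
rewrite ?gtn_eqF //.
set P := ivar st 7 in rc ra1 r2 ra2 r3 ra3 r4 p0 pF q0 qF s0 sF info1 info2 *.
apply: ev_seq; apply: run_push => // s1 pu; apply: ev_seq; apply: ev_iset.
have F1 : 0 < ivar s1 1 by apply: leq_trans F _; case: (pushed_heap pu).
have sP : ivar s1 7 = P by rewrite (pushed_ivar pu).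
have rc1 := rep_le (pushed_heap pu) rc.
have e2 : ieval s1 (IGet 2 (IGet 2 (IVar 7))) = iarr st 2 (iarr st 2 P).
  rewrite /= sP; case: (pushed_heap pu) => _ hp.
  by have [[_ -> _] _] := hp _ pF; have [[_ -> _] _] := hp _ qF.
have bc' : balanced h (Cell lf3 a3 c).
  by move: bc; rewrite !balanced_cell => /andP[_ /andP[_]].
apply: ev_seq; apply: ev_call.
apply: (ev_conseq (IH (Cell lf3 a3 c) o _ _ _ _ _ _ bc' bo)) => //.
- by move: cn => /=; lia.
- by rewrite e2 /= /upd /=; apply: rep_le r3; exact: pushed_heap pu.
- by rewrite /= /upd /= (pushed_ivar pu (x := 4)) //; apply: rep_le ro; exact: pushed_heap pu.
move=> k s2 xc2 [ o2 [ro2 bo2 lo2 so2 [sp2 hk2]]].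
have hp2 : heap_le s1 s2 by apply: heap_le_trans (exec_heap xc2 isT).
have F2 : 0 < ivar s2 1 by apply: leq_trans F1 _; case: hp2.
have hps2 := heap_le_trans (pushed_heap pu) hp2.
have /andP[t0 tF] := pushed_stack pu.
have [_ /(_ _ tF)[[ch2 nx2 _] _]] := hp2.
have sp2' : ivar s2 2 = ivar s1 2 by rewrite sp2 /upd.
apply: ev_seq; apply: ev_seq; apply: ev_iset; apply: ev_iset.
set s3 := set_ivar _ 2 _.
have i3 x : x \notin [:: 2; 7] -> ivar s3 x = ivar s2 x.
  by rewrite !inE => /norP[/negPf x2 /negPf x7]; rewrite /s3 /= /upd x2 x7.
have i37 : ivar s3 7 = P by rewrite /s3 /= /upd /= sp2' ch2 (pushed_child pu).
have i32 : ivar s3 2 = ivar st 2.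
  by rewrite /s3 /= /upd /= sp2' nx2 (pushed_next pu).
have hp3 : heap_le s2 s3 by [].
clearbody s3.
have F3 : 0 < ivar s3 1 by rewrite i3.
have hps3 : heap_le st s3 := heap_le_trans hps2 hp3.
have r23 : rep s3 (iarr s3 2 P) (Cell lf2 a2 (Cell lf3 a3 c)).
  by have [_ _ ? _] := rep_le hps3 rc.
(* The second sibling is copied with a null successor, then the first with that copy as its
   successor: this cuts the pair off from the others. *)
apply: ev_seq; apply: run_copy.
- by move=> s' h1 h2 /=; rewrite h1 // h2.
- by [].
rewrite /= i37 => s4 cp4.
have F4 : 0 < ivar s4 1 by rewrite (copied_free cp4).
have r4' : rep s4 (ivar s3 1) (Cell lf2 a2 Nil) := copied_rep cp4 F3 r23 (erefl 0 : rep s4 0 Nil).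
have i4 := copied_ivar cp4.
have hps4 := heap_le_trans hps3 (copied_heap cp4).
apply: ev_seq; apply: run_copy.
- by move=> s' h1 h2 /=; rewrite h1.
- by move=> s' h1 h2 /=; rewrite h1.
rewrite /= i4 // i37 (copied_free cp4) /= => s5 cp5.
have r5 : rep s5 (ivar s4 1) (Cell lf1 a1 (Cell lf2 a2 Nil)).
  exact: copied_rep cp5 F4 (rep_le hps4 rc) (rep_le (copied_heap cp5) r4').
have i5 := copied_ivar cp5.
apply: ev_seq; apply: ev_iset.
set s6 := set_ivar _ 7 _.
have i67 : ivar s6 7 = ivar s4 1 by rewrite /s6 /= /upd /= (copied_free cp5).
have i6 x : x != 7 -> ivar s6 x = ivar s5 x by rewrite /s6 /= /upd => /negPf ->.
have hp6 : heap_le s5 s6 by [].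
clearbody s6.
have ro6 : rep s6 (ivar s6 4) o2.
  rewrite i6 // i5 // i4 // i3 //; apply: rep_le ro2.
  have := heap_le_trans (copied_heap cp4) (copied_heap cp5).
  by move=> h5; apply: heap_le_trans hp3 (heap_le_trans h5 hp6).
have r6 : rep s6 (ivar s6 7) (Cell lf1 a1 (Cell lf2 a2 Nil)).
  by rewrite i67; apply: rep_le r5.
apply: (run_make_node r6 isT ro6); first by rewrite i6 // (copied_free cp5).
move=> k7 s7 hp7 hi7 hr7 r7 hk7.
exists (Cell (0, 0, false)%R (Cell lf1 a1 (Cell lf2 a2 Nil)) o2); split=> //.
- rewrite balanced_cell bo2 andbT !balanced_cell /=.
  by move: bc; rewrite !balanced_cell => /andP[-> /andP[-> _]].
- by rewrite leavesE head_leavesE // lo2 !leavesE cats0 -!catA.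
- by rewrite /= so2 /= !addSn.
split; first by rewrite hi7 // i6 // i5 // i4.
by move: hk2 hk7; rewrite /=; lia.
Qed.

(** * Insertion of sorted items into a forest *)

Lemma run_pop x st Q : x != 2 ->
  (forall st', (forall y, y \notin [:: 2; x] -> ivar st' y = ivar st y) ->
     ivar st' x = iarr st 1 (ivar st 2) -> ivar st' 2 = iarr st 2 (ivar st 2) ->
     rvar st' = rvar st -> iarr st' = iarr st -> rarr st' = rarr st -> Q 2 st') ->
  run (pop x) st Q.
Proof.
move=> x2 h; apply: ev_seq; apply: ev_iset; apply: ev_iset; apply: h => //=.
- by move=> y; rewrite !inE => /norP[/negPf y2 /negPf yx]; rewrite /upd y2 yx.
- by rewrite /upd eqxx (negPf x2).
- by rewrite /upd /= eq_sym (negPf x2).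
Qed.

Lemma heap_le_same st st' : ivar st' 1 = ivar st 1 -> iarr st' = iarr st ->
  rarr st' = rarr st -> heap_le st st'.
Proof. by move=> e1 e2 e3; split; rewrite ?e1 // e2 e3. Qed.

Lemma heap_le_child st st' x : heap_le st st' -> x < ivar st 1 ->
  iarr st' 1 x = iarr st 1 x.
Proof. by move=> [_ h] /h[[]]. Qed.

Lemma heap_le_next st st' x : heap_le st st' -> x < ivar st 1 ->
  iarr st' 2 x = iarr st 2 x.
Proof. by move=> [_ h] /h[[]]. Qed.

Lemma heap_le_len st st' x : heap_le st st' -> x < ivar st 1 ->
  rarr st' 2 x = rarr st 2 x.
Proof. by move=> [_ h] /h[_ []]. Qed.

Lemma heap_le_wt st st' x : heap_le st st' -> x < ivar st 1 ->
  rarr st' 3 x = rarr st 3 x.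
Proof. by move=> [_ h] /h[_ []]. Qed.

Lemma heap_le_free st st' : heap_le st st' -> 0 < ivar st 1 -> 0 < ivar st' 1.
Proof. by move=> [h _] F; exact: leq_trans F h. Qed.

Definition skips st t (its : seq (item R)) : bool :=
  if its is it :: _ then
    if t is Cell lf c _ then
      ~~ linf (head_leaves lf c) &&
      (rvar st 1 + llen (head_leaves lf c) <= it.1.1)%R
    else true
  else true.

Lemma bulk_skipsE st lf c r its :
  rep st (ivar st 3) (Cell lf c r) -> items_rep st (ivar st 6) its ->
  beval st bulk_skips = skips st (Cell lf c r) its.
Proof.
move=> /rep_cell[_ _ _ [e1 e2 _ _]] ri.
rewrite /= e1 e2 (items_rep_eq0 ri); case: its ri => [|[[x d] w] its] //=.
by move=> [_ -> _ _ _]; rewrite negbK; case: linf.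
Qed.

(* The visited nodes of height greater than J are charged to the tree, which has
   at most size/2^J of them, and the lower ones to the items, each of which is
   responsible for at most J visits. The credit [80 * fsize t'] on the left pays
   for grouping t'. *)
Section BulkCost.
Variable J : nat.

(** Leftover items stand on both sides of the bound, so only the absorbed ones pay: 150 units for
    the leaf they become, and 500 for each level up to [J], hence [minn h J]. *)
Definition bulk_spec h t its st k st' := exists t' its',
  [/\ rep st' (ivar st' 4) t', items_rep st' (ivar st' 6) its',
    balanced h t', insertion (leaves t) its (rvar st 1) (leaves t') its'
  & [/\ rvar st' 1 = (rvar st 1 + llen (leaves t))%R, ivar st' 5 = h,
     ivar st' 2 = ivar st 2, fsize t <= fsize t'
   & k + 80 * fsize t' + 150 * size its' + 500 * (size its' * minn h J) <=
     150 * fsize t + 10 + 500 * high_nodes J h t +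
       150 * size its + 500 * (size its * minn h J)]].

Definition bulk_pre h t its st :=
  [/\ rep st (ivar st 3) t, items_rep st (ivar st 6) its, ivar st 5 = h,
      balanced h t & ascending (leaves t)] /\ 0 < ivar st 1.

(** The 150 units of the skipped tree cover its copy and the 80 units of grouping credit that it
    keeps. *)
Lemma bulk_skip lf c r h its st :
  (forall its st, bulk_pre h r its st -> run bulk st (bulk_spec h r its st)) ->
  bulk_pre h (Cell lf c r) its st -> skips st (Cell lf c r) its ->
  run bulk st (bulk_spec h (Cell lf c r) its st).
Proof.
move=> IH [[rt ri hh bt asc] F] sk.
have [/andP[p0 pF] rc rr [_ e2 _ _]] := rep_cell rt.
have [asc1 asc2] : ascending (head_leaves lf c) /\ ascending (leaves r).
  exact: ascending_cat.
have br : balanced h r by move: bt; rewrite balanced_cell => /andP[].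
have b1 : beval st (BIeq (IVar 3) (ICst 0)) = false by rewrite /= (rep_eq0 rt).
apply: ev_if; rewrite b1; apply: ev_if; rewrite (bulk_skipsE rt ri) sk {b1}.
apply: ev_seq; apply: run_push => // s1 pu; apply: ev_seq; apply: ev_rset.
apply: ev_seq; apply: ev_iset.
have hp1 := pushed_heap pu; have i1 := pushed_ivar pu; have r1 := pushed_rvar pu.
set s2 := set_ivar _ 3 _.
have i2 y : y \notin [:: 1; 2; 3; 11; 12] -> ivar s2 y = ivar st y.
  rewrite /s2 /= /upd !inE => /norP[y1 /norP[y2 /norP[/negPf -> /norP[y11 y12]]]].
  by rewrite i1 // !inE !negb_or y1 y2 y11.
have i23 : ivar s2 3 = iarr st 2 (ivar st 3).
  by rewrite /s2 /= /upd /= i1 // (heap_le_next hp1).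
have i22 : ivar s2 2 = ivar s1 2 by [].
have r2 : rvar s2 1 = (rvar st 1 + llen (head_leaves lf c))%R.
  by rewrite /s2 /= /upd /= r1 i1 // (heap_le_len hp1) ?e2.
have hp2 : heap_le s1 s2 by [].
clearbody s2; have hp02 := heap_le_trans hp1 hp2.
apply: ev_seq; apply: ev_call.
apply: (ev_conseq (IH its s2 _)).
  split; last exact: heap_le_free hp02 F.
  by split; rewrite ?i23 ?i2 //; [apply: rep_le rr | apply: items_rep_le ri].
move=> k s3 x3 [t' [its' [rt' ri' bt' ins [p3 h3 sp3 ft3 k3]]]].
have hp3 := exec_heap x3 isT.
have /andP[t0 tF] := pushed_stack pu.
have hp13 := heap_le_trans hp2 hp3.
apply: ev_seq; apply: run_pop => // s4 i4 i43 i42 r4 a4 b4.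
have hp4 : heap_le s3 s4 by apply: heap_le_same; rewrite ?i4.
have hp14 := heap_le_trans hp13 hp4; have hp04 := heap_le_trans hp1 hp14.
have F4 := heap_le_free hp04 F.
have {}i43 : ivar s4 3 = ivar st 3.
  by rewrite i43 sp3 i22 (heap_le_child hp13) // (pushed_child pu).
have {}i42 : ivar s4 2 = ivar st 2.
  by rewrite i42 sp3 i22 (heap_le_next hp13) // (pushed_next pu).
apply: ev_seq; apply: run_copy.
- by move=> s' f1 f2 /=; rewrite f1.
- by move=> s' f1 f2 /=; rewrite f1.
rewrite /= i43 => s5 cp5; apply: ev_iset.
have i5 := copied_ivar cp5; have hp5 := copied_heap cp5.
have hp35 := heap_le_trans hp4 hp5.
exists (Cell lf c t'), its'; split.
- rewrite /= /upd /= (copied_free cp5) /=.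
  apply: (@rep_le _ s5) => //.
  apply: copied_rep cp5 F4 (rep_le hp04 rt) _.
  by rewrite i4 //; apply: rep_le rt'.
- rewrite /= /upd /= (i5 6) // (i4 6) //; apply: (@items_rep_le _ s5) => //.
  exact: items_rep_le ri'.
- by rewrite balanced_cell bt' andbT; move: bt; rewrite balanced_cell => /andP[].
- rewrite !leavesE; apply: insertion_cat; last by rewrite -r2; exact: ins.
  by apply: insertion_skip.
split.
- by rewrite /= (copied_rvar cp5) r4 p3 r2 leavesE llen_cat addrA.
- by rewrite /= /upd /= (i5 5) // i4.
- by rewrite /= /upd /= (i5 2).
- exact: ft3.
move: k3 => /=; lia.
Qed.

Lemma rep_leaf st p n lf r : 0 < p < ivar st 1 -> iarr st 1 p = 0 ->
  iarr st 2 p = n -> rep st n r -> iarr st 3 p = nat_of_bool lf.2 ->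
  rarr st 2 p = lf.1.1 -> rarr st 3 p = lf.1.2 ->
  rarr st 4 p = (lf.1.2 * lf.1.1)%R -> rep st p (Cell lf Nil r).
Proof.
move=> pF c0 nn rr e1 e2 e3 e4; rewrite /rep -/rep c0 nn; split=> //.
rewrite e1 e2 e3 e4 /linf /= orbF; split=> //; rewrite ?addr0 //.
by rewrite mulr0 !addr0.
Qed.

(** The leaf behind the inserted item is rebuilt with what remains of its gap and visited again,
    hence a hypothesis for every gap [g] and for one item fewer. *)
Lemma bulk_item lf r x dx w its st :
  (forall g st, bulk_pre 0 (Cell (g, lf.1.2, lf.2) Nil r) its st ->
     run bulk st (bulk_spec 0 (Cell (g, lf.1.2, lf.2) Nil r) its st)) ->
  bulk_pre 0 (Cell lf Nil r) ((x, dx, w) :: its) st ->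
  ~~ skips st (Cell lf Nil r) ((x, dx, w) :: its) ->
  run bulk st (bulk_spec 0 (Cell lf Nil r) ((x, dx, w) :: its) st).
Proof.
case: lf => [[g d] b] IH [[rt ri hh bt asc] F] sk.
have [/andP[p0 pF] rc rr [f1 f2 f3 f4]] := rep_cell rt.
rewrite /linf /= ?orbF ?addr0 in f1 f2 f3.
have [/andP[q0 qF] g2 g3 g4 ri'] := items_rep_cons ri.
rewrite /= in IH.
have br : balanced 0 r by move: bt; rewrite balanced_cell.
have b1 : beval st (BIeq (IVar 3) (ICst 0)) = false by rewrite /= (rep_eq0 rt).
have b2 : beval st (BIeq (IVar 5) (ICst 0)) = true by rewrite /= hh.
have b3 : beval st bulk_skips = false by rewrite (bulk_skipsE rt ri) (negPf sk).
apply: ev_if; rewrite b1; apply: ev_if; rewrite b3 {b1 b3}.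
apply: ev_if; rewrite b2 {b2}.
apply: ev_seq; apply: ev_rset; apply: ev_seq; apply: ev_rset; apply: ev_seq.
apply: run_push => // s1 [hp1 i1 r1 /andP[t0 tF] ch1 nx1 ln1 wt1].
rewrite /= /upd /= g2 g4 in ln1; rewrite /= /upd /= g3 in wt1.
rewrite /= in i1 nx1 ch1.
have {}r1 : rvar s1 1 = rvar st 1 by rewrite r1.
have {}hp1 : heap_le st s1 by [].
do 3![apply: ev_seq; apply: ev_rset]; do 3![apply: ev_seq; apply: ev_iset].
apply: ev_seq; apply: run_alloc.
rewrite /= /upd /= (i1 3) // (i1 6) // (heap_le_len hp1 pF) (heap_le_len hp1 qF) f2 g2 r1.
rewrite (heap_le_next hp1 pF) (heap_le_wt hp1 pF) f3.
have fl1 : iarr s1 3 (ivar st 3) = b by case: hp1 => _ /(_ _ pF)[[_ _ ->]].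
rewrite fl1 => s2 hp2 i2 r2 [hc hn hf] [hl hw hm].
have {}hp2 : heap_le s1 s2 by apply: heap_le_trans hp2.
do 2![apply: ev_seq; first [apply: ev_iset | apply: ev_rset]].
apply: ev_seq; apply: ev_iset; set s3 := set_ivar _ 6 _.
have F1 := heap_le_free hp1 F; have hp02 := heap_le_trans hp1 hp2.
have i26 : ivar s2 6 = ivar st 6 by rewrite i2 /= i1.
have i33 : ivar s3 3 = ivar s1 1 by rewrite /s3 /= /upd /= i2.
have i36 : ivar s3 6 = iarr st 2 (ivar st 6).
  by rewrite /s3 /= /upd /= i26 (heap_le_next hp02).
have r3 : rvar s3 1 = x by rewrite /s3 /= /upd /= i26 (heap_le_len hp02).
have i35 : ivar s3 5 = 0 by rewrite /s3 /= /upd /= i2 /= i1.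
have i32 : ivar s3 2 = ivar s1 2 by rewrite /s3 /= /upd /= i2.
have hp23 : heap_le s2 s3 by [].
clearbody s3; have hp13 := heap_le_trans hp2 hp23.
have hp03 := heap_le_trans hp1 hp13.
have rl3 : rep s3 (ivar s3 3) (Cell (rvar st 1 + g - x, d, b)%R Nil r).
  have lt : ivar s1 1 < ivar s2 1 by rewrite i2.
  have lt3 : ivar s1 1 < ivar s3 1 by case: hp23 => /(leq_trans lt).
  rewrite i33; apply: (@rep_leaf _ _ (iarr st 2 (ivar st 3))) => //=.
  - by rewrite F1.
  - by rewrite (heap_le_child hp23).
  - by rewrite (heap_le_next hp23).
  - exact: rep_le rr.
  - by case: hp23 => _ /(_ _ lt)[[_ _ ->]].
  - by rewrite (heap_le_len hp23).
  - by rewrite (heap_le_wt hp23).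
  - by case: hp23 => _ /(_ _ lt)[_ [_ _ ->]].
apply: ev_seq; apply: ev_call.
apply: (ev_conseq (IH _ s3 (conj (And5 rl3 _ i35 _ _) _))) => //.
- by rewrite i36; apply: items_rep_le ri'.
- exact: heap_le_free hp03 F.
move=> k s4 x4 [t' [its' [rt' ri4 bt' ins [p4 h4 sp4 ft4 k4]]]].
have hp4 := exec_heap x4 isT.
have hp14 := heap_le_trans hp13 hp4.
have {}sp4 : ivar s4 2 = ivar s1 2 by rewrite sp4 i32.
have F4 := heap_le_free hp14 F1.
do 3![apply: ev_seq; apply: ev_rset]; do 2![apply: ev_seq; apply: ev_iset].
apply: ev_seq; apply: run_pop => // s5.
rewrite /= /upd /= => i5 i511 i52 r5 a5 b5.
move: i511 i52 r5; rewrite sp4 (heap_le_child hp14) // (heap_le_next hp14) //.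
rewrite (heap_le_len hp14) // (heap_le_wt hp14) // ch1 nx1 ln1 wt1.
move=> i511 i52 r5.
apply: ev_seq; apply: run_alloc.
rewrite r5 (i5 1) // (i5 12) // (i5 9) // i511 /= => s6 hp6 i6 r6 [hc6 hn6 hf6] [hl6 hw6 hm6].
have hp45 : heap_le s4 s5 by apply: heap_le_same => //; rewrite i5.
have hp46 := heap_le_trans hp45 hp6.
apply: ev_iset; exists (Cell (x - rvar st 1 + w, dx, false)%R Nil t'), its'.
have i64 : (ivar s6 1).-1 = ivar s4 1 by rewrite i6.
split.
- rewrite /= /upd /= i64; apply: (@rep_le _ s6) => //.
  apply: (@rep_leaf _ _ (ivar s4 4)) => //=; last by exact: rep_le rt'.
  by rewrite F4 i6 /= ltnS.
- rewrite /= /upd /= (i6 6) /= (i5 6) //=; apply: (@items_rep_le _ s6) => //.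
  exact: items_rep_le ri4.
- by rewrite balanced_cell bt'.
- rewrite !leavesE /=; apply: InsItem; last by move: ins; rewrite leavesE r3.
  by move: sk; rewrite /skips /linf /= orbF addr0 negb_and negbK -ltNge.
split.
- by rewrite /= r6 /= p4 r3 !leavesE /=; ring.
- by rewrite /= /upd /= (i6 5) /= (i5 5).
- by rewrite /= /upd /= (i6 2) /= i52.
- by rewrite /= ltnS; apply: leq_trans _ ft4.
move: k4; rewrite min0n !muln0 !high_nodes_eq0 //=; lia.
Qed.

(** Of the 80 units per tree of [c'], 40 pay for the grouping and 40 for the credit of the [hc] new
    nodes. The visit costs at most 40 + 150 * 3 + 10 = 500 more. A high node owns this amount; at a
    low one an absorbed item pays it, since [minn] grows by 1 from [h] to [h.+1]. *)
Lemma bulk_node_cost (h kc kr kg c c' hc cr r' s0 s1 s2 nc nr : nat) :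
  kc + 80 * c' + 150 * s1 + 500 * (s1 * minn h J) <=
    150 * c + 10 + 500 * nc + 150 * s0 + 500 * (s0 * minn h J) ->
  kr + 80 * r' + 150 * s2 + 500 * (s2 * minn h.+1 J) <=
    150 * cr + 10 + 500 * nr + 150 * s1 + 500 * (s1 * minn h.+1 J) ->
  kg <= 40 * c' -> hc * 2 <= c' -> (h < J -> nc = 0) -> c <= 3 -> s1 < s0 ->
  40 + kc + kr + kg + 80 * (hc + r') + 150 * s2 + 500 * (s2 * minn h.+1 J) <=
    150 * cr.+1 + 10 + 500 * ((if J < h.+1 then nc.+1 else 0) + nr) +
    150 * s0 + 500 * (s0 * minn h.+1 J).
Proof.
case: (ltnP J h.+1) => [Jh|hJ].
  rewrite (minn_idPr (_ : J <= h)) // => k3 k7 k9 half _ c3 lt1.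
  move: k3 k7; generalize (s0 * J) (s1 * J) (s2 * J) => a0 a1 a2 k3 k7.
  by clear -k3 k7 k9 half c3 lt1; lia.
rewrite (minn_idPl (ltnW hJ)) !(mulnS _ h) => k3 k7 k9 half /(_ isT) nc0 c3 lt1.
rewrite nc0 in k3.
move: k3 k7; generalize (s0 * h) (s1 * h) (s2 * h) => a0 a1 a2 k3 k7.
  by clear -k3 k7 k9 half c3 lt1; lia.
Qed.

Lemma bulk_node lf c r h its st :
  (forall its st, bulk_pre h c its st -> run bulk st (bulk_spec h c its st)) ->
  (forall its st, bulk_pre h.+1 r its st -> run bulk st (bulk_spec h.+1 r its st)) ->
  bulk_pre h.+1 (Cell lf c r) its st -> ~~ skips st (Cell lf c r) its ->
  run bulk st (bulk_spec h.+1 (Cell lf c r) its st).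
Proof.
move=> IHc IHr [[rt ri hh bt asc] F] sk.
have [/andP[p0 pF] rc rr [f1 f2 f3 f4]] := rep_cell rt.
have [/and3P[c1 c3 bc] br] : [&& 1 < fsize c, fsize c <= 3 & balanced h c] /\ balanced h.+1 r.
  by move: bt; rewrite balanced_cell => /andP.
have hl : head_leaves lf c = leaves c by rewrite head_leavesE // ltnW.
rewrite hl in f1 f2 f3 f4.
have [asc1 asc2] : ascending (leaves c) /\ ascending (leaves r).
  by apply: ascending_cat; rewrite -hl.
have b1 : beval st (BIeq (IVar 3) (ICst 0)) = false by rewrite /= (rep_eq0 rt).
have b2 : beval st (BIeq (IVar 5) (ICst 0)) = false by rewrite /= hh.
have b3 : beval st bulk_skips = false by rewrite (bulk_skipsE rt ri) (negPf sk).
apply: ev_if; rewrite b1; apply: ev_if; rewrite b3; apply: ev_if; rewrite b2 {b1 b2 b3}.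
apply: ev_seq; apply: run_push => // s1 [hp1 i1 r1 /andP[t0 tF] ch1 nx1 _ _].
rewrite /= in i1 nx1 ch1.
do 2![apply: ev_seq; apply: ev_iset]; set s2 := set_ivar _ 5 _.
have i23 : ivar s2 3 = iarr st 1 (ivar st 3).
  by rewrite /s2 /= /upd /= i1 // (heap_le_child hp1).
have i25 : ivar s2 5 = h by rewrite /s2 /= /upd /= i1 // hh.
have i2 y : y != 3 -> y != 5 -> ivar s2 y = ivar s1 y.
  by rewrite /s2 /= /upd => /negPf -> /negPf ->.
have r2 : rvar s2 1 = rvar st 1 by rewrite /s2 /= r1.
have hp12 : heap_le s1 s2 by [].
clearbody s2; have hp02 := heap_le_trans hp1 hp12.
apply: ev_seq; apply: ev_call; apply: (ev_conseq (IHc its s2 _)).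
  split; last exact: heap_le_free hp02 F.
  split; rewrite ?i23 //; first by exact: rep_le rc.
  by rewrite i2 // i1 //; apply: items_rep_le ri.
move=> kc s3 x3 [c' [its1 [rc3 ri3 bc3 ins3 [p3 h3 sp3 ft3 k3]]]].
have hp3 := exec_heap x3 isT; have hp13 := heap_le_trans hp12 hp3.
have hp03 := heap_le_trans hp1 hp13.
rewrite i2 // in sp3.
apply: ev_seq; apply: ev_iset; apply: ev_seq; apply: run_pop => // s4.
rewrite /= /upd /= sp3 (heap_le_child hp13) // (heap_le_next hp13) // ch1 nx1.
move=> i4 i43 i42 r4 a4 b4.
have hp4 : heap_le s3 s4 by apply: heap_le_same; rewrite ?i4.
have hp04 := heap_le_trans hp03 hp4.
apply: ev_seq; apply: run_push; first exact: heap_le_free hp04 F.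
move=> s5 [hp5 i5 r5 /andP[t50 t5F] ch5 nx5 _ _]; rewrite /= in i5 nx5 ch5.
rewrite i4 //= in ch5; rewrite i42 in nx5.
apply: ev_seq; apply: ev_iset; set s6 := set_ivar _ 3 _.
have hp05 := heap_le_trans hp04 hp5.
have i63 : ivar s6 3 = iarr st 2 (ivar st 3).
  by rewrite /s6 /= /upd /= i5 // i43 (heap_le_next hp05).
have i65 : ivar s6 5 = h.+1 by rewrite /s6 /= /upd /= i5 // i4 //= h3.
have i66 : ivar s6 6 = ivar s3 6 by rewrite /s6 /= /upd /= i5 // i4.
have i62 : ivar s6 2 = ivar s5 2 by [].
have r6 : rvar s6 1 = (rvar st 1 + llen (leaves c))%R.
  by rewrite /s6 /= r5 r4 p3 r2.
have hp56 : heap_le s5 s6 by [].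
clearbody s6; have hp06 := heap_le_trans hp05 hp56.
have hp36 := heap_le_trans hp4 (heap_le_trans hp5 hp56).
apply: ev_seq; apply: ev_call; apply: (ev_conseq (IHr its1 s6 _)).
  split; last exact: heap_le_free hp06 F.
  split; rewrite ?i63 ?i66 //; first by exact: rep_le rr.
  exact: items_rep_le ri3.
move=> kr s7 x7 [r' [its2 [rr7 ri7 br7 ins7 [p7 h7 sp7 ft7 k7]]]].
have hp7 := exec_heap x7 isT; have hp57 := heap_le_trans hp56 hp7.
have hp37 := heap_le_trans hp36 hp7.
rewrite i62 in sp7.
apply: ev_seq; apply: run_pop => // s8.
rewrite sp7 (heap_le_child hp57) // (heap_le_next hp57) // ch5 nx5.
move=> i8 i87 i82 r8 a8 b8.
have hp8 : heap_le s7 s8 by apply: heap_le_same; rewrite ?i8.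
have hp38 := heap_le_trans hp37 hp8.
(* The subtree was entered because it cannot be skipped, so it absorbs an item. *)
have lt1 : size its1 < size its.
  apply: (insertion_consumes ins3); last first.
    case: its sk {ri ins3 k3} => // it its; rewrite /skips hl r2.
    by rewrite negb_and negbK -ltNge.
  apply/eqP => c0; move: c1 (balanced_size bc); rewrite c0.
  by case: (fsize c) => // n _; rewrite leqn0 muln_eq0 expn_eq0.
(* Insertion never lowers the number of trees, so there are enough of them to group. *)
have c'1 : 1 < fsize c' := leq_trans c1 ft3.
have hp58 := heap_le_trans hp57 hp8.
apply: ev_call; apply: (ev_conseq (@run_group c' r' h s8 _ _ _ _ _ _)) => //.
- by rewrite i87; apply: rep_le rc3.
- by rewrite i8 //; apply: rep_le rr7.
- exact: heap_le_free hp38 (heap_le_free hp03 F).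
move=> kg s9 x9 [ o9 [ro9 bo9 lo9 so9 [sp9 k9]]].
have hp9 := exec_heap x9 isT.
have [i9 r9 _ _] := group_frame x9.
exists o9, its2; split=> //.
- by rewrite i9 // i8 //; apply: items_rep_le ri7; apply: heap_le_trans hp8 hp9.
- rewrite lo9 leavesE hl; apply: insertion_cat; last by rewrite -r6; exact: ins7.
  by rewrite -r2.
split.
- by rewrite r9 // r8 p7 r6 leavesE llen_cat hl addrA.
- by rewrite i9 // i8.
- by rewrite sp9.
- by rewrite so9 [fsize (Cell _ _ _)]/= -add1n leq_add // half_gt0.
rewrite so9.
have -> : high_nodes J h.+1 (Cell lf c r) =
  (if J < h.+1 then (high_nodes J h c).+1 else 0) + high_nodes J h.+1 r by [].
have half : (fsize c')./2 * 2 <= fsize c' by rewrite muln2 -[leqRHS]odd_double_half leq_addl.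
have hn : h < J -> high_nodes J h c = 0 by move=> /ltnW; exact: high_nodes_eq0.
apply: leq_trans (bulk_node_cost k3 k7 k9 half hn c3 lt1).
by rewrite !leq_add2r; clear; lia.
Qed.

Lemma run_bulk t h its st : bulk_pre h t its st -> run bulk st (bulk_spec h t its st).
Proof.
elim: t h its st => [|lf c IHc r IHr] h its st pre.
  have [[rt ri hh _ _] F] := pre.
  apply: ev_if; rewrite (_ : beval _ _ = true); last by rewrite /= (rep_eq0 rt).
  apply: ev_iset; exists Nil, its; split=> //.
  - exact: items_rep_le ri.
  - exact: InsNil.
  by split=> //=; [rewrite addr0 | lia].
have [sk|sk] := boolP (skips st (Cell lf c r) its).
  by apply: bulk_skip => // *; apply: IHr.
case: h pre => [|h] pre; last first.
  by apply: bulk_node => // *; [apply: IHc | apply: IHr].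
have c0 : c = Nil by case: pre => [[_ _ _]]; rewrite balanced_cell; case: (c).
rewrite {}c0 {IHc} in pre sk *.
(* A leaf is revisited after each insertion in front of it: the forest does not shrink, the list of
   items does. *)
elim: its lf st pre sk => [|[[x dx] w] its IH] lf st pre sk //.
apply: bulk_item => // g s pre'.
have [sk'|sk'] := boolP (skips s (Cell (g, lf.1.2, lf.2) Nil r) its).
  by apply: bulk_skip => // *; apply: IHr.
exact: IH.
Qed.

End BulkCost.

(** The term [50 * fsize t] is unspent credit: an inner node is paid for by the credit of its
    children, at least two, which makes the cost linear in the number of leaves. *)
Lemma run_flatten t h its st :
  rep st (ivar st 3) t -> items_rep st (ivar st 4) its -> balanced h t ->
  ivar st 5 = h -> 0 < ivar st 1 ->
  run flatten st (fun k st' =>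
    [/\ items_rep st' (ivar st' 4) (items_of (rvar st 1) (leaves t) ++ its),
        ivar st' 10 = ivar st 10 + size (items_of (rvar st 1) (leaves t)),
        ivar st' 5 = h, ivar st' 2 = ivar st 2
      & k + 50 * fsize t <= 100 * size (leaves t) + 2]).
Proof.
elim: t h its st => [|lf c IHc r IHr] h its st rt ri bt hh F.
  apply: ev_if; rewrite (_ : beval _ _ = true); last by rewrite /= (rep_eq0 rt).
  by apply: ev_skip; split=> //; rewrite addn0.
have [/andP[p0 pF] rc rr [f1 f2 f3 f4]] := rep_cell rt.
have br : balanced h r by move: bt; rewrite balanced_cell => /andP[].
apply: ev_if; rewrite (_ : beval _ _ = false); last by rewrite /= (rep_eq0 rt).
apply: ev_seq; apply: ev_rset; apply: ev_seq; apply: run_push => //.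
move=> s1 [hp1 i1 r1 /andP[t0 tF] ch1 nx1 ln1 _]; rewrite /= in i1 nx1 ch1.
rewrite /= /upd /= in ln1.
have {}r1 : rvar s1 1 = rvar st 1 by rewrite r1.
have {}hp1 : heap_le st s1 by [].
apply: ev_seq; apply: ev_rset; apply: ev_seq; apply: ev_iset; set s2 := set_ivar _ 3 _.
have r2 : rvar s2 1 = (rvar st 1 + llen (head_leaves lf c))%R.
  by rewrite /s2 /= /upd /= r1 i1 // (heap_le_len hp1) // f2.
have i23 : ivar s2 3 = iarr st 2 (ivar st 3).
  by rewrite /s2 /= /upd /= i1 // (heap_le_next hp1).
have i22 : ivar s2 2 = ivar s1 2 by [].
have i2 y : y \notin [:: 1; 2; 3; 11; 12] -> ivar s2 y = ivar st y.
  rewrite /s2 /= /upd !inE => /norP[y1 /norP[y2 /norP[/negPf -> /norP[y11 y12]]]].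
  by rewrite i1 // !inE !negb_or y1 y2 y11.
have hp12 : heap_le s1 s2 by [].
clearbody s2; have hp02 := heap_le_trans hp1 hp12.
apply: ev_seq; apply: ev_call; apply: (ev_conseq (IHr h its s2 _ _ _ _ _)) => //.
- by rewrite i23; apply: rep_le rr.
- by rewrite i2 //; apply: items_rep_le ri.
- by rewrite i2.
- exact: heap_le_free hp02 F.
move=> k s3 x3 [ri3 n3 h3 sp3 k3].
have hp3 := exec_heap x3 isT; have hp13 := heap_le_trans hp12 hp3.
have hp03 := heap_le_trans hp1 hp13; have F3 := heap_le_free hp03 F.
rewrite i22 in sp3; rewrite i2 // r2 in n3; rewrite r2 in ri3.
apply: ev_seq; apply: ev_rset; apply: ev_seq; apply: run_pop => // s4.
rewrite /= sp3 (heap_le_child hp13) // (heap_le_next hp13) // (heap_le_len hp13) //.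
rewrite ch1 nx1 ln1 => i4 i43 i42 r4 a4 b4.
have hp4 : heap_le s3 s4 by apply: heap_le_same; rewrite ?i4.
have hp04 := heap_le_trans hp03 hp4.
have {}r4 : rvar s4 1 = rvar st 1 by rewrite r4 /upd.
apply: ev_if; rewrite (_ : beval _ _ = (h == 0)); last by rewrite /= i4 // h3.
have rest : items_rep s4 (ivar s4 4)
    (items_of (rvar st 1 + llen (head_leaves lf c)) (leaves r) ++ its).
  by rewrite i4 //; apply: items_rep_le ri3.
have rt4 := rep_le hp04 rt.
have F4 := heap_le_free hp04 F.
case: h bt hh br h3 k3 => [|h] bt hh br h3 k3 /=.
  have c0 : c = Nil by move: bt; rewrite balanced_cell; case: (c).
  rewrite {}c0 {IHc IHr} in rt rc bt rt4 rest f1 f2 f3 f4 n3 r2 ri3 *.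
  case: lf rt rt4 bt rest f1 f2 f3 f4 n3 r2 ri3 => [[g d] b] rt rt4 bt rest f1 f2 f3 f4 n3 r2 ri3.
  rewrite /linf /= ?orbF ?addr0 in f1 f2 f3 n3 rest.
  have flE : iarr s4 3 (ivar st 3) = b by case: (hp04) => _ /(_ _ pF)[[_ _ ->]].
  apply: ev_if; rewrite (_ : beval _ _ = ~~ b); last by rewrite /= i43 flE eqb0.
  clear rt rt4 bt f4 r2 ri3 f1 flE.
  rewrite !leavesE /=; case: b => /=.
    apply: ev_skip; split=> //; rewrite ?addr0 in n3 *.
    - by rewrite i4 // n3.
    - by rewrite i4.
    by move: k3; clear; lia.
  do 3![apply: ev_seq; apply: ev_rset]; do 2![apply: ev_seq; apply: ev_iset].
  apply: ev_seq; apply: run_alloc.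
  rewrite /= /upd /= i43 (heap_le_len hp04) // (heap_le_wt hp04) // f2 f3 r4.
  move=> s5 hp5 i5 r5 [hc5 hn5 hf5] [hl5 hw5 hm5].
  have {}hp5 : heap_le s4 s5 by [].
  apply: ev_seq; apply: ev_iset; apply: ev_iset; split.
  - rewrite /= /upd /= (i5 1) /=; split.
    + by rewrite F4 /= /upd /= i5 /=.
    + exact: hl5.
    + exact: hw5.
    + exact: hm5.
    by rewrite /= hn5; apply: (@items_rep_le _ s5) => //; apply: items_rep_le rest.
  - by rewrite /= /upd /= i5 /= i4 // n3 addnS.
  - by rewrite /= /upd /= i5 /= i4.
  - by rewrite /= /upd /= i5 /= i42.
  by move: k3 => /=; clear; lia.
have [/and3P[c1 c3 bc] _] : [&& 1 < fsize c, fsize c <= 3 & balanced h c] /\ balanced h.+1 r.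
  by move: bt; rewrite balanced_cell => /andP.
have hl : head_leaves lf c = leaves c by rewrite head_leavesE // ltnW.
rewrite hl in rest n3.
do 2![apply: ev_seq; apply: ev_iset]; set s5 := set_ivar _ 5 _.
have r5 : rvar s5 1 = rvar st 1 by [].
have rest5 : items_rep s5 (ivar s5 4)
    (items_of (rvar st 1 + llen (leaves c)) (leaves r) ++ its).
  exact: (@items_rep_le _ s4).
apply: ev_seq; apply: ev_call; apply: (ev_conseq (IHc h _ s5 _ rest5 bc _ _)) => //.
- rewrite /s5 /= /upd /= i43 (heap_le_child hp04) //.
  by apply: (@rep_le _ s4) => //; apply: rep_le rc.
- by rewrite /s5 /= /upd /= i4 // h3.
move=> k6 s6 x6; rewrite r5 => -[ri6 n6 h6 sp6 k6'].
apply: ev_iset; rewrite leavesE hl items_of_cat; split.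
- by rewrite /= /upd /= -catA; apply: (@items_rep_le _ s6).
- by rewrite /= /upd /= n6 size_cat /s5 /= /upd /= i4 // n3; lia.
- by rewrite /= /upd /= h6.
- by rewrite /= /upd /= sp6 /s5 /= /upd /= i42.
rewrite size_cat; move: k3 k6' c1 => /=; clear; lia.
Qed.

(** The last hypothesis, a sentinel or a positive value at the end of the forest, ensures that the
    scan stops at some tree. Inner levels have at most three siblings, hence a constant cost per
    level. *)
Lemma run_find_root t h st : let l := leaves t in
  let pos := rvar st 1 in let S := rvar st 5 in let I := rvar st 6 in
  rep st (ivar st 3) t -> balanced h t -> ivar st 5 = h -> 0 < fsize t ->
  linf l || (0 < (S + lwt l) * (pos + llen l) + (I - (lmom l + pos * lwt l)))%R ->
  run find_root st (fun k st' => exists l1 g d b l2,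
    [/\ l = l1 ++ (g, d, b) :: l2, rvar st' 5 = (S + lwt l1)%R,
        rvar st' 6 = (I - (lmom l1 + pos * lwt l1))%R,
        l1 = [::] \/ (rvar st' 5 * (pos + llen l1) + rvar st' 6 <= 0)%R
      & b || (0 < rvar st' 5 * (pos + llen l1 + g) + rvar st' 6)%R] /\
    k <= 8 * fsize t + 30 * h + 2).
Proof.
elim: t h st => [|lf c IHc r IHr] h st //= rt bt hh _ ns.
have [/andP[p0 pF] rc rr [f1 f2 f3 f4]] := rep_cell rt.
have br : balanced h r by move: bt; rewrite balanced_cell => /andP[].
set hl := head_leaves lf c in f1 f2 f3 f4.
set S := rvar st 5 in ns *; set I := rvar st 6 in ns *; set pos := rvar st 1 in ns *.
rewrite leavesE -/hl in ns *.
pose v := ((S + lwt hl) * (pos + llen hl) + (I - (lmom hl + pos * lwt hl)))%R.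
apply: ev_if; rewrite (_ : beval _ _ = ~~ linf hl && (v <= 0)%R); last first.
  by rewrite /= f1 f2 f3 f4 eqb0.
case: ifP => [/andP[nf v0]|sk].
  have ns' : linf (leaves r) || (0 < (S + lwt hl + lwt (leaves r)) *
      (pos + llen hl + llen (leaves r)) + (I - (lmom hl + pos * lwt hl) -
      (lmom (leaves r) + (pos + llen hl) * lwt (leaves r))))%R.
    move: ns; rewrite /linf has_cat -!/(linf _) (negPf nf) /= llen_cat lwt_cat lmom_cat.
    case: (linf _) => //=; set x := (X in (0 < X)%R -> _) => x0.
    by rewrite (_ : (_ + _)%R = x) // /x; ring.
  (* Were there no tree to the right, the nonpositive value at the end of this one would contradict
     the hypothesis. *)
  have r0 : 0 < fsize r.
    by case: (r) ns' => //=; rewrite /leaves /=; move: v0; rewrite /v; lra.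
  do 3![apply: ev_seq; apply: ev_rset]; apply: ev_seq; apply: ev_iset.
  set s1 := set_ivar _ 3 _.
  have S1 : rvar s1 5 = (S + lwt hl)%R by rewrite /s1 /= /upd /= f3.
  have I1 : rvar s1 6 = (I - (lmom hl + pos * lwt hl))%R.
    by rewrite /s1 /= /upd /= f3 f4.
  have P1 : rvar s1 1 = (pos + llen hl)%R by rewrite /s1 /= /upd /= f2.
  apply: ev_call; apply: (ev_conseq (IHr h s1 _ br _ r0 _)).
  - by apply: (@rep_le _ st) => //; rewrite /s1 /= /upd.
  - by [].
  - by rewrite P1 S1 I1.
  move=> k s2 _; rewrite P1 S1 I1 => -[l1 [g [d [b [l2 [[e S2 I2 c1 c2] hk]]]]]].
  exists (hl ++ l1), g, d, b, l2; split; last by move: hk => /=; clear; lia.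
  split.
  - by rewrite e catA.
  - by rewrite S2 lwt_cat addrA.
  - by rewrite I2 lwt_cat lmom_cat; ring.
  (* If nothing more is skipped, the left end of the piece is the end of the tree just skipped,
     where the test found a nonpositive value. *)
  - right; case: c1 => [l10|]; last by rewrite llen_cat addrA.
    by move: v0; rewrite S2 I2 l10 /= cats0 /v; clear; lra.
  by rewrite llen_cat addrA.
have ns' : linf hl || (0 < v)%R.
  by move: sk; case: (linf hl) => //=; rewrite leNgt => /negbFE.
apply: ev_if; rewrite (_ : beval _ _ = (h == 0)); last by rewrite /= hh.
case: h bt hh br => [|h] bt hh br.
  have c0 : c = Nil by move: bt; rewrite balanced_cell; case: (c).
  apply: ev_skip; move: ns'; rewrite /v /hl c0 /=; case: (lf) => [[g d] b] /= ns'.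
  exists [::], g, d, b, (leaves r); split; last by lia.
  rewrite /= mulr0 !addr0 subr0; split=> //; first by left.
  move: ns'; rewrite /linf /= orbF !addr0 mulr0 addr0; case: b => //=.
  by congr (0 < _)%R; rewrite -/S -/I -/pos; ring.
have [/and3P[c1 c3 bc] _] : [&& 1 < fsize c, fsize c <= 3 & balanced h c] /\ balanced h.+1 r.
  by move: bt; rewrite balanced_cell => /andP.
have hlE : hl = leaves c by rewrite /hl head_leavesE // ltnW.
do 2![apply: ev_seq; apply: ev_iset]; set s1 := set_ivar _ 5 _.
apply: ev_call; apply: (ev_conseq (IHc h s1 _ bc _ _ _)).
- by apply: (@rep_le _ st) => //; rewrite /s1 /= /upd.
- by rewrite /s1 /= /upd /= hh.
- exact: ltnW.
- by rewrite -hlE.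
move=> k s2 _ [l1 [g [d [b [l2 [[e S2 I2 c1' c2] hk]]]]]].
exists l1, g, d, b, (l2 ++ leaves r); split; last by move: hk c3 => /=; clear; lia.
by split=> //; rewrite hlE e -catA.
Qed.

(** [J] is arbitrary and does not occur in the program: each caller picks the value that balances
    the first two terms. *)
Lemma run_insert_items J l its h st :
  tree_rep st (ivar st 3) h l -> items_rep st (ivar st 6) its ->
  ivar st 5 = h -> sentinel l -> ascending l -> 0 < ivar st 1 ->
  run insert_items st (fun k st' => exists h' o,
    [/\ tree_rep st' (ivar st' 4) h' o, ivar st' 5 = h',
        insertion l its 0%R o [::], ivar st' 2 = ivar st 2
      & k <= 1400 * (size its * J.+1) + 1000 * (size l %/ 2 ^ J) + 1000]).
Proof.
move=> [t [t1 bt rt tl]] ri hh sl asc F; rewrite -tl in asc sl *.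
apply: ev_seq; apply: ev_rset; set s1 := set_rvar _ 1 _.
have r1 : rvar s1 1 = 0%R by [].
apply: ev_seq; apply: ev_call; apply: (ev_conseq (@run_bulk J t h its s1 _)).
  split=> //; split=> //; first exact: (@rep_le _ st).
  exact: (@items_rep_le _ st).
move=> k s2 x2; rewrite /bulk_spec r1 => -[t' [its' [rt2 ri2 bt2 ins [p2 h2 sp2 ft2 k2]]]].
have F2 : 0 < ivar s2 1 by apply: heap_le_free (exec_heap x2 isT) F.
have [_ its0] := insertion_sentinel ins sl; rewrite {}its0 {its'} in ins ri2 k2.
have hn := high_nodes_bound J bt t1.
have {k2}kb : k + 80 * fsize t' <= 160 + 500 * (size (leaves t) %/ 2 ^ J) + 650 * (size its * J.+1).
  have mJ : size its * minn h J <= size its * J by rewrite leq_mul2l geq_minr orbT.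
  move: k2 hn mJ; rewrite t1 (mulnS _ J).
  by clear; generalize (size (leaves t) %/ 2 ^ J) (size its * J) (size its * minn h J) => x y z; lia.
set W := While _ _.
(* The rounds form a geometric series, so the loop is linear in the initial number of roots, which
   the credit in [kb] bounds. *)
suff loop n t0 h0 s : fsize t0 <= n -> 0 < fsize t0 -> rep s (ivar s 4) t0 ->
    balanced h0 t0 -> ivar s 5 = h0 -> 0 < ivar s 1 ->
  run W s (fun j s' => exists h' o, [/\ fsize o = 1, balanced h' o, leaves o = leaves t0,
     rep s' (ivar s' 4) o & [/\ ivar s' 5 = h', ivar s' 2 = ivar s 2 & j <= 100 * fsize t0]]).
  apply: (ev_conseq (loop _ t' h s2 (leqnn _) _ rt2 bt2 h2 F2)); first by rewrite t1 in ft2.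
  move=> j s3 _ [h' [ o [f1 b1 l1 ro [h3 sp3 hj]]]].
  exists h', (leaves t'); split=> //; first by exists o.
    by rewrite sp3 sp2.
  move: kb hj; clear; generalize (size (leaves t) %/ 2 ^ J) (size its * J.+1) => x y; lia.
elim: n t0 h0 s => [|n IH] t0 h0 s tn t0p rt0 bt0 h0s Fs.
  by move: tn t0p; case: fsize.
case: t0 tn t0p rt0 bt0 => // lf c r tn _ rt0 bt0.
have [/andP[p0 pF] rc rr _] := rep_cell rt0.
have bW : beval s (BNot (BIeq (IGet 2 (IVar 4)) (ICst 0))) = (0 < fsize r).
  by rewrite /= (rep_eq0 rr) lt0n.
case: (posnP (fsize r)) => [r0|r0].
  apply: ev_while_end; first by rewrite bW r0.
  by exists h0, (Cell lf c r); split=> //; rewrite /= r0.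
apply: ev_while_step; first by rewrite bW.
do 2![apply: ev_seq; apply: ev_iset]; set s3 := set_ivar _ 4 _.
apply: ev_seq; apply: ev_call.
apply: (ev_conseq (@run_group (Cell lf c r) Nil h0 s3 _ _ _ _ _ _)) => //.
  by apply: (@rep_le _ s) => //.
move=> k4 s4 x4 [ o4 [ro4 bo4 lo4 so4 [sp4 k4']]].
have [i4 _ _ _] := group_frame x4.
have F4 : 0 < ivar s4 1 by apply: heap_le_free (exec_heap x4 isT) _.
apply: ev_iset; set s5 := set_ivar _ 5 _.
have half : (fsize (Cell lf c r))./2 * 2 <= fsize (Cell lf c r).
  by rewrite muln2 -[leqRHS]odd_double_half leq_addl.
have half0 : 0 < (fsize (Cell lf c r))./2 by rewrite half_gt0 ltnS.
rewrite addn0 in so4.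
apply: (ev_conseq (IH o4 h0.+1 s5 _ _ _ bo4 _ F4)).
- by rewrite so4; move: half half0 tn r0 => /=; clear; lia.
- by rewrite so4.
- exact: (@rep_le _ s4).
- by rewrite /s5 /= /upd /= i4 // /s3 /= /upd /= h0s.
move=> j s6 _ [h' [ o [f1 b1 l1 ro [h6 sp6 hj]]]].
exists h', o; split=> //.
  by rewrite l1 lo4 cats0.
split=> //; first by rewrite sp6 /s5 /= /upd /= sp4.
move: hj k4' half; rewrite so4.
have : 1 < fsize (Cell lf c r) by [].
by generalize (fsize (Cell lf c r)) => x; clear; lia.
Qed.

(** * Operations on the function of one vertex *)

Definition scratch_ivars : pred nat := fun x => 0 < x < 20.
Definition scratch_iarrs : pred nat := fun x => x \in [:: 1; 2; 3].
Definition scratch_rarrs : pred nat := fun x => x \in [:: 2; 3; 4].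
Definition scratch_procs : pred nat := fun f => 0 < f < 5.

(** Registers and arrays from 20 on belong to the outer loops, number 0 to the input. The write sets
    are allowed to be larger, for commands that write to some of these themselves. *)
Lemma scratch_procs_only (wi wa wb : pred nat) :
  (forall x, scratch_ivars x -> wi x) -> (forall x, scratch_iarrs x -> wa x) ->
  (forall x, scratch_rarrs x -> wb x) -> forall f, scratch_procs f ->
  writes_only wi scratch_ivars wa wb scratch_procs (nth Skip lir_program f).
Proof.
move=> si sa sb f Ff.
have sub : forall c : cmd, writes_only scratch_ivars scratch_ivars scratch_iarrs
    scratch_rarrs scratch_procs c -> writes_only wi scratch_ivars wa wb scratch_procs c.
  elim=> //=.
  - by move=> x _; exact: si.
  - by move=> x _ _; exact: sa.
  - by move=> x _ _; exact: sb.
  - by move=> c1 h1 c2 h2 /andP[/h1 -> /h2].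
  - by move=> _ c1 h1 c2 h2 /andP[/h1 -> /h2].
apply: sub; case: f Ff => [|[|[|[|[|]]]]] //.
Qed.

Lemma run_alloc_frame st Q :
  (forall st', heap_le st st' ->
     (forall x, ivar st' x = if x == 1 then (ivar st 1).+1 else ivar st x) ->
     rvar st' = rvar st ->
     (forall x, x \notin [:: 1; 2; 3] -> iarr st' x = iarr st x) ->
     (forall x, x \notin [:: 2; 3; 4] -> rarr st' x = rarr st x) ->
     [/\ iarr st' 1 (ivar st 1) = ivar st 11,
         iarr st' 2 (ivar st 1) = ivar st 12
       & iarr st' 3 (ivar st 1) = ivar st 9] ->
     [/\ rarr st' 2 (ivar st 1) = rvar st 2,
         rarr st' 3 (ivar st 1) = rvar st 3
       & rarr st' 4 (ivar st 1) = rvar st 4] -> Q 7 st') ->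
  run alloc st Q.
Proof.
move=> h; pose Q' k st' := [/\ k = 7, heap_le st st',
  forall x, ivar st' x = (if x == 1 then (ivar st 1).+1 else ivar st x)
  & rvar st' = rvar st] /\
  [/\ iarr st' 1 (ivar st 1) = ivar st 11, iarr st' 2 (ivar st 1) = ivar st 12
       & iarr st' 3 (ivar st 1) = ivar st 9] /\
  [/\ rarr st' 2 (ivar st 1) = rvar st 2, rarr st' 3 (ivar st 1) = rvar st 3
       & rarr st' 4 (ivar st 1) = rvar st 4].
have : run alloc st Q' by apply: run_alloc.
move/ev_conseq; apply=> k st' ex [[-> hp hi hr] [h1 h2]].
have [|_ _ ha hb] := exec_agree (wi := predT) (wr := predT) (wa := scratch_iarrs)
  (wb := scratch_rarrs) (F := pred0) _ ex isT; first by [].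
by apply: h.
Qed.

Lemma upd_row_off (T : Type) (f : nat -> nat -> T) a v n x y : y != v ->
  upd f a (upd (f a) v n) x y = f x y.
Proof. by move=> yv; rewrite /upd; case: (x =P a) => [->|//]; rewrite (negPf yv). Qed.

Lemma tree_rep_le st st' p h l : heap_le st st' -> tree_rep st p h l -> tree_rep st' p h l.
Proof. by move=> hp [t [t1 bt rt tl]]; exists t; split=> //; apply: rep_le rt. Qed.

Lemma tree_rep_height st p h l : tree_rep st p h l -> h <= trunc_log 2 (size l).
Proof.
move=> [t [t1 bt _ <-]]; apply: trunc_log_max => //.
by have := balanced_size bt; rewrite t1 mul1n.
Qed.

(* The function stored for a vertex: slope and intercept at -oo, and
   breakpoints. *)
Definition stores st (v : nat) (l : seq (leaf R)) (F : R -> R) :=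
  [/\ tree_rep st (iarr st 22 v) (iarr st 23 v) l, sentinel l, ascending l,
      size l = (iarr st 24 v).+1
    & forall x, F x = (rarr st 20 v * x + rarr st 21 v + pl l 0 x)%R].

Lemma stores_le st st' v l F : heap_le st st' ->
  iarr st' 22 v = iarr st 22 v -> iarr st' 23 v = iarr st 23 v ->
  iarr st' 24 v = iarr st 24 v -> rarr st' 20 v = rarr st 20 v ->
  rarr st' 21 v = rarr st 21 v -> stores st v l F -> stores st' v l F.
Proof.
move=> hp e1 e2 e3 e4 e5 [h1 h2 h3 h4 h5]; split=> //; rewrite ?e1 ?e2 ?e3 //.
  exact: tree_rep_le h1.
by move=> x; rewrite e4 e5.
Qed.

(** What [solve] hands over to [expand]: the piece that contains the zero [m], and its slope [S]. *)
Definition root_split (a : R) (l : seq (leaf R)) (F : R -> R) (S m : R) :=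
  exists l1 g d b l2, [/\ l = l1 ++ (g, d, b) :: l2, S = (a + lwt l1)%R, F m = 0%R,
    l1 = [::] \/ (llen l1 <= m)%R & b || (m < llen l1 + g)%R].

Lemma run_solve v l F st : ivar st 22 = v -> stores st v l F -> steep F ->
  run solve st (fun k st' => exists m,
    [/\ root_split (rarr st 20 v) l F (rvar st' 5) m,
        rarr st' 22 = upd (rarr st 22) v m
      & k <= 30 * trunc_log 2 (size l) + 20]).
Proof.
move=> iv [rl sl asc sz FE] st_F.
do 2![apply: ev_seq; apply: ev_iset]; do 3![apply: ev_seq; apply: ev_rset].
set s1 := set_rvar _ 6 _.
have i13 : ivar s1 3 = iarr st 22 v by rewrite /s1 /= /upd /= iv.
have i15 : ivar s1 5 = iarr st 23 v by rewrite /s1 /= /upd /= iv.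
have i122 : ivar s1 22 = v by rewrite /s1 /= /upd.
have S1 : rvar s1 5 = rarr st 20 v by rewrite /s1 /= /upd /= iv.
have I1 : rvar s1 6 = rarr st 21 v by rewrite /s1 /= /upd /= iv.
have P1 : rvar s1 1 = 0%R by [].
have a1 : rarr s1 = rarr st by [].
have hp1 : heap_le st s1 by [].
have hl := tree_rep_height rl.
case: rl hl => t [t1 bt rt tl] hl; clearbody s1.
apply: ev_seq; apply: ev_call.
apply: (ev_conseq (@run_find_root t (iarr st 23 v) s1 _ bt i15 _ _)).
- by rewrite i13; apply: rep_le rt.
- by rewrite t1.
- by rewrite tl sentinel_linf.
rewrite tl S1 I1 P1 => k s2 x2 [l1 [g [d [b [l2 [[e S2 I2 c1 c2] hk]]]]]].
have [i2 _ _ b2] : agree_off scratch_ivars predT pred0 pred0 s1 s2.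
  by apply: (exec_agree (F := pred1 4) _ x2) => // f /eqP ->.
rewrite mul0r addr0 in I2; rewrite !add0r S2 I2 in c1 c2.
rewrite e in FE sl asc.
have [S0 Fm c1' c2'] := root_piece FE st_F sl asc c1 c2.
apply: ev_rput; rewrite /= i2 // i122 b2 // a1 sub0r S2 I2; exists (- (rarr st 21 v - lmom l1) / (rarr st 20 v + lwt l1))%R.
split.
- by exists l1, g, d, b, l2.
- by rewrite /upd /=.
by move: hk hl; rewrite t1; clear; lia.
Qed.

Lemma run_expand v l F m st : let gam := rvar st 0 in
  ivar st 22 = v -> stores st v l F -> (0 <= gam)%R -> 0 < ivar st 1 ->
  root_split (rarr st 20 v) l F (rvar st 5) m -> rarr st 22 v = m ->
  run expand st (fun k st' => exists o,
    [/\ stores st' v o (fun x => F (clamp gam m x)),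
        iarr st' 24 v = (iarr st 24 v).+2,
        forall x y, y != v -> x \notin [:: 1; 2; 3] -> iarr st' x y = iarr st x y
      & k <= 2800 * trunc_log 2 (size l) + 5000]).
Proof.
move=> gam iv [rl sl asc sz FE] gam0 F0 [l1 [g [d [b [l2 [e S_E Fm c1 c2]]]]]] bm.
do 3![apply: ev_seq; apply: ev_iset]; do 3![apply: ev_seq; apply: ev_rset].
apply: ev_seq; apply: run_alloc_frame; rewrite /= /upd /= iv bm S_E.
move=> s1 hp1 i1 r1 a1 b1 [_ hn1 _] [hl1 hw1 hm1].
have {}hp1 : heap_le st s1 by [].
do 2![apply: ev_seq; apply: ev_rset]; apply: ev_seq; apply: ev_iset.
apply: ev_seq; apply: run_alloc_frame; rewrite /= /upd /= r1 /= i1 /= S_E.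
move=> s2 hp2 i2 r2 a2 b2 [_ hn2 _] [hl2 hw2 hm2].
have {}hp2 : heap_le s1 s2 by [].
do 3![apply: ev_seq; apply: ev_iset]; set s3 := set_ivar _ 5 _.
have hp23 : heap_le s2 s3 by [].
have lt2 : ivar st 1 < ivar s1 1 by rewrite i1.
have lt3 : (ivar st 1).+1 < ivar s2 1 by rewrite i2.
have i32 : ivar s3 2 = ivar st 2 by rewrite /s3 /= /upd /= i2 /= i1.
have i36 : ivar s3 6 = (ivar st 1).+1 by rewrite /s3 /= /upd /= i2.
have i322 : ivar s3 22 = v by rewrite /s3 /= /upd /= i2 /= i1.
have i33 : ivar s3 3 = iarr st 22 v.
  by rewrite /s3 /= /upd /= i2 /= i1 /= iv a2 // a1.
have i35 : ivar s3 5 = iarr st 23 v.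
  by rewrite /s3 /= /upd /= i2 /= i1 /= iv a2 // a1.
have i31 : ivar s3 1 = (ivar st 1).+2 by rewrite /s3 /= /upd /= i2.
have a3 x : x \notin [:: 1; 2; 3] -> iarr s3 x = iarr st x.
  by move=> nx; rewrite /s3 /= a2 // a1.
have b3 x : x \notin [:: 2; 3; 4] -> rarr s3 x = rarr st x.
  by move=> nx; rewrite /s3 /= b2 // b1.
clearbody s3.
have hp13 := heap_le_trans hp2 hp23; have hp03 := heap_le_trans hp1 hp13.
set S := (rarr st 20 v + lwt l1)%R in S_E hw1 hw2.
have its3 : items_rep s3 (ivar s3 6) [:: (m, - S, 0)%R; (m, S, gam)].
  rewrite i36; split=> /=.
  - by rewrite i31.
  - by rewrite (heap_le_len hp23).
  - by rewrite (heap_le_wt hp23) // hw2 sub0r.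
  - by case: hp23 => _ /(_ _ lt3)[_ [_ _ ->]].
  rewrite (heap_le_next hp23) // hn2; split.
  - by rewrite F0 i31 ltnS ltnW.
  - by rewrite (heap_le_len hp13).
  - by rewrite (heap_le_wt hp13).
  - by case: hp13 => _ /(_ _ lt2)[_ [_ _ ->]].
  by rewrite (heap_le_next hp13).
have rl3 : tree_rep s3 (ivar s3 3) (iarr st 23 v) l.
  by rewrite i33; apply: tree_rep_le rl.
(* With only two items the threshold can be the logarithm of the whole list, which makes the term
   [size l %/ 2 ^ J] at most 1. *)
pose J := trunc_log 2 (size l).
apply: ev_seq; apply: (ev_conseq (run_insert_items J rl3 its3 i35 sl asc _)).
  by rewrite i31.
move=> k s4 x4 [h' [ o [ro h4 ins sp4 hk]]].
have [i4 _ a4 b4] : agree_off scratch_ivars scratch_ivars scratch_iarrs scratch_rarrs s3 s4.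
  by apply: (exec_agree _ x4); first exact: scratch_procs_only.
do 2![apply: ev_seq; apply: ev_iput]; apply: ev_iput.
rewrite /= i4 // i322; exists o; split.
- split.
  + by rewrite /= /upd /= !eqxx h4; apply: (@tree_rep_le s4).
  + by have [] := insertion_sentinel ins sl.
  + apply: insertion_ascending ins asc _ _ => /=; first by rewrite lexx.
    by rewrite lexx gam0.
  + rewrite /= /upd /= !eqxx; have := insertion_size ins.
    rewrite /= addn0 sz a4 // a3 //; set N := iarr st 24 v.
    by clear; lia.
  move=> x; rewrite /= b4 // b4 // b3 // b3 //; apply/esym.
  rewrite e in FE sl asc ins.
  exact: (expand_pl FE gam0 sl asc Fm c1 c2 ins).
- by rewrite /= /upd /= eqxx a4 // a3.
- by move=> x y nv nx; rewrite /= !upd_row_off // a4 // a3.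
have : size l %/ 2 ^ J <= 1.
  rewrite -ltnS ltn_divLR ?expn_gt0 // mul2n -muln2 mulnC -expnS.
  by rewrite trunc_log_ltn.
move: hk => /=; rewrite /J; clear; lia.
Qed.

Definition potential n := 2 * (n * trunc_log 2 n).

(** With [a], [b], [c] the truncated logarithms of [m], [n], [m + n], one has [a + J <= b <= c], and
    [a < c] because [2 * m <= m + n]. Adding [a + J <= c] and [a.+1 <= c] spends [c] twice, whence
    the factor 2 in [potential]. *)
Lemma potential_merge m n : 0 < m <= n ->
  m * (trunc_log 2 (n %/ m)).+1 + (potential m + potential n) <=
  potential (m + n).
Proof.
move=> /andP[m0 mn]; rewrite /potential.
have n0 : 0 < n by apply: leq_trans mn.
set J := trunc_log 2 (n %/ m); set a := trunc_log 2 m; set b := trunc_log 2 n.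
set c := trunc_log 2 (m + n).
have q0 : 0 < n %/ m by rewrite divn_gt0.
have aJ : a + J <= b.
  apply: trunc_log_max => //; rewrite expnD; apply: leq_trans (leq_trunc_div n m).
  by rewrite mulnC leq_mul // trunc_logP.
have bc : b <= c by apply: leq_trunc_log; exact: leq_addl.
have ac : a < c.
  rewrite /c; apply: trunc_log_max => //; rewrite expnS mul2n -addnn leq_add //.
    exact: trunc_logP.
  by apply: leq_trans mn; exact: trunc_logP.
have h1 : m * J.+1 + 2 * (m * a) <= 2 * (m * c).
  rewrite -mulnCA -(mulnCA m) -mulnDr leq_mul2l; apply/orP; right; lia.
have h2 : n * b <= n * c by rewrite leq_mul2l bc orbT.
by rewrite mulnDl; lia.
Qed.

Lemma leq_potential m n : m <= n -> potential m <= potential n.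
Proof. by move=> mn; rewrite leq_mul // leq_mul // leq_trunc_log. Qed.

(** The 3500 consists of 1400 for the items, twice 1000 for the high nodes and 100 for flattening,
    each times at most m (J + 1), with m the smaller size; [potential_merge] turns this into a
    difference of potentials. *)
Lemma run_merge_trees st i j li lj Fi Fj v p :
  ivar st 24 = i -> ivar st 25 = j -> ivar st 22 = v -> ivar st 23 = p ->
  stores st i li Fi -> stores st j lj Fj -> iarr st 24 i <= iarr st 24 j ->
  0 < ivar st 1 ->
  run merge_trees st
   (fun k st' => exists h o, [/\ tree_rep st' (ivar st' 4) h o, ivar st' 5 = h,
      sentinel o, ascending o & size o = (iarr st 24 i + iarr st 24 j).+1] /\
    [/\ forall x, pl o 0 x = (pl li 0 x + pl lj 0 x)%R,
      ivar st' 10 = iarr st 24 i + iarr st 24 j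
    & k + 3500 * (potential (iarr st 24 i) + potential (iarr st 24 j)) <=
      3500 * potential (iarr st 24 i + iarr st 24 j) + 1500]).
Proof.
move=> i24 i25 i22 i23 [ri sli asci szi FEi] [rj slj ascj szj FEj] le F.
do 4![apply: ev_seq; apply: ev_iset]; apply: ev_seq; apply: ev_rset.
set s1 := set_rvar _ 1 _.
have i13 : ivar s1 3 = iarr st 22 i by rewrite /s1 /= /upd /= i24.
have i15 : ivar s1 5 = iarr st 23 i by rewrite /s1 /= /upd /= i24.
have i110 : ivar s1 10 = iarr st 24 j by rewrite /s1 /= /upd /= i25.
have i1 x : x \notin [:: 3; 4; 5; 10] -> ivar s1 x = ivar st x.
  by rewrite /s1 /= /upd !inE => /norP[/negPf -> /norP[/negPf -> /norP[/negPf -> /negPf ->]]].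
have r1 : rvar s1 1 = 0%R by [].
have a1 : iarr s1 = iarr st by [].
have e1 : items_rep s1 (ivar s1 4) [::] by [].
have hp1 : heap_le st s1 by [].
clearbody s1.
have [t [t1 bt rt tl]] := ri.
apply: ev_seq; apply: ev_call; apply: (ev_conseq (run_flatten _ e1 bt i15 _)).
- by rewrite i13; apply: rep_le rt.
- by rewrite i1.
rewrite r1 tl cats0 t1 => k2 s2 x2 [ri2 n2 h2 sp2 k2E].
have hp2 := exec_heap x2 isT; have hp02 := heap_le_trans hp1 hp2.
have [i2 _ a2 _] : agree_off scratch_ivars scratch_ivars scratch_iarrs scratch_rarrs s1 s2.
  apply: (exec_agree _ x2); first exact: scratch_procs_only.
  by [].
have si := items_of_size 0 sli; rewrite szi in si; case: si => si.
rewrite -si i110 in n2.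
do 3![apply: ev_seq; apply: ev_iset].
set s3 := set_ivar _ 5 _.
have i33 : ivar s3 3 = iarr st 22 j.
  by rewrite /s3 /= /upd /= i2 // i1 // i25 a2 // a1.
have i35 : ivar s3 5 = iarr st 23 j.
  by rewrite /s3 /= /upd /= i2 // i1 // i25 a2 // a1.
have i36 : ivar s3 6 = ivar s2 4 by [].
have i310 : ivar s3 10 = ivar s2 10 by [].
have hp23 : heap_le s2 s3 by [].
clearbody s3; have hp03 := heap_le_trans hp02 hp23.
pose m := iarr st 24 i; pose n := iarr st 24 j.
(* For [m = 0] there is no item, and a large threshold makes the term of the high nodes vanish. *)
pose J := if m == 0 then n.+1 else trunc_log 2 (n %/ m).
apply: (ev_conseq (@run_insert_items J lj (items_of 0 li) (iarr st 23 j) s3 _ _ i35 slj ascj _)).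
- by rewrite i33; apply: tree_rep_le rj.
- by rewrite i36; apply: items_rep_le ri2.
- exact: heap_le_free hp03 F.
move=> k4 s4 x4 [h4 [ o [ro h4E ins sp4 k4E]]].
(* Insertion calls only [bulk] and [group], which spare the count in register 10. *)
have [i4 _ _ _] : agree_off [pred x | scratch_ivars x && (x != 10)] scratch_ivars
    scratch_iarrs scratch_rarrs s3 s4.
  apply: (exec_agree (F := [pred f | 0 < f < 3]) _ x4) => //.
  by case=> [|[|[|]]].
exists h4, o; split; split=> //.
- by have [] := insertion_sentinel ins slj.
- apply: insertion_ascending ins ascj (items_of_sorted 0 asci sli) _.
  by apply/allP => it /(allP (items_of_stretch li 0)) /eqP ->.
- by have := insertion_size ins; rewrite /= addn0 szj -si -/m -/n; clear; lia.
- move=> x; have := insertion_pl x ins (items_of_stretch li 0).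
  by rewrite /= addr0 items_of_pl // addrC.
- by rewrite i4 // i310 n2 addnC.
move: k4E k2E; rewrite -si szj szi -/m -/n.
have hm : m <= n := le.
rewrite /J; case: (posnP m) => [->|m0].
  rewrite mul0n muln0 divn_small; last by apply: leq_trans (ltn_expl _ _); rewrite ?ltnS.
  have -> : potential 0 = 0 by [].
  by rewrite !add0n; clear; generalize (potential n); lia.
have nJ : n.+1 %/ 2 ^ trunc_log 2 (n %/ m) <= 2 * m.
  have lt : n < 2 * m * 2 ^ trunc_log 2 (n %/ m).
    rewrite mulnAC -expnS mulnC; apply: leq_trans (ltn_ceil n m0) _.
    by rewrite mulnC leq_mul2l trunc_log_ltn ?orbT.
  by rewrite -(mulnK (2 * m) (expn_gt0 2 (trunc_log 2 (n %/ m)))) leq_div2r.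
have := @potential_merge m n; rewrite m0 hm => /(_ isT).
move: nJ; generalize (n.+1 %/ 2 ^ trunc_log 2 (n %/ m)) => u.
rewrite (mulnS m); generalize (m * trunc_log 2 (n %/ m)) (potential m) (potential n) (potential (m + n)).
by clear; lia.
Qed.

Lemma run_union st (v p : nat) lv lp Fv Fp : v != p ->
  ivar st 22 = v -> ivar st 23 = p -> stores st v lv Fv -> stores st p lp Fp ->
  0 < ivar st 1 ->
  run union st (fun k st' => exists o,
    [/\ stores st' p o (fun x => Fp x + Fv x)%R,
        iarr st' 24 p = iarr st 24 v + iarr st 24 p,
        forall x y, y != p -> x \notin [:: 1; 2; 3] -> iarr st' x y = iarr st x y,
        forall x y, y != p -> x \notin [:: 2; 3; 4] -> rarr st' x y = rarr st x y
      & k + 3500 * (potential (iarr st 24 v) + potential (iarr st 24 p)) <=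
        3500 * potential (iarr st 24 v + iarr st 24 p) + 1600]).
Proof.
move=> vp i22 i23 stv stp F.
pose T i j := set_ivar (set_ivar st 24 i) 25 j.
(* Forgets which of the two vertices has the smaller list, so that the merge is treated once. *)
pose U := fun (k : nat) (st' : state R) => exists i j li lj Fi Fj, [/\ k <= 4, st' = T i j,
  stores st i li Fi /\ stores st j lj Fj, iarr st 24 i <= iarr st 24 j
  & [/\ iarr st 24 i + iarr st 24 j = iarr st 24 v + iarr st 24 p,
    potential (iarr st 24 i) + potential (iarr st 24 j) =
    potential (iarr st 24 v) + potential (iarr st 24 p)
    & forall x, (pl li 0 x + pl lj 0 x = pl lp 0 x + pl lv 0 x)%R]].
apply: ev_seq; apply: (@ev_conseq _ _ _ _ U).
  apply: ev_if; rewrite [beval _ _]/= i22 i23; case: leqP => le.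
    apply: ev_seq; apply: ev_iset; apply: ev_iset; exists v, p, lv, lp, Fv, Fp.
    rewrite /= /T /upd /= i22 i23; split=> //; split=> // x; exact: addrC.
  apply: ev_seq; apply: ev_iset; apply: ev_iset; exists p, v, lp, lv, Fp, Fv.
  by rewrite /= /T /upd /= i22 i23 (ltnW le); split=> //; split=> //; exact: addnC.
move=> k1 s1 _ [i [j [li [lj [Fi [Fj [hk1 s1E [sti stj] le [szE potE plE]]]]]]]].
have hp1 : heap_le st s1 by rewrite s1E.
have a1 : iarr s1 = iarr st by rewrite s1E.
have b1 : rarr s1 = rarr st by rewrite s1E.
have i1 x : x \notin [:: 24; 25] -> ivar s1 x = ivar st x.
  by rewrite s1E /= /upd !inE => /norP[/negPf -> /negPf ->].
have i124 : ivar s1 24 = i by rewrite s1E.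
have i125 : ivar s1 25 = j by rewrite s1E.
clear s1E.
have sti1 : stores s1 i li Fi by apply: stores_le sti; rewrite ?a1 ?b1.
have stj1 : stores s1 j lj Fj by apply: stores_le stj; rewrite ?a1 ?b1.
have leq1 : iarr s1 24 i <= iarr s1 24 j by rewrite a1.
have i122 : ivar s1 22 = v by rewrite i1.
have i123 : ivar s1 23 = p by rewrite i1.
have F1 : 0 < ivar s1 1 by rewrite i1.
have mg := run_merge_trees i124 i125 i122 i123 sti1 stj1 leq1 F1.
rewrite a1 in mg.
apply: ev_seq; apply: (ev_conseq mg) => k2 s2 x2 [h [ o [[ro h2 so asco szo] [plo n2 k2E]]]].
have hp2 := exec_heap x2 isT.
have [i2 _ a2 b2] : agree_off scratch_ivars scratch_ivars scratch_iarrs scratch_rarrs s1 s2.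
  by apply: (exec_agree _ x2); first exact: scratch_procs_only.
have i223 : ivar s2 23 = p by rewrite i2 // i1.
have i222 : ivar s2 22 = v by rewrite i2 // i1.
do 3![apply: ev_seq; apply: ev_iput]; apply: ev_seq; apply: ev_rput; apply: ev_rput.
have [_ _ _ _ FEv] := stv; have [_ _ _ _ FEp] := stp.
rewrite /= i223 i222; exists o; split.
- split=> //.
  + by rewrite /= /upd /= !eqxx h2; apply: (@tree_rep_le s2).
  + by rewrite /= /upd /= eqxx szo n2.
  move=> x; rewrite /= /upd /= !eqxx !b2 // b1 FEp FEv plo plE.
  by ring.
- by rewrite /= /upd /= eqxx n2 szE.
- by move=> x y yp nx; rewrite /= !upd_row_off // a2 // a1.
- by move=> x y yp nx; rewrite /= !upd_row_off // b2 // b1.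
move: k2E hk1; rewrite szE potE.
generalize (3500 * potential (iarr st 24 v + iarr st 24 p)).
generalize (3500 * (potential (iarr st 24 v) + potential (iarr st 24 p))).
by clear; lia.
Qed.

(** * Processing one vertex *)

Definition static_eq st st' :=
  [/\ ivar st' 0 = ivar st 0, rvar st' 0 = rvar st 0, iarr st' 0 = iarr st 0
    & rarr st' 0 = rarr st 0].

(** The factor 2830 is 30 for the descent to the zero plus 2800 for inserting the two breakpoints;
    merging is covered by the potential. *)
Lemma run_process st vi pi lv lp Fv Fp :
  iarr st 21 (ivar st 20) = vi -> iarr st 0 vi = pi -> vi != pi ->
  stores st vi lv Fv -> stores st pi lp Fp -> steep Fv ->
  (0 <= rvar st 0)%R -> 0 < ivar st 1 ->
  run process st (fun k st' => exists m o,
    [/\ Fv m = 0%R, stores st' pi o (fun x => Fp x + Fv (clamp (rvar st 0) m x))%R,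
        iarr st' 24 pi = (iarr st 24 vi).+2 + iarr st 24 pi,
        rarr st' 22 = upd (rarr st 22) vi m
      & iarr st' 20 = upd (iarr st 20) pi (iarr st 20 pi).-1] /\
    [/\ forall y l F, y != vi -> y != pi -> stores st y l F -> stores st' y l F,
        forall y, y != vi -> y != pi -> iarr st' 24 y = iarr st 24 y,
        (if (iarr st 20 pi).-1 == 0 then
          iarr st' 21 = upd (iarr st 21) (ivar st 21) pi /\ ivar st' 21 = (ivar st 21).+1
         else iarr st' 21 = iarr st 21 /\ ivar st' 21 = ivar st 21),
        ivar st' 20 = (ivar st 20).+1 /\ ivar st' 27 = ivar st 27
      & [/\ static_eq st st', 0 < ivar st' 1
      & k + 3500 * (potential (iarr st 24 vi).+2 + potential (iarr st 24 pi)) <=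
        3500 * potential ((iarr st 24 vi).+2 + iarr st 24 pi) +
        2830 * trunc_log 2 (size lv) + 7 * 1000]]).
Proof.
move=> q par vp sv sp stF g0 F0.
do 3![apply: ev_seq; apply: ev_iset]; set s1 := set_ivar _ 23 _.
have i122 : ivar s1 22 = vi by rewrite /s1 /= /upd /= q.
have i123 : ivar s1 23 = pi by rewrite /s1 /= /upd /= q par.
have i120 : ivar s1 20 = (ivar st 20).+1 by rewrite /s1 /= /upd /=.
have i1 x : x \notin [:: 20; 22; 23] -> ivar s1 x = ivar st x.
  by rewrite /s1 /= /upd !inE => /norP[/negPf -> /norP[/negPf -> /negPf ->]].
have [r1 a1 b1] : [/\ rvar s1 = rvar st, iarr s1 = iarr st & rarr s1 = rarr st] by [].
have hp1 : heap_le st s1 by [].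
clearbody s1.
have sv1 : stores s1 vi lv Fv by apply: stores_le sv; rewrite ?a1 ?b1.
apply: ev_seq; apply: (ev_conseq (run_solve i122 sv1 stF)) => k2 s2 x2 [m [sp2 m2 k2E]].
have hp2 := exec_heap x2 isT; have hp02 := heap_le_trans hp1 hp2.
have [i2 r2 a2 b2] : agree_off scratch_ivars scratch_ivars scratch_iarrs
    [pred x | scratch_rarrs x || (x == 22)] s1 s2.
  apply: (exec_agree (F := scratch_procs) _ x2); last by [].
  by apply: scratch_procs_only => // x /= ->.
have sv2 : stores s2 vi lv Fv by apply: stores_le sv1; rewrite ?a2 ?b2.
rewrite b1 in sp2 m2.
have i222 : ivar s2 22 = vi by rewrite i2.
have g2 : (0 <= rvar s2 0)%R by rewrite r2 // r1.
have F2 : 0 < ivar s2 1 := heap_le_free hp02 F0.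
have b222 : rarr s2 22 vi = m by rewrite m2 /upd eqxx.
have Fm : Fv m = 0%R by case: sp2 => l1 [g [d [b [l2 []]]]].
have sp2' : root_split (rarr s2 20 vi) lv Fv (rvar s2 5) m by rewrite b2 // b1.
apply: ev_seq; apply: (ev_conseq (run_expand i222 sv2 g2 F2 sp2' b222)).
move=> k3 s3 x3 [ o3 [so3 sz3 fr3 k3E]].
have hp3 := exec_heap x3 isT; have hp03 := heap_le_trans hp02 hp3.
have [i3 r3 a3 b3] : agree_off scratch_ivars scratch_ivars
    [pred x | scratch_iarrs x || (x \in [:: 22; 23; 24])] scratch_rarrs s2 s3.
  apply: (exec_agree (F := scratch_procs) _ x3); last by [].
  by apply: scratch_procs_only => // x /= ->.
have spi3 : stores s3 pi lp Fp.
  have pv : pi != vi by rewrite eq_sym.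
  by apply: stores_le sp; rewrite ?fr3 ?b3 ?a2 ?b2 ?a1 ?b1.
rewrite r2 // r1 in so3.
have i322 : ivar s3 22 = vi by rewrite i3.
have i323 : ivar s3 23 = pi by rewrite i3 // i2.
apply: ev_seq; apply: (ev_conseq (run_union vp i322 i323 so3 spi3 (heap_le_free hp03 F0))).
move=> k4 s4 x4 [ o4 [so4 sz4 fra4 frb4 k4E]].
have hp4 := exec_heap x4 isT; have hp04 := heap_le_trans hp03 hp4.
have [i4 r4 a4 b4] : agree_off [pred x | scratch_ivars x || (x \in [:: 24; 25])] scratch_ivars
    [pred x | scratch_iarrs x || (x \in [:: 22; 23; 24])]
    [pred x | scratch_rarrs x || (x \in [:: 20; 21])] s3 s4.
  apply: (exec_agree (F := scratch_procs) _ x4); last by [].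
  by apply: scratch_procs_only => // x /= ->.
have i423 : ivar s4 23 = pi by rewrite i4.
have i04 x : ~~ scratch_ivars x -> x \notin [:: 20; 22; 23; 24; 25] -> ivar s4 x = ivar st x.
  move=> nx; rewrite !inE => /norP[x20 /norP[x22 /norP[x23 /norP[x24 x25]]]].
  rewrite i4 ?inE; last by rewrite negb_or nx negb_or x24.
  by rewrite i3 // i2 // i1 // !inE !negb_or x20 x22.
have sz4' : iarr s4 24 pi = (iarr st 24 vi).+2 + iarr st 24 pi.
  by rewrite sz4 sz3 a2 // a1 fr3 // 1?eq_sym // a2 // a1.
have a420 : iarr s4 20 = iarr st 20 by rewrite a4 // a3 // a2 // a1.
have a421 : iarr s4 21 = iarr st 21 by rewrite a4 // a3 // a2 // a1.
have i421 : ivar s4 21 = ivar st 21 by rewrite i04.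
have i420 : ivar s4 20 = (ivar st 20).+1 by rewrite i4 // i3 // i2.
have {}k4E : k4 + 3500 * (potential (iarr st 24 vi).+2 + potential (iarr st 24 pi)) <=
        3500 * potential ((iarr st 24 vi).+2 + iarr st 24 pi) + 1600.
  by move: k4E; rewrite sz3 fr3 // 1?eq_sym // a2 // a1.
have fin (s5 : state R) k : iarr s5 20 = upd (iarr st 20) pi (iarr st 20 pi).-1 ->
    (forall x, x \notin [:: 20; 21] -> iarr s5 x = iarr s4 x) -> rarr s5 = rarr s4 ->
    (forall x, x != 21 -> ivar s5 x = ivar s4 x) -> rvar s5 = rvar s4 ->
    (if (iarr st 20 pi).-1 == 0 then
          iarr s5 21 = upd (iarr st 21) (ivar st 21) pi /\ ivar s5 21 = (ivar st 21).+1
         else iarr s5 21 = iarr st 21 /\ ivar s5 21 = ivar st 21) ->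
    k <= k2 + k3 + k4 + 30 -> 
    exists m o,
    [/\ Fv m = 0%R, stores s5 pi o (fun x => Fp x + Fv (clamp (rvar st 0) m x))%R,
        iarr s5 24 pi = (iarr st 24 vi).+2 + iarr st 24 pi,
        rarr s5 22 = upd (rarr st 22) vi m
      & iarr s5 20 = upd (iarr st 20) pi (iarr st 20 pi).-1] /\
    [/\ forall y l F, y != vi -> y != pi -> stores st y l F -> stores s5 y l F,
        forall y, y != vi -> y != pi -> iarr s5 24 y = iarr st 24 y,
        (if (iarr st 20 pi).-1 == 0 then
          iarr s5 21 = upd (iarr st 21) (ivar st 21) pi /\ ivar s5 21 = (ivar st 21).+1
         else iarr s5 21 = iarr st 21 /\ ivar s5 21 = ivar st 21),
        ivar s5 20 = (ivar st 20).+1 /\ ivar s5 27 = ivar st 27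
      & [/\ static_eq st s5, 0 < ivar s5 1
      & k + 3500 * (potential (iarr st 24 vi).+2 + potential (iarr st 24 pi)) <=
        3500 * potential ((iarr st 24 vi).+2 + iarr st 24 pi) +
        2830 * trunc_log 2 (size lv) + 7 * 1000]].
  move=> e20 ea eb ei er e21 kE; exists m, o4.
  have hp5 : heap_le s4 s5 by split=> [|x xF]; rewrite ?ei // !ea // eb.
  split; split=> //.
  - by apply: stores_le so4; rewrite ?ea ?eb.
  - by rewrite ea.
  - by rewrite eb b4 // b3.
  - move=> y l F yv yp sy; apply: stores_le sy; first exact: heap_le_trans hp04 hp5.
    + by rewrite ea // fra4 // fr3 // a2 // a1.
    + by rewrite ea // fra4 // fr3 // a2 // a1.
    + by rewrite ea // fra4 // fr3 // a2 // a1.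
    + by rewrite eb frb4 // b3 // b2 // b1.
    + by rewrite eb frb4 // b3 // b2 // b1.
  - by move=> y yv yp; rewrite ea // fra4 // fr3 // a2 // a1.
  - by rewrite !ei // i420 i04.
  split; last first.
    move: kE k2E k3E k4E.
    generalize (3500 * (potential (iarr st 24 vi).+2 + potential (iarr st 24 pi))).
    generalize (3500 * potential ((iarr st 24 vi).+2 + iarr st 24 pi)).
    by clear; lia.
  - by rewrite ei //; exact: heap_le_free hp04 F0.
  split; rewrite ?ei ?ea ?eb ?er //.
  - by rewrite i04.
  - by rewrite r4 // r3 // r2 // r1.
  - by rewrite a4 // a3 // a2 // a1.
  - by rewrite b4 // b3 // b2 // b1.
suff tail : run (Seq (IPut 20 (IVar 23) (IPred (IGet 20 (IVar 23))))
      (If (BIeq (IGet 20 (IVar 23)) (ICst 0)) (enqueue (IVar 23)) Skip)) s4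
  (fun k s5 => [/\ iarr s5 20 = upd (iarr st 20) pi (iarr st 20 pi).-1,
    forall x, x \notin [:: 20; 21] -> iarr s5 x = iarr s4 x, rarr s5 = rarr s4,
    forall x, x != 21 -> ivar s5 x = ivar s4 x & rvar s5 = rvar s4] /\
    (if (iarr st 20 pi).-1 == 0 then
          iarr s5 21 = upd (iarr st 21) (ivar st 21) pi /\ ivar s5 21 = (ivar st 21).+1
         else iarr s5 21 = iarr st 21 /\ ivar s5 21 = ivar st 21) /\ k <= 5).
  apply: (ev_conseq tail) => k s5 _ [[e20 ea eb ei er] [e21 k5]].
  by apply: fin => //; move: k5; clear; lia.
apply: ev_seq; apply: ev_iput; apply: ev_if.
rewrite (_ : beval _ _ = ((iarr st 20 pi).-1 == 0)); last first.
  by rewrite /= /upd /= i423 eqxx a420.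
have [c0|c0] := boolP ((iarr st 20 pi).-1 == 0).
  apply: ev_seq; apply: ev_iput; apply: ev_iset; split; last first.
    by rewrite /= /upd /= i421 a421 i423.
  split=> //.
  - by rewrite /= /upd /= i423 a420.
  - by move=> x; rewrite !inE => /norP[x20 x21]; rewrite /= /upd (negPf x20) (negPf x21).
  - by move=> x x21; rewrite /= /upd (negPf x21).
apply: ev_skip; split; last by [].
split=> //; first by rewrite /= /upd /= i423 a420.
by move=> x; rewrite !inE => /norP[x20 x21]; rewrite /= /upd (negPf x20).
Qed.

End Procedures.

(** * The main procedure *)

Section Main.
Variables (R : realType) (V : finType) (r : V) (pr : V -> V).
Variables (num : V -> 'I_#|V|) (t : V -> R) (gam : R).
Hypotheses (pr_r : pr r = r) (num_inj : injective num) (gam0 : (0 <= gam)%R).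
Implicit Types (st : state R) (f : V -> R -> R) (s : seq V) (u v c : V).
Local Open Scope nat_scope.
Local Notation run := (ev lir_program).

Definition holds_tree st :=
  [/\ ivar st 0 = #|V|, rvar st 0 = gam,
      forall u, iarr st 0 (num u) = num (pr u)
    & forall u, rarr st 0 (num u) = t u].

Lemma holds_tree_eq st st' : static_eq st st' -> holds_tree st -> holds_tree st'.
Proof. by move=> [e1 e2 e3 e4] [h1 h2 h3 h4]; split; rewrite ?e1 ?e2 ?e3 ?e4. Qed.

(* The function f_u of the subtree that keeps, below u, only the branches of the
   children in D. *)
Definition partial_deriv f (m : V -> R) (D : pred V) u (x : R) : R :=
  (x - t u + \sum_(c | D c && (pr c == u)) f c (clamp gam (m c) x))%R.

Definition zeros st u : R := rarr st 22 (num u).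
Definition count_of st u : nat := iarr st 24 (num u).

(* The queue s only grows, and its first [ivar st 20] vertices are processed.
   Being its own parent, r counts as one of its own children, so that it is never
   queued. *)
Definition queue_inv st s := let D := take (ivar st 20) s in
  [/\ uniq s, r \notin s, ivar st 20 <= size s & ivar st 21 = size s] /\
  [/\ forall j, j < size s -> iarr st 21 j = num (nth r s j),
      forall u, iarr st 20 (num u) = #|[pred c | (c \notin D) && (pr c == u)]|,
      forall u, (u \in s) = (iarr st 20 (num u) == 0)
    & forall j c, j < size s -> c != r -> pr c = nth r s j -> c \in take j s].

(** Processed vertices have a final [f] and zero, which satisfy the full recurrence; an unprocessed
    one stores the sum over its processed children only. *)
Definition deriv_inv st s f (L : V -> seq (leaf R)) := let D := take (ivar st 20) s in
  [/\ holds_tree st, 0 < ivar st 1,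
      forall u, u \notin D -> stores st (num u) (L u)
        (partial_deriv f (zeros st) (mem D) u)
    & forall u, u \in D -> [/\ steep (f u), f u (zeros st u) = 0%R
      & forall x, f u x = partial_deriv f (zeros st) [pred c | c != r] u x]].

Definition step_cost := 2830 * trunc_log 2 (2 * #|V|) + 7 * 1000 + 1.

(** A processed vertex adds two breakpoints and hands all of its own to its parent; the exact count
    bounds the size of every list still in use. *)
Definition cost_inv k0 st s k := let D := take (ivar st 20) s in
  \sum_(u | u \notin D) count_of st u = 2 * ivar st 20 /\
  k <= k0 + step_cost * ivar st 20 +
       3500 * \sum_(u | u \notin D) potential (count_of st u).

Definition loop_inv k0 k st :=
  exists s f L, [/\ queue_inv st s, deriv_inv st s f L, cost_inv k0 st s k
    & ivar st 27 = num r].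

Lemma partial_deriv_steep f m (D : pred V) u :
  (forall c, D c -> steep (f c)) -> steep (partial_deriv f m D u).
Proof.
move=> stf; have stP c : [pred c | D c && (pr c == u)] c -> steep (f c).
  by move=> /andP[/stf].
exact: (@steep_sum _ _ gam _ m _ (t u) stP).
Qed.

Lemma num_eq u v : (num u == num v :> nat) = (u == v).
Proof. by apply/eqP/eqP => [/ord_inj/num_inj|->]. Qed.

Lemma run_process_inv k0 k st : loop_inv k0 k st -> ivar st 20 < ivar st 21 ->
  run process st (fun j st' => loop_inv k0 (k + j).+1 st' /\
    #|V| - ivar st' 20 < #|V| - ivar st 20).
Proof.
move=> [s [f [L [[[us rs is_ ws] [qE degE sE topo]] [ht F sto der] [cntE kE] i27]]]] lt.
set i := ivar st 20 in is_ degE sto der cntE kE lt *.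
rewrite ws in lt.
pose v := nth r s i; pose p := pr v.
pose D := take i s.
have vs : v \in s by exact: mem_nth.
have vr : v != r by apply: contraNneq rs => <-.
have D' : take i.+1 s = rcons D v by rewrite (take_nth r).
have vD : v \notin D.
  by move: us; rewrite -(cat_take_drop i.+1 s) D' cat_uniq rcons_uniq => /andP[/andP[]].
(* The processed set is closed under taking children, and contains those of [v]; hence the parent
   [p] is neither [v] nor processed. *)
have topo_D c u : c != r -> pr c = u -> u \in D -> c \in D.
  move=> cr pc /(nthP r)[j]; rewrite size_takel // => ji; rewrite nth_take // => ju.
  have cj : c \in take j s by apply: topo => //; [exact: ltn_trans lt | rewrite ju].
  by move: cj; rewrite -(take_takel s (ltnW ji)) => /mem_take.
have topo_v c : c != r -> pr c = v -> c \in D by move=> cr pc; apply: (topo i).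
have pv : p != v by apply: contraNneq vD => e; apply: topo_v.
have pD : p \notin D by apply: contraNN vD; exact: (topo_D v p).
have [h0 hg hpar ht'] := ht.
have par : iarr st 0 (num v) = num p by rewrite hpar.
have qi : iarr st 21 (ivar st 20) = num v by rewrite qE.
have nvp : num v != num p :> nat by rewrite num_eq eq_sym.
have stFv : steep (partial_deriv f (zeros st) (mem D) v).
  by apply: partial_deriv_steep => c cD; have [] := der c cD.
have g0 : (0 <= rvar st 0)%R by rewrite hg.
apply: (ev_conseq (run_process qi par nvp (sto v vD) (sto p pD) stFv g0 F)).
move=> j st' _ [mv [lo [[Fmv sto' cnt' z' deg'] [frS frC q' [i' i27'] [seq' F' kj]]]]].
have degp : 0 < iarr st 20 (num p).
  by rewrite degE; apply/card_gt0P; exists v; rewrite inE vD eqxx.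
pose Fv := partial_deriv f (zeros st) (mem D) v.
pose f' := fun u => if u == v then Fv else f u.
pose L' := fun u => if u == p then lo else L u.
pose s' := if (iarr st 20 (num p)).-1 == 0 then rcons s p else s.
have zE u : zeros st' u = if u == v then mv else zeros st u.
  by rewrite /zeros z' /upd num_eq.
have ps : p \notin s by rewrite sE -lt0n.
have takeE j' : j' <= size s -> take j' s' = take j' s.
  by move=> le; rewrite /s'; case: ifP => // _; rewrite -cats1 takel_cat.
have pD' : p \notin rcons D v by rewrite mem_rcons inE negb_or pv.
have degE' u : iarr st' 20 (num u) = #|[pred c | (c \notin rcons D v) && (pr c == u)]|.
  rewrite deg' /upd num_eq; have [->|up] := eqVneq u p.
    rewrite degE (cardD1 v) inE vD eqxx /=; apply: eq_card => c.
    by rewrite !inE mem_rcons inE negb_or andbA.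
  rewrite degE; apply: eq_card => c; rewrite !inE mem_rcons inE negb_or.
  by case: (c =P v) => [->|//]; rewrite eq_sym (negPf up) !andbF.
have size_s' : size s <= size s'.
  by rewrite /s'; case: ifP; rewrite ?size_rcons.
have rest_split (G : V -> nat) : \sum_(u | u \notin D) G u =
    G v + (G p + \sum_(u | (u \notin rcons D v) && (u != p)) G u).
  rewrite (bigD1 v) //= (bigD1 p) /=; last by rewrite pD.
  congr (_ + (_ + _)); apply: eq_bigl => u.
  by rewrite mem_rcons inE negb_or [(u != v) && _]andbC.
have rest_split' (G : V -> nat) : \sum_(u | u \notin rcons D v) G u =
    G p + \sum_(u | (u \notin rcons D v) && (u != p)) G u.
  by rewrite (bigD1 p).
have cntr u : (u \notin rcons D v) && (u != p) -> count_of st' u = count_of st u.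
  rewrite mem_rcons inE negb_or => /andP[/andP[uv _] up].
  by rewrite /count_of frC // num_eq.
have cntp : count_of st' p = (count_of st v).+2 + count_of st p by [].
have sizeN : size s <= #|V| by rewrite -(card_uniqP us) max_card.
split; last by rewrite i'; move: lt sizeN; rewrite -/i; clear; lia.
have take' : take (ivar st' 20) s' = rcons D v by rewrite i' takeE.
exists s', f', L'; split; last by rewrite i27'.
- rewrite /queue_inv take' i'; split; [split|split].
  + by rewrite /s'; case: ifP => // _; rewrite rcons_uniq ps.
  + rewrite /s'; case: ifP => // d0; rewrite mem_rcons inE negb_or rs andbT.
    (* If [p] were the root, being its own unprocessed child would keep its degree positive. *)
    apply/eqP => rp; have : iarr st' 20 (num p) = 0 by rewrite deg' /upd eqxx; apply/eqP.
    have rD : r \notin rcons D v.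
      by rewrite mem_rcons inE negb_or eq_sym vr; apply: contraNN rs => /mem_take.
    by rewrite degE' => /card0_eq/(_ r); rewrite inE rD pr_r rp eqxx.
  + exact: leq_trans size_s'.
  + by move: q'; rewrite /s'; case: ifP => _ [_ ->]; rewrite ?size_rcons ws.
  + move=> j'; move: q'; rewrite /s'; case: ifP => _ [-> _]; last exact: qE.
    rewrite size_rcons ltnS nth_rcons /upd ws leq_eqVlt.
    case: eqP => [->|_] /=; first by rewrite ltnn.
    by move=> lj; rewrite lj qE.
  + exact: degE'.
  + move=> u; rewrite deg' /upd num_eq /s'; have [->|up] := eqVneq u p.
      by case: ifP => _; rewrite ?mem_rcons ?inE ?eqxx // (negPf ps).
    by case: ifP => _; rewrite ?mem_rcons ?inE ?(negPf up) sE.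
  (* The only new case is the vertex [p] just queued: its degree 0 says that all its children are
     processed. *)
  move=> j' c lj cr pc; have [ls|ge] := ltnP j' (size s).
    rewrite takeE ?(ltnW ls) //; apply: topo => //.
    by rewrite pc /s'; case: ifP => // _; rewrite nth_rcons ls.
  move: lj pc; rewrite /s'; case: ifP => [d0|_ lj]; last first.
    by move: (leq_trans lj ge); rewrite ltnn.
  rewrite size_rcons ltnS => le; have {le ge}-> : j' = size s by apply/eqP; rewrite eqn_leq le.
  rewrite nth_rcons ltnn eqxx -cats1 take_size_cat // => pc.
  have : iarr st' 20 (num p) = 0 by rewrite deg' /upd eqxx; apply/eqP.
  rewrite degE' => /card0_eq/(_ c); rewrite inE pc eqxx andbT => /negbFE.
  by rewrite -D' => /mem_take.
(* Only the sum at [p] gains a term, that of [v]. *)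
- have sumE u x : (\sum_(c | mem (rcons D v) c && (pr c == u))
      f' c (clamp gam (zeros st' c) x) =
    (if u == p then Fv (clamp gam mv x) else 0) +
    \sum_(c | mem D c && (pr c == u)) f c (clamp gam (zeros st c) x))%R.
    have other c : c != v -> f' c (clamp gam (zeros st' c) x) = f c (clamp gam (zeros st c) x).
      by rewrite /f' zE => /negPf ->.
    have [->|up] := eqVneq u p; last first.
      rewrite add0r; apply: eq_big => c /=; rewrite mem_rcons inE.
        by case: (c =P v) => [->|//]; rewrite eq_sym (negPf up) !andbF.
      case: (c =P v) => [->|/eqP cv _]; last exact: other.
      by move=> /= /eqP e; case/eqP: up; rewrite -e.
    rewrite (bigD1 v) /=; last by rewrite mem_rcons inE !eqxx.
    rewrite /f' zE eqxx; congr (_ + _)%R; apply: eq_big => c.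
      rewrite mem_rcons inE; case: (c =P v) => [->|_] /=; last by rewrite andbT.
      by rewrite andbF (negPf vD).
    by move=> /andP[_ cv]; rewrite -other.
  have kids u c : u \in rcons D v -> (c != r) && (pr c == u) = (c \in D) && (pr c == u).
    rewrite mem_rcons inE => uD; case: (pr c =P u) => [pc|_]; last by rewrite !andbF.
    rewrite !andbT; apply/idP/idP => [cr|cD].
      by case: (u =P v) uD => [uv _|_ /= uD]; [apply: topo_v; rewrite -?uv | apply: topo_D uD].
    by apply: contraNneq rs => <-; exact: mem_take cD.
  have kidsE u x : u \in rcons D v ->
      (\sum_(c | (c != r) && (pr c == u)) f' c (clamp gam (zeros st' c) x) =
       \sum_(c | (c \in D) && (pr c == u)) f c (clamp gam (zeros st c) x))%R.
    move=> uD; apply: eq_big => c; first exact: kids.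
    rewrite kids // => /andP[cD _]; rewrite /f' zE.
    by case: (c =P v) cD => [->|//]; rewrite (negPf vD).
  split.
  + exact: holds_tree_eq seq' ht.
  + exact: F'.
  + rewrite take' => u uD; rewrite /L'.
    have ext l G G' : (forall x, G x = G' x) -> stores st' (num u) l G ->
        stores st' (num u) l G'.
      by move=> GG [h1 h2 h3 h4 h5]; split=> // x; rewrite -GG h5.
    have pdE x : partial_deriv f' (zeros st') (mem (rcons D v)) u x =
       (partial_deriv f (zeros st) (mem D) u x +
        (if u == p then Fv (clamp gam mv x) else 0))%R.
      by rewrite /partial_deriv sumE; ring.
    move: uD; rewrite mem_rcons inE negb_or => /andP[uv uD].
    have [up|up] := eqVneq u p.
      by rewrite up in ext pdE *; apply: ext sto' => x; rewrite pdE eqxx hg.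
    apply: ext (frS _ _ _ _ _ (sto u uD)); rewrite ?num_eq //.
    by move=> x; rewrite pdE (negPf up) addr0.
  rewrite take' => u; rewrite mem_rcons inE /f' zE.
  have [-> _|uv /= uD] := eqVneq u v.
    split=> //= x; rewrite /Fv /partial_deriv kidsE //.
    by rewrite mem_rcons inE eqxx.
  have uD' : u \in rcons D v by rewrite mem_rcons inE uD orbT.
  have [h1 h2 h3] := der u uD; split=> // x; rewrite h3 /partial_deriv kidsE //.
  by congr (_ + _)%R; apply: eq_bigl => c /=; exact: kids.
have kv : count_of st v <= 2 * i by rewrite -cntE rest_split leq_addr.
rewrite /cost_inv take' i' !rest_split'.
rewrite (eq_bigr (count_of st)) => [|u /cntr //].
rewrite [X in 3500 * (_ + X)](eq_bigr (fun u => potential (count_of st u)));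
  last by move=> u /cntr ->.
rewrite !rest_split in cntE kE; rewrite cntp; split.
  by move: cntE; rewrite -/i; clear; lia.
have szL : size (L v) <= 2 * #|V|.
  have [_ _ _ -> _] := sto v vD.
  by move: kv lt sizeN; rewrite /count_of; clear; lia.
have lgL : trunc_log 2 (size (L v)) <= trunc_log 2 (2 * #|V|) by exact: leq_trunc_log.
have potv : potential (count_of st v) <= potential (count_of st v).+2.
  by apply: leq_potential; rewrite -addn2 leq_addr.
move: kj kE lgL potv; rewrite /step_cost -!/(count_of _ _) -/i mulnS.
set rest := \sum_(u | _) _.
generalize (potential (count_of st v)) (potential (count_of st v).+2)
  (potential (count_of st p)) (potential ((count_of st v).+2 + count_of st p)).
generalize (trunc_log 2 (size (L v))) (trunc_log 2 (2 * #|V|)) => a b.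
generalize ((2830 * b + 7 * 1000 + 1) * i) => C.
by clear; lia.
Qed.

(** * Initialisation passes *)

Lemma run_for_all (cm : cmd) (I : nat -> state R -> Prop) K st :
  (forall j st', I j st' -> j < ivar st 0 -> ivar st' 0 = ivar st 0 ->
     ivar st' 26 = j -> run cm st' (fun k st2 =>
       [/\ I j.+1 (set_ivar st2 26 j.+1), ivar st2 0 = ivar st 0,
           ivar st2 26 = j & k <= K])) ->
  I 0 (set_ivar st 26 0) ->
  run (for_all_vertices cm) st (fun k st' =>
    [/\ I (ivar st 0) st', ivar st' 0 = ivar st 0 & k <= (K + 2) * ivar st 0 + 2]).
Proof.
move=> step I0; set n := ivar st 0 in step *.
pose J k st' := [/\ I (ivar st' 26) st', ivar st' 0 = n, ivar st' 26 <= n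
  & k <= (K + 2) * ivar st' 26].
apply: ev_seq; apply: ev_iset.
apply: (ev_conseq (ev_while (I := J) (mu := fun st' => n - ivar st' 26) _ (k := 0) _)).
- move=> k s1 [h1 h2 _ h4]; rewrite /= -ltnNge h2 => lt.
  apply: ev_seq; apply: (ev_conseq (step _ _ h1 lt h2 erefl)).
  move=> j s2 _ [g1 g2 g3 g4]; apply: ev_iset; rewrite /J /= /upd /= g3.
  split; first split=> //.
    by move: h4 g4; rewrite mulnS; clear; lia.
  by move: lt; clear; lia.
- by rewrite /J /= /upd /= muln0.
move=> k s1 _ [/=]; rewrite negbK => ge [j -> [h1 h2 h3 h4]].
rewrite h2 in ge; have e : ivar s1 26 = n by apply/eqP; rewrite eqn_leq h3.
by rewrite e in h1 h4; split=> //; move: h4; clear; lia.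
Qed.

Definition vertex_ready (b : nat -> R) st y :=
  [/\ iarr st 20 y = 0, iarr st 24 y = 0
    & exists l, stores st y l (fun x => x - b y)%R].

Definition ready_inv st j st' := [/\ static_eq st st', 0 < ivar st' 1
  & forall y, y < j -> vertex_ready (rarr st 0) st' y].

Lemma run_init_vertices st : 0 < ivar st 1 ->
  run (for_all_vertices init_vertex) st (fun k st' =>
    ready_inv st (ivar st 0) st' /\ k <= 25 * ivar st 0 + 2).
Proof.
move=> F0; apply: (ev_conseq (run_for_all (K := 23) (I := ready_inv st) _ _)); last first.
- by move=> k st' _ [h1 _ h2].
- by [].
move=> j s0 [[e1 e2 e3 e4] F rdy] lt i0 i26.
apply: ev_seq; apply: ev_iput; do 3![apply: ev_seq; apply: ev_iset].
do 3![apply: ev_seq; apply: ev_rset].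
set s1 := set_rvar _ 4 _.
have hp1 : heap_le s0 s1 by [].
have i1 x : x \notin [:: 9; 11; 12] -> ivar s1 x = ivar s0 x.
  by rewrite /s1 /= /upd !inE => /norP[/negPf -> /norP[/negPf -> /negPf ->]].
have [i19 i111 i112] : [/\ ivar s1 9 = 1, ivar s1 11 = 0 & ivar s1 12 = 0] by [].
have [r12 r13 r14] : [/\ rvar s1 2 = 0, rvar s1 3 = 0 & rvar s1 4 = 0]%R by [].
have r1 : rvar s1 0 = rvar s0 0 by [].
have a1 x : x != 20 -> iarr s1 x = iarr s0 x by rewrite /s1 /= /upd => /negPf ->.
have a120 : iarr s1 20 = upd (iarr s0 20) j 0 by rewrite /s1 /= /upd /= i26.
have b1 : rarr s1 = rarr s0 by [].
clearbody s1.
apply: ev_seq; apply: run_alloc_frame => s2 hp2 i2 r2 a2 b2 [c1 c2 c3] [c4 c5 c6].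
have i226 : ivar s2 26 = j by rewrite i2 /= (i1 26).
do 3![apply: ev_seq; apply: ev_iput]; apply: ev_seq; apply: ev_rput; apply: ev_rput.
set s3 := set_rarr _ 21 _ _.
have i3 : ivar s3 = ivar s2 by [].
have r3 : rvar s3 = rvar s2 by [].
have a3 x : x \notin [:: 22; 23; 24] -> iarr s3 x = iarr s2 x.
  by rewrite /s3 /= /upd !inE => /norP[/negPf -> /norP[/negPf -> /negPf ->]].
have b3 x : x \notin [:: 20; 21] -> rarr s3 x = rarr s2 x.
  by rewrite /s3 /= /upd !inE => /norP[/negPf -> /negPf ->].
have a3y a y : y != j -> iarr s3 a y = iarr s2 a y.
  by move=> yj; rewrite /s3 /= i226 !upd_row_off.
have b3y a y : y != j -> rarr s3 a y = rarr s2 a y.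
  by move=> yj; rewrite /s3 /= i226 !upd_row_off.
have [a322 a323 a324] : [/\ iarr s3 22 j = ivar s1 1, iarr s3 23 j = 0 & iarr s3 24 j = 0].
  by rewrite /s3 /= /upd /= i226 eqxx i2.
have [b320 b321] : (rarr s3 20 j = 1 /\ rarr s3 21 j = 0 - rarr s2 0 j)%R.
  by rewrite /s3 /= /upd /= i226 eqxx.
have hp3 : heap_le s2 s3 by split=> [|x _]; rewrite ?i3 ?a3 ?b3.
clearbody s3.
have hp03 := heap_le_trans hp1 (heap_le_trans hp2 hp3).
have F3 : ivar s1 1 < ivar s3 1 by rewrite i3 i2.
have F1 : 0 < ivar s1 1 by rewrite i1.
split=> //; last first.
- by rewrite i3.
- by rewrite i3 i2 /= (i1 0).
split=> [| |y].
- split; rewrite /= ?/upd /=.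
  + by rewrite i3 i2 /= (i1 0) ?i0.
  + by rewrite r3 r2 r1.
  + by rewrite a3 // a2 // a1.
  + by rewrite b3 // b2 // b1.
- by rewrite /= /upd /=; exact: leq_trans F3.
rewrite ltnS leq_eqVlt => /predU1P[->|yj]; last first.
  have [h1 h2 [l h3]] := rdy y yj.
  have {}yj : y != j by rewrite ltn_eqF.
  split=> /=.
  - by rewrite a3y // a2 // a120 /upd (negPf yj).
  - by rewrite a3y // a2 // a1.
  exists l; apply: stores_le h3 => /=.
  - exact: hp03.
  - by rewrite a3y // a2 // a1.
  - by rewrite a3y // a2 // a1.
  - by rewrite a3y // a2 // a1.
  - by rewrite b3y // b2 // b1.
  - by rewrite b3y // b2 // b1.
split=> /=; first by rewrite a3 // a2 // a120 /upd eqxx.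
- by [].
exists [:: (0, 0, true)%R]; split => /=.
- exists (Cell (0, 0, true)%R Nil Nil); rewrite a322 a323; split=> //.
  split; rewrite /= ?F1.
  + exact: F3.
  + by rewrite a3 // c1.
  + by rewrite a3 // c2.
  by rewrite a3 // c3 b3 // c4 b3 // c5 b3 // c6 /= i19 r12 r13 r14; split=> //; ring.
- by rewrite eqxx.
- by [].
- by rewrite a324.
by move=> x; rewrite b320 b321 b2 // b1 e4; ring.
Qed.

Lemma num_surj (j : nat) : j < #|V| -> exists u, num u = j :> nat.
Proof.
move=> lt; have : Ordinal lt \in codom num.
  by apply: inj_card_onto => //; rewrite card_ord.
by move=> /codomP[u e]; exists u; rewrite -e.
Qed.

Definition child_count_inv st j st' := [/\
  [/\ forall x, x \notin [:: 22; 26] -> ivar st' x = ivar st x,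
      rvar st' = rvar st, forall x, x != 20 -> iarr st' x = iarr st x
    & rarr st' = rarr st],
  forall u, iarr st' 20 (num u) = #|[pred c | (num c < j) && (pr c == u)]|
& num r < j -> ivar st' 22 = num r].

(** As the root is the only fixed point of [pr], register 22 is not overwritten once it holds the
    root. *)
Lemma run_count_children st : holds_tree st ->
  (forall u, iarr st 20 (num u) = 0) -> (forall u, pr u = u -> u = r) ->
  run (for_all_vertices count_child) st (fun k st' =>
    child_count_inv st #|V| st' /\ k <= 5 * #|V| + 2).
Proof.
move=> [h0 _ par _] deg0 fix_r.
apply: (ev_conseq (run_for_all (K := 3) (I := child_count_inv st) _ _)); last first.
- by rewrite h0; move=> k st' _ [h1 _ h2].
- split=> //; first split=> //.
    by move=> x; rewrite !inE /= /upd => /norP[_ /negPf ->].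
  by move=> u; rewrite /= deg0; apply/esym/eq_card0 => c; rewrite inE.
move=> j s0 [[i1 r1 a1 b1] deg root] lt i0 i26.
rewrite h0 in lt; have [c cj] := num_surj lt.
have pc : iarr s0 0 j = num (pr c) by rewrite a1 // -cj par.
have degE u : #|[pred c0 | (num c0 < j.+1) && (pr c0 == u)]| =
    (pr c == u) + #|[pred c0 | (num c0 < j) && (pr c0 == u)]|.
  rewrite (cardD1 c) inE cj ltnSn; congr (_ + _); apply: eq_card => d.
  rewrite !inE ltnS leq_eqVlt -cj num_eq; case: (d =P c) => [->|//].
  by rewrite ltnn.
have fin (s1 : state R) : (forall x, x \notin [:: 22] -> ivar s1 x = ivar s0 x) ->
    rvar s1 = rvar s0 -> rarr s1 = rarr s0 ->
    iarr s1 = upd (iarr s0) 20 (upd (iarr s0 20) (num (pr c)) (iarr s0 20 (num (pr c))).+1) ->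
    ivar s1 22 = (if pr c == c then j else ivar s0 22) ->
    [/\ child_count_inv st j.+1 (set_ivar s1 26 j.+1), ivar s1 0 = ivar st 0
      & ivar s1 26 = j].
  move=> i2 r2 b2 a2 i22; split; try by rewrite i2 // ?i1.
  split; [split|..] => /=.
  - move=> x xn; move: (xn); rewrite !inE /upd => /norP[x22 /negPf ->].
    by rewrite i2 ?inE // i1.
  - by rewrite r2.
  - by move=> x xn; rewrite a2 /upd (negPf xn) a1.
  - by rewrite b2.
  - move=> u; rewrite degE a2 /upd /= num_eq eq_sym -deg.
    by case: eqP => [->|_].
  rewrite /upd /= i22 ltnS leq_eqVlt -cj num_eq.
  case: (r =P c) => [<-|rc]; first by rewrite pr_r eqxx.
  by case: eqP => [/fix_r cr|_]; [case: rc | rewrite cj].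
apply: ev_seq; apply: ev_iput; apply: ev_if.
rewrite (_ : beval _ _ = (pr c == c)); last by rewrite /= /upd /= i26 pc -cj num_eq.
have [e|e] := boolP (pr c == c).
  apply: ev_iset; have [| | | | |h1 h2 h3] := fin (set_ivar
    (set_iarr s0 20 (ieval s0 (IGet 0 (IVar 26)))
       (ieval s0 (ISucc (IGet 20 (IGet 0 (IVar 26)))))) 22 (ivar s0 26)) => //.
  - by move=> x; rewrite inE /= /upd => /negPf ->.
  - by rewrite /= i26 pc.
  - by rewrite /= /upd /= e i26.
apply: ev_skip; have [| | | | |h1 h2 h3] := fin (set_iarr s0 20 (ieval s0 (IGet 0 (IVar 26)))
       (ieval s0 (ISucc (IGet 20 (IGet 0 (IVar 26)))))) => //.
- by rewrite /= i26 pc.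
- by rewrite /= (negPf e).
Qed.

Definition leaves_inv st j st' := [/\ forall x, x \notin [:: 21; 26] -> ivar st' x = ivar st x,
  rvar st' = rvar st, forall x, x != 21 -> iarr st' x = iarr st x
& rarr st' = rarr st] /\ exists s,
  [/\ uniq s, forall u, (u \in s) = (num u < j) && (iarr st 20 (num u) == 0),
      ivar st' 21 = size s
    & forall i, i < size s -> iarr st' 21 i = num (nth r s i)].

Lemma run_enqueue_leaves st : ivar st 0 = #|V| -> ivar st 21 = 0 ->
  run (for_all_vertices enqueue_leaf) st (fun k st' =>
    leaves_inv st #|V| st' /\ k <= 5 * #|V| + 2).
Proof.
move=> h0 i21.
apply: (ev_conseq (run_for_all (K := 3) (I := leaves_inv st) _ _)); last first.
- by rewrite h0; move=> k st' _ [h1 _ h2].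
- split; last by exists [::]; split.
  by split=> // x; rewrite !inE /= /upd => /norP[_ /negPf ->].
move=> j s0 [[i1 r1 a1 b1] [s [us sE sz qE]]] lt i0 i26.
rewrite h0 in lt; have [c cj] := num_surj lt.
have ltE u : (num u < j.+1) = (u == c) || (num u < j).
  by rewrite ltnS leq_eqVlt -cj num_eq.
apply: ev_if; rewrite (_ : beval _ _ = (iarr st 20 j == 0)); last by rewrite /= a1 ?i26.
have [d0|d0] := boolP (iarr st 20 j == 0); last first.
  apply: ev_skip; split=> //.
  split; first split=> //.
    move=> x xn; move: (xn); rewrite !inE /= /upd => /norP[_ /negPf ->].
    by rewrite i1.
  exists s; split=> // u; rewrite sE ltE; case: (u =P c) => [->|//].
  by rewrite cj (negPf d0) andbF.
apply: ev_seq; apply: ev_iput; apply: ev_iset; split=> //; try by rewrite /= /upd /= ?i1.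
split; first split=> //.
- move=> x xn; move: (xn); rewrite !inE /= /upd => /norP[/negPf -> /negPf ->].
  by rewrite i1.
- by move=> x xn; rewrite /= /upd (negPf xn) a1.
exists (rcons s c); split.
- by rewrite rcons_uniq us sE cj ltnn.
- move=> u; rewrite mem_rcons inE sE ltE; case: (u =P c) => [->|//].
  by rewrite cj d0.
- by rewrite /= /upd /= sz size_rcons.
move=> i; rewrite size_rcons ltnS /= /upd /= nth_rcons sz i26 leq_eqVlt.
by case: eqP => [->|_ /= lti]; [rewrite ltnn cj | rewrite lti qE].
Qed.

(** * Exhaustion of the queue, and output in reverse order *)

Hypothesis reach : forall u, exists n, iter n pr u == r.

Definition depth u := ex_minn (reach u).

Lemma depth_parent c : c != r -> depth (pr c) < depth c.
Proof.
move=> cr; rewrite /depth; case: ex_minnP => m _ min_m.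
case: ex_minnP => -[/eqP c0|n] ; first by rewrite -c0 eqxx in cr.
by rewrite iterSr => /min_m.
Qed.

Lemma fixed_root u : pr u = u -> u = r.
Proof. by move=> fu; have [n /eqP <-] := reach u; elim: n => //= n <-. Qed.

(** An unqueued vertex other than the root, taken at maximal depth, has positive degree, hence an
    unprocessed child; this child is unqueued too and deeper, a contradiction. *)
Lemma all_queued st s : queue_inv st s -> ivar st 20 = size s ->
  forall u, (u \in s) = (u != r).
Proof.
move=> [[us rs _ _] [_ degE sE _]] sz u; rewrite sz take_size in degE.
apply/idP/idP => [|ur]; first by apply: contraTneq => ->.
apply/negPn/negP => us'; have Pu : [pred w | (w \notin s) && (w != r)] u by rewrite /= us'.
case: (arg_maxnP depth Pu) => w /andP[ws wr] max_w.
have : iarr st 20 (num w) != 0 by rewrite -sE.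
rewrite degE -lt0n => /card_gt0P[c]; rewrite inE => /andP[cs /eqP pc].
have cr : c != r by apply: contraNneq wr => cr; rewrite -pc cr pr_r.
have /max_w : [pred w | (w \notin s) && (w != r)] c by rewrite /= cs.
by rewrite /= leqNgt -pc depth_parent.
Qed.

(** Children precede parents in the queue. Going backwards, writing a vertex therefore leaves intact
    the parent values used at the positions already treated. *)
Lemma parent_later st s i j : queue_inv st s -> i <= j -> j < size s ->
  pr (nth r s j) != nth r s i.
Proof.
move=> [[us rs _ _] [_ _ _ topo]] ij js; apply/eqP => e.
have jr : nth r s j != r by apply: contraNneq rs => <-; exact: mem_nth.
have is_ := leq_ltn_trans ij js.
have /(nthP r)[k] := topo i _ is_ jr e.
rewrite size_takel ?(ltnW is_) // => ki; rewrite nth_take // => /eqP.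
rewrite nth_uniq // ?(ltn_trans ki) // => /eqP kj.
by move: ki; rewrite kj ltnNge ij.
Qed.

Definition output_inv st s i st' := [/\
  [/\ rvar st' = rvar st, iarr st' = iarr st,
      forall x, x != 1 -> rarr st' x = rarr st x,
      ivar st' 20 = i & i <= size s],
  rarr st' 1 (num r) = rarr st 1 (num r)
& forall j, i <= j -> j < size s -> let v := nth r s j in
    rarr st' 1 (num v) = clamp gam (zeros st v) (rarr st' 1 (num (pr v)))].

Lemma run_outputs st0 st s : queue_inv st0 s -> holds_tree st ->
  iarr st 21 = iarr st0 21 -> ivar st 20 = size s ->
  run (While (BNot (BIle (IVar 20) (ICst 0))) output_vertex) st (fun k st' =>
    output_inv st s 0 st' /\ k <= 7 * size s + 1).
Proof.
move=> qi [_ hg par _] q21 sz.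
pose J k st' := output_inv st s (ivar st' 20) st' /\ k + 7 * ivar st' 20 <= 7 * size s.
apply: (ev_conseq (ev_while (I := J) (mu := fun st' => ivar st' 20) _ (k := 0) _)).
- move=> k s1 [[[r1 a1 b1 _ le] root out] kE]; rewrite /= -ltnNge => lt.
  case ei : (ivar s1 20) => [|i] in le out kE lt * => //.
  pose v := nth r s i.
  have qv : iarr s1 21 i = num v by rewrite a1 q21; have [_ [-> ]] := qi.
  do 3![apply: ev_seq; apply: ev_iset]; set s2 := set_ivar _ 23 _.
  have i20 : ivar s2 20 = i by rewrite /s2 /= /upd /= ei.
  have i22 : ivar s2 22 = num v by rewrite /s2 /= /upd /= ei.
  have i23 : ivar s2 23 = num (pr v).
    by rewrite /s2 /= /upd /= ei /= qv a1 par.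
  have [r2 a2 b2] : [/\ rvar s2 = rvar s1, iarr s2 = iarr s1 & rarr s2 = rarr s1] by [].
  clearbody s2.
  have vr : v != r by have [[_ rs _ _] _] := qi; apply: contraNneq rs => <-; exact: mem_nth.
  have fin e j : reval s2 e = clamp gam (zeros st v) (rarr s1 1 (num (pr v))) -> j <= 5 ->
      let s3 := set_rarr s2 1 (ieval s2 (IVar 22)) (reval s2 e) in
      J (k + j.+1).+1 s3 /\ ivar s3 20 < i.+1.
    move=> eE j5 s3; rewrite /J /= i20; split; last exact: ltnSn.
    have out3 u : rarr s3 1 (num u) = if u == v then reval s2 e else rarr s1 1 (num u).
      by rewrite /s3 /= /upd /= i22 num_eq b2.
    split; last by move: kE j5; clear; lia.
    split; first split=> //.
    + by rewrite /s3 /= r2.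
    + by rewrite /s3 /= a2.
    + by move=> x x1; rewrite /s3 /= /upd (negPf x1) b2 b1.
    + exact: ltnW.
    + by rewrite out3 eq_sym (negPf vr).
    move=> j' ij js v'; rewrite !out3 (negPf (parent_later qi ij js)) /=.
    case: (v' =P v) => [->|ne]; first by rewrite eE.
    by rewrite out // ltn_neqAle ij andbT; apply/eqP => e'; case: ne; rewrite /v' -e'.
  have e1 : reval s2 (RGet 1 (IVar 23)) = rarr s1 1 (num (pr v)) by rewrite /= i23 b2.
  have e2 : reval s2 (RGet 22 (IVar 22)) = zeros st v by rewrite /= i22 b2 b1.
  have e3 : reval s2 (RVar 0) = gam by rewrite /= r2 r1.
  apply: ev_if; rewrite /= -/(reval s2 (RGet 1 (IVar 23))) -/(reval s2 (RGet 22 (IVar 22))).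
  rewrite e1 e2; case: leP => [h|/ltW h].
    by apply: ev_rput; apply: (fin _ 4) => //; rewrite e1 clamp_left.
  apply: ev_if; rewrite /= -/(reval s2 (RGet 1 (IVar 23))) -/(reval s2 (RGet 22 (IVar 22))).
  rewrite -/(reval s2 (RVar 0)) e1 e2 e3; case: leP => [h'|/ltW h'].
    by apply: ev_rput; apply: (fin _ 5) => //; rewrite e2 clamp_mid.
  apply: ev_rput; apply: (fin _ 5) => //; rewrite clamp_right //.
  by rewrite /= -/(reval s2 (RGet 1 (IVar 23))) e1 -/(reval s2 (RVar 0)) e3.
- rewrite /J sz; split=> //; split=> // j sj js.
  by move: (leq_trans js sj); rewrite ltnn.
move=> k st' _ [/=]; rewrite negbK leqn0 => /eqP e0 [j -> []].
by rewrite e0 => h kE; split=> //; move: kE; clear; lia.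
Qed.

Lemma initial_loop_inv st0 st1 st2 st3 : holds_tree st0 ->
  ready_inv st0 #|V| st1 -> child_count_inv st1 #|V| st2 ->
  (forall x, x != 21 -> iarr st3 x = iarr st2 x) -> rarr st3 = rarr st2 ->
  rvar st3 = rvar st2 -> ivar st3 0 = ivar st2 0 -> ivar st3 1 = ivar st2 1 ->
  ivar st3 20 = 0 -> ivar st3 27 = num r ->
  (exists s, [/\ uniq s, forall u, (u \in s) = (iarr st2 20 (num u) == 0),
     ivar st3 21 = size s
   & forall i, i < size s -> iarr st3 21 i = num (nth r s i)]) ->
  loop_inv 0 0 st3.
Proof.
move=> ht [seq1 F1 rdy] [[i2 r2 a2 b2] deg2 _] a3 b3 r3 i30 i31 i320 i327 [s [us sE sz qE]].
have degE u : iarr st3 20 (num u) = #|[pred c | (c \notin [::]) && (pr c == u)]|.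
  by rewrite a3 // deg2; apply: eq_card => c; rewrite !inE ltn_ord.
have deg_child c u : pr c = u -> u \notin s.
  move=> pc; rewrite sE -(a3 20) // degE -lt0n; apply/card_gt0P.
  by exists c; rewrite inE pc eqxx.
have hp : heap_le st1 st3.
  by split=> [|x _]; rewrite ?i31 ?i2 // !a3 // b3 b2 !a2.
have rdy3 u : exists l, stores st3 (num u) l (fun x => x - t u)%R.
  have [_ _ [l sl]] := rdy _ (ltn_ord (num u)); exists l.
  have [_ _ _ <-] := ht; apply: stores_le sl; rewrite ?a3 ?a2 ?b3 ?b2 //.
have [L Lstores] := choice rdy3.
have cnt u : count_of st3 u = 0.
  by rewrite /count_of a3 // a2 //; have [] := rdy _ (ltn_ord (num u)).
exists s, (fun _ _ => 0%R), L; rewrite /queue_inv /deriv_inv /cost_inv i320 take0.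
split=> //.
- split; split=> //.
  + exact: (deg_child r).
  + by move=> u; rewrite sE a3.
  by move=> j c js _ /deg_child; rewrite mem_nth.
- split=> //.
  + apply: holds_tree_eq (holds_tree_eq seq1 ht); split; rewrite ?i30 ?r3 ?a3 ?b3 //.
    * by rewrite i2.
    * by rewrite r2.
    * by rewrite a2.
    * by rewrite b2.
  + by rewrite i31 i2.
  move=> u _; have [h1 h2 h3 h4 h5] := Lstores u; split=> // x.
  by rewrite /partial_deriv big_pred0 ?addr0 // -h5.
by split=> //; rewrite big1.
Qed.

(** The hypotheses of [lir_optimal], for the output read from the final state. *)
Definition optimality_certificate st := exists f (m : V -> R),
  [/\ forall u x, f u x = partial_deriv f m [pred c | c != r] u x,
      forall u, steep (f u), forall u, f u (m u) = 0%R,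
      output num st r = m r
    & forall c, c != r -> output num st c = clamp gam (m c) (output num st (pr c))].

Lemma run_main st : holds_tree st ->
  run main st (fun k st' => optimality_certificate st' /\
    k < 24 * 1000 * (#|V|.+1 * (trunc_log 2 #|V|).+1)).
Proof.
move=> ht; have [h0 _ _ _] := ht; have n0 : 0 < #|V| by apply/card_gt0P; exists r.
apply: ev_seq; apply: ev_iset; set s0 := set_ivar _ _ _.
have ht0 : holds_tree s0 by apply: holds_tree_eq ht.
have F0 : 0 < ivar s0 1 by [].
have h00 : ivar s0 0 = #|V| by [].
clearbody s0.
apply: ev_seq; apply: (ev_conseq (run_init_vertices F0)) => k1 s1 _ [rdy k1E].
rewrite h00 in rdy k1E; have [seq1 F1 cells] := rdy.
have ht1 := holds_tree_eq seq1 ht0.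
have deg0 u : iarr s1 20 (num u) = 0 by have [] := cells _ (ltn_ord (num u)).
apply: ev_seq; apply: (ev_conseq (run_count_children ht1 deg0 fixed_root)).
move=> k2 s2 _ [cc k2E].
have [[i2 _ _ _] _ /(_ (ltn_ord _)) i222] := cc.
do 3![apply: ev_seq; apply: ev_iset]; set s3 := set_ivar _ 27 _.
have [h1 _ _ _] := ht1.
have h30 : ivar s3 0 = #|V| by rewrite /s3 /= /upd /= i2.
have i321 : ivar s3 21 = 0 by [].
have i31 : ivar s3 1 = ivar s2 1 by [].
have i320 : ivar s3 20 = 0 by [].
have i327 : ivar s3 27 = num r by rewrite /s3 /= /upd /= i222.
have i300 : ivar s3 0 = ivar s2 0 by [].
have [r3 a3 b3] : [/\ rvar s3 = rvar s2, iarr s3 = iarr s2 & rarr s3 = rarr s2] by [].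
clearbody s3.
apply: ev_seq; apply: (ev_conseq (run_enqueue_leaves h30 i321)).
move=> k4 s4 _ [[[i4 r4 a4 b4] [s [us sE sz qE]]] k4E].
have inv0 : loop_inv 0 0 s4.
  apply: (initial_loop_inv ht0 rdy cc) => [x x21|||||||].
  - by rewrite a4 // a3.
  - by rewrite b4.
  - by rewrite r4.
  - by rewrite i4.
  - by rewrite i4.
  - by rewrite i4.
  - by rewrite i4.
  by exists s; split=> // u; rewrite sE ltn_ord a3.
apply: ev_seq.
apply: (ev_conseq (ev_while (I := loop_inv 0) (mu := fun st' => #|V| - ivar st' 20) _ inv0)).
  move=> k s' inv; rewrite /= -ltnNge; exact: run_process_inv.
move=> k5 s5 _ [/=]; rewrite negbK => exit [j -> ].
move=> [{us sE sz qE}s [f [L [qi [ht5 F5 sto der] [cntE kE] i527]]]].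
have [[us rs le sz] _] := qi.
have e20 : ivar s5 20 = size s by apply/eqP; rewrite eqn_leq le -sz.
have all_s := all_queued qi e20.
rewrite e20 take_size in sto der cntE kE.
(* Only the root is left unprocessed, so the remaining potential is that of a single list. *)
have rest (G : V -> nat) : \sum_(u | u \notin s) G u = G r.
  by rewrite (eq_bigl (pred1 r)) ?big_pred1_eq // => u; rewrite all_s negbK.
rewrite !rest in cntE kE.
have sizeN : size s < #|V|.
  rewrite -(card_uniqP us) -[X in _ < X](cardC (mem s)) -[X in X < _]addn0 ltn_add2l.
  by apply/card_gt0P; exists r; rewrite !inE.
have stF : steep (partial_deriv f (zeros s5) (mem s) r).
  by apply: partial_deriv_steep => c cs; have [] := der c cs.
apply: ev_seq; apply: ev_iset; set s6 := set_ivar _ 22 _.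
have i622 : ivar s6 22 = num r by rewrite /s6 /= /upd /= i527.
have st6 : stores s6 (num r) (L r) (partial_deriv f (zeros s5) (mem s) r).
  by have := sto r rs; exact: stores_le.
apply: ev_seq; apply: (ev_conseq (run_solve i622 st6 stF)) => k7 s7 x7 [m [sp z7 k7E]].
have [i7 r7 a7 b7] : agree_off scratch_ivars scratch_ivars scratch_iarrs
    [pred x | scratch_rarrs x || (x == 22)] s6 s7.
  apply: (exec_agree (F := scratch_procs) _ x7); last by [].
  by apply: scratch_procs_only => // x /= ->.
have Fm : partial_deriv f (zeros s5) (mem s) r m = 0%R.
  by case: sp => l1 [g [d [b [l2 []]]]].
apply: ev_seq; apply: ev_rput; set s8 := set_rarr _ 1 _ _.
have i822 : ieval s7 (IVar 22) = num r by rewrite /= i7.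
have ht8 : holds_tree s8.
  apply: holds_tree_eq ht5; split; rewrite /s8 /=.
  - by rewrite i7.
  - by rewrite r7.
  - by rewrite a7.
  - by rewrite /upd /= b7.
have q8 : iarr s8 21 = iarr s5 21 by rewrite /s8 /= a7.
have i820 : ivar s8 20 = size s by rewrite /s8 /= i7.
have out8 : rarr s8 1 (num r) = m.
  by rewrite /s8 i822 /= /upd /= i7 // i622 eqxx z7 /upd eqxx.
have z8 u : zeros s8 u = if u == r then m else zeros s5 u.
  by rewrite /zeros /s8 /= /upd /= z7 /upd num_eq.
clearbody s8; clear i822.
apply: (ev_conseq (run_outputs qi ht8 q8 i820)) => k9 s9 _ [[[r9 a9 b9 i9 _] o9 outs] k9E].
split.
  (* The root is never dequeued; its function is complete once all the other vertices are
     processed. *)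
  pose f' u := if u == r then partial_deriv f (zeros s5) (mem s) r else f u.
  exists f', (zeros s8); split.
  - move=> u x; have sumE : (\sum_(c | mem s c && (pr c == u)) f c (clamp gam (zeros s5 c) x) =
        \sum_(c | (c != r) && (pr c == u)) f' c (clamp gam (zeros s8 c) x))%R.
      apply: eq_big => c /=; rewrite all_s // => /andP[/negPf cr _].
      by rewrite /f' z8 cr.
    rewrite {1}/f' /partial_deriv -sumE; case: (u =P r) => [->//|/eqP ur].
    have us' : u \in s by rewrite all_s.
    have [_ _ ->] := der u us'; rewrite /partial_deriv; congr (_ + _)%R.
    by apply: eq_bigl => c /=; rewrite all_s.
  - move=> u; rewrite /f'; case: (u =P r) => // /eqP; rewrite -all_s => /der[].
    by [].
  - move=> u; rewrite /f' z8; case: (u =P r) => // /eqP; rewrite -all_s => /der[].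
    by [].
  - by rewrite /output o9 out8 z8 eqxx.
  move=> c cr; have cs : c \in s by rewrite all_s.
  by have := outs (index c s) isT; rewrite index_mem nth_index //=; exact.
have szL : size (L r) <= 2 * #|V|.
  have [_ _ _ -> _] := sto r rs.
  by move: cntE sizeN; rewrite /count_of; clear; lia.
have lgL : trunc_log 2 (size (L r)) <= (trunc_log 2 #|V|).+1.
  by rewrite -trunc_logMp //; exact: leq_trunc_log.
have pot : potential (count_of s5 r) <= 4 * (#|V| * (trunc_log 2 #|V|).+1).
  have le2 : count_of s5 r <= 2 * #|V| by move: cntE sizeN; clear; lia.
  apply: leq_trans (leq_potential le2) _.
  by rewrite /potential trunc_logMp // !mulnA.
have stepE : step_cost * size s <= (2830 * (trunc_log 2 #|V|).+1 + 7 * 1000 + 1) * #|V|.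
  by rewrite /step_cost trunc_logMp // leq_mul // ltnW.
(* In units of [n * l], the loop accounts for 2830 + 7001 and the potential for 3500 * 4; the other
   passes fit into the rest of the 24000. *)
move: k1E k2E k4E kE k7E k9E lgL pot stepE sizeN.
rewrite !add0n; move: (step_cost * size s) (potential _) (trunc_log 2 (size (L r))) => A B C.
move: #|V| (size s) => n z; have : 0 < (trunc_log 2 n).+1 by [].
move: (trunc_log 2 n).+1 => l; clear.
rewrite (_ : (2830 * l + _ + 1) * n = 2830 * (n * l) + (7 * 1000 + 1) * n); last by ring.
rewrite (mulSn n l); have : 0 < l -> n <= n * l by move=> l0; rewrite leq_pmulr.
by move: (n * l) => P h1 h2; have {}h1 := h1 h2; lia.
Qed.

End Main.

(** The root is made its own parent, as in the input array; the parent map becomes total, and paths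
    to the root become its iterates. *)
Lemma rooted_parent (V : finType) (A : rel V) (r : V) : rooted_tree A r ->
  exists pr : V -> V, [/\ pr r = r, forall u v, A u v = (u != r) && (pr u == v)
    & forall u, exists n, iter n pr u == r].
Proof.
move=> [Ar par reach].
have /choice[pr prE] u : exists v, if u == r then v = r else A u v /\ forall w, A u w -> v = w.
  by case: (u =P r) => [_|/eqP/par[v [Av uni]]]; [exists r | exists v].
have AE u v : A u v = (u != r) && (pr u == v).
  have := prE u; case: (u =P r) => [-> _|_ [Au uni]] /=; first exact/negbTE.
  by apply/idP/eqP => [/uni|<-].
exists pr; split=> //; first by have := prE r; rewrite eqxx.
move=> u; have /connectP[p] := reach u; elim: p u => [|v p IH] u /=.
  by move=> _ ->; exists 0%N.
rewrite AE => /andP[/andP[_ /eqP puv] pv] rE; have [n itn] := IH v pv rE.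
by exists n.+1; rewrite iterSr puv.
Qed.

Unset Implicit Arguments.

Theorem theorem4 (R : realType) :
  exists (p : program) (T : nat -> nat),
    ((fun n : nat => (T n)%:R : R^o) =O_\oo
       (fun n : nat => n%:R * ln n%:R : R^o)) /\
    forall (V : finType) (A : rel V) (r : V) (num : V -> 'I_#|V|)
           (t : V -> R) (gamma : R) (st : state R),
      rooted_tree A r -> injective num -> 0 <= gamma ->
      holds_input A r num t gamma st ->
      exists (k : nat) (st' : state R),
        [/\ runs p st k st', (k <= T #|V|)%N &
            is_LIR A t gamma (output num st')].
Proof.
pose T n := (24 * 1000 * (n.+1 * (trunc_log 2 n).+1))%N.
exists lir_program, T; split; first exact: nlogn_bigO.
move=> V A r num t gamma st /rooted_parent[pr [pr_r AE reach]] num_inj gam0.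
move=> [h0 hg par par_r ht].
have ht' : holds_tree pr num t gamma st.
  split=> // u; case: (u =P r) => [->|/eqP ur]; first by rewrite pr_r.
  by apply: par; rewrite AE ur eqxx.
have [k [st' [ex [[f [m [fE stp f0 root out]]] kE]]]] := run_main pr_r num_inj gam0 reach ht'.
(* The initial call is one more step, absorbed by the strict bound of [run_main]. *)
exists k.+1, st'; split.
- exact: ExecCall.
- exact: kE.
exact: (lir_optimal (f := f) (m := m) AE gam0).
Qed.
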